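(* In the bond price model described in the context: (1) For every $T\in(0,T_h]$, the asset price process $(P(t,T))_{0\le t\le T}$ is a semimartingale. (2) For every $T\in(0,T_h]$, the discounted asset price $\dfrac{P(t,T)}{P(t,T_h)}$, $0\le t\le T$, is a positive local martingale. (3) If $F$ is a continuous, strictly decreasing nominal forward rate function on $[0,T_h]$ with $F(0)=-\log P(0,T_h)$, then all nominal forward rates within the model are positive; that is, for all $T_1<T_2\le T_h$ and all $t\le T_1$, $$\frac{1}{T_2-T_1}\log\Big(\frac{P(t,T_1)}{P(t,T_2)}\Big)>0 .$$
   Context: $B_t$ is a standard Brownian motion with filtration $(\mathcal F_t)$, $M_t=\exp(B_t-\tfrac t2)$, $A_t=\int_0^tM_s\,ds$. Fix a horizon date $T_h>0$ and a deterministic, positive, continuous, monotone decreasing (nonincreasing) function $T\mapsto P(0,T)$ on $[0,T_h]$ with $P(0,0)=1$ (initial bond prices). The long bond price is, for $0\le t\le T_h$, $$P(t,T_h)=\Big(\frac{P(0,t)}{P(0,T_h)}\Big)^{\left[\frac{-2M_t}{2+A_t\log[P(0,t)/P(0,T_h)]}\right]},$$ and for $T\le T_h$ the $T$-maturity bond price is, for $0\le t\le T$, $$P(t,T)=P(t,T_h)\Big(\frac{P(0,T)}{P(0,T_h)}\Big)^{\left[\frac{2M_t}{2+A_t\log[P(0,T)/P(0,T_h)]}\right]}.$$ The nominal forward rate curve is $F(t)=\log(P(0,t)/P(0,T_h))$, $0\le t\le T_h$. The nominal forward interest rate at time $t\le T_1$ for the period $[T_1,T_2]$, $T_1<T_2$,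 is $\frac{1}{T_2-T_1}\log\big(P(t,T_1)/P(t,T_2)\big)$. *)

(* Defs.v *)
From HB Require Import structures.
From mathcomp Require Import all_boot all_order all_algebra.
From mathcomp Require Import all_classical all_reals all_analysis.

Set Implicit Arguments.
Unset Strict Implicit.
Unset Printing Implicit Defensive.

Import Order.TTheory GRing.Theory Num.Theory.
Import numFieldNormedType.Exports.

Local Open Scope classical_set_scope.
Local Open Scope ring_scope.

(* Time is a real number; filtrations and processes are families indexed by
   the whole of R, of which only the part t >= 0 (or 0 <= t <= T) is ever
   constrained or used. *)

(* No completeness or right-continuity of the filtration is assumed. *)
Definition is_filtration {d : measure_display} {Omega : measurableType d}
    {R : realType} (Fil : R -> set (set Omega)) : Prop :=
  [/\ forall t, 0 <= t -> sigma_algebra setT (Fil t),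
      forall t, 0 <= t -> Fil t `<=` measurable
    & forall s t, 0 <= s -> s <= t -> Fil s `<=` Fil t].

Definition sub_measurable {d : measure_display} {Omega : measurableType d}
    {R : realType} (G : set (set Omega)) (X : Omega -> R) : Prop :=
  forall U : set R, measurable U -> G (X @^-1` U).

Definition adapted {d : measure_display} {Omega : measurableType d}
    {R : realType} (Fil : R -> set (set Omega)) (T : R)
    (X : R -> Omega -> R) : Prop :=
  forall t, 0 <= t <= T -> sub_measurable (Fil t) (X t).

Definition independent_of {d : measure_display} {Omega : measurableType d}
    {R : realType} (P : probability Omega R) (X : Omega -> R)
    (G : set (set Omega)) : Prop :=
  forall (A : set Omega) (U : set R), G A -> measurable U ->
    P (A `&` X @^-1` U) = (P A * P (X @^-1` U))%E.

(* The second parameter of normal_prob is the standard deviation. *)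
Definition brownian_motion {d : measure_display} {Omega : measurableType d}
    {R : realType} (P : probability Omega R) (Fil : R -> set (set Omega))
    (B : R -> Omega -> R) : Prop :=
  [/\ forall t, 0 <= t -> sub_measurable (Fil t) (B t),
      {ae P, forall w, B 0 w = 0},
      forall w, {within `[0, +oo[, continuous (fun t => B t w)},
      forall s t, 0 <= s -> s < t ->
        independent_of P (fun w => B t w - B s w) (Fil s)
    & forall s t, 0 <= s -> s < t -> forall U : set R, measurable U ->
        P ((fun w => B t w - B s w) @^-1` U) =
        normal_prob 0 (Num.sqrt (t - s)) U].

(* Y is a version of E[X | G]. *)
Definition is_cond_exp {d : measure_display} {Omega : measurableType d}
    {R : realType} (P : probability Omega R) (G : set (set Omega))
    (X Y : Omega -> R) : Prop :=
  [/\ sub_measurable G Y,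
      P.-integrable setT (EFin \o Y)
    & forall A, G A ->
        (\int[P]_(w in A) (Y w)%:E = \int[P]_(w in A) (X w)%:E)%E].

Definition martingale {d : measure_display} {Omega : measurableType d}
    {R : realType} (P : probability Omega R) (Fil : R -> set (set Omega))
    (T : R) (X : R -> Omega -> R) : Prop :=
  [/\ adapted Fil T X,
      forall t, 0 <= t <= T -> P.-integrable setT (EFin \o X t)
    & forall s t, 0 <= s -> s <= t -> t <= T ->
        is_cond_exp P (Fil s) (X t) (X s)].

Definition stopping_time {d : measure_display} {Omega : measurableType d}
    {R : realType} (Fil : R -> set (set Omega)) (tau : Omega -> \bar R)
    : Prop :=
  (forall w, (0 <= tau w)%E) /\
  (forall t, 0 <= t -> Fil t [set w | (tau w <= t%:E)%E]).

Definition stopped {d : measure_display} {Omega : measurableType d}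
    {R : realType} (X : R -> Omega -> R) (tau : Omega -> \bar R)
    : R -> Omega -> R :=
  fun t w => X (fine (mine t%:E (tau w))) w.

Definition cadlag {R : realType} (T : R) (f : R -> R) : Prop :=
  (forall t, 0 <= t < T -> f x @[x --> t^'+] --> f t) /\
  (forall t, 0 < t <= T -> cvg (f x @[x --> t^'-])).

(* The localizing sequence tends to +oo, as for a process on [0, +oo[ which is
   constant after T: the stopped processes thus exhaust the closed interval
   [0, T], end point included. *)
Definition local_martingale {d : measure_display} {Omega : measurableType d}
    {R : realType} (P : probability Omega R) (Fil : R -> set (set Omega))
    (T : R) (X : R -> Omega -> R) : Prop :=
  [/\ adapted Fil T X,
      forall w, cadlag T (fun t => X t w)
    & exists tau : nat -> Omega -> \bar R,
        [/\ forall n, stopping_time Fil (tau n),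
            forall n w, (tau n w <= tau n.+1 w)%E,
            {ae P, forall w, tau n w @[n --> \oo] --> +oo%E}
          & forall n, martingale P Fil T (stopped X (tau n))]].

Definition semimartingale {d : measure_display} {Omega : measurableType d}
    {R : realType} (P : probability Omega R) (Fil : R -> set (set Omega))
    (T : R) (X : R -> Omega -> R) : Prop :=
  adapted Fil T X /\
  exists N V : R -> Omega -> R,
    [/\ local_martingale P Fil T N /\ (forall w, N 0 w = 0),
        adapted Fil T V /\ (forall w, V 0 w = 0),
        forall w, cadlag T (fun t => V t w),
        forall w, bounded_variation 0 T (fun t => V t w)
      & forall t w, 0 <= t <= T -> X t w = X 0 w + N t w + V t w].

Definition Mproc {d : measure_display} {Omega : measurableType d}
    {R : realType} (B : R -> Omega -> R) (t : R) (w : Omega) : R :=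
  expR (B t w - t / 2).

Definition Aproc {d : measure_display} {Omega : measurableType d}
    {R : realType} (B : R -> Omega -> R) (t : R) (w : Omega) : R :=
  \int[lebesgue_measure]_(s in `[0, t]) Mproc B s w.

(* P0 T is the initial price P(0, T), and Th the horizon date T_h. *)
Definition initial_bond_curve {R : realType} (Th : R) (P0 : R -> R) : Prop :=
  [/\ forall T, 0 <= T <= Th -> 0 < P0 T,
      {within `[0, Th], continuous P0},
      {in `[0, Th] &, forall S T, S <= T -> P0 T <= P0 S}
    & P0 0 = 1].

Definition forward_curve {R : realType} (Th : R) (P0 : R -> R) (t : R) : R :=
  ln (P0 t / P0 Th).

Definition long_bond {d : measure_display} {Omega : measurableType d}
    {R : realType} (B : R -> Omega -> R) (Th : R) (P0 : R -> R)
    (t : R) (w : Omega) : R :=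
  (P0 t / P0 Th) `^
    (- 2 * Mproc B t w / (2 + Aproc B t w * ln (P0 t / P0 Th))).

Definition bond {d : measure_display} {Omega : measurableType d}
    {R : realType} (B : R -> Omega -> R) (Th : R) (P0 : R -> R)
    (T t : R) (w : Omega) : R :=
  long_bond B Th P0 t w *
  (P0 T / P0 Th) `^
    (2 * Mproc B t w / (2 + Aproc B t w * ln (P0 T / P0 Th))).

Definition forward_rate {d : measure_display} {Omega : measurableType d}
    {R : realType} (B : R -> Omega -> R) (Th : R) (P0 : R -> R)
    (T1 T2 t : R) (w : Omega) : R :=
  (T2 - T1)^-1 * ln (bond B Th P0 T1 t w / bond B Th P0 T2 t w).

(* Main.v *)
(* Write q(a, x) = 2 x / (2 + a x). The price of the T-bond is
   exp (M_t (q(A_t, F(T)) - q(A_t, F(t)))). Since the derivatives of q are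
   - q ^ 2 / 2 in a and 4 / (2 + a x) ^ 2 in x, Ito's formula makes the price minus
   an explicit Stieltjes integral against dt and dF a local martingale. This is
   proved without stochastic integrals: stop M at level n and telescope over a
   uniform grid. On each step the increment splits into a pathwise error, whose
   sum vanishes with the mesh, and a function of M at the end of the step with
   A and F frozen, whose conditional mean is O(h^(3/2)) by the moments of a
   lognormal increment. The discounted price is the price for the zero curve,
   for which the Stieltjes integrals vanish, and the sign of forward rates
   follows from the strict monotonicity of q in x. *)

Require Import Defs.
From HB Require Import structures.
From mathcomp Require Import all_boot all_order all_algebra.
From mathcomp Require Import all_classical all_reals all_analysis.
From mathcomp Require Import measurable_realfun ring lra.

Set Implicit Arguments.
Unset Strict Implicit.
Unset Printing Implicit Defensive.

Import Order.TTheory GRing.Theory Num.Theory.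
Import numFieldNormedType.Exports.

Local Open Scope classical_set_scope.
Local Open Scope ring_scope.

(** Freezing [A] and [F] over a step of length [h] makes the exponent known at the start of the
    step, so that only the law of one increment of [M] is left. A grid has about [1 / h] steps: a
    mean error of order [h ^ (3/2)] in each is small enough, and a third-order Taylor expansion
    delivers it. The obstacle is integrability: the exponential of a positive multiple of a
    lognormal variable has infinite mean, and stopping does not help, since a step begun before the
    stopping time may end anywhere. Hence [M] is moreover truncated at [n + 1]; where the truncation
    acts within a step, the relative increment of [M] is bounded below and a cubic error absorbs
    everything. The curve is only continuous and monotone, so [dF] may be singular; pathwise errors
    are measured against [t - F(t)], a clock that dominates both time and curve. Finally, [B] starts
    at 0 only almost surely, in a filtration that need not be complete: initial values are
    subtracted before localizing, and the limits that prove adaptedness are taken at every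
    outcome. *)

Section exp_taylor.
Context {R : realType}.
Implicit Types x y : R.

(** By the mean value theorem [f y = g c * y] with [|c| <= |y|], and the bound on [g] grows with
    [|x|]: each primitive gains one power. Factorials are given up, since only the order of the
    Taylor remainders of [expR] matters. *)
Lemma norm_le_of_derive (n : nat) (f g : R -> R) y :
  f 0 = 0 -> (forall x, is_derive x 1 f (g x)) ->
  (forall x, `|g x| <= expR `|x| * `|x| ^+ n) ->
  `|f y| <= expR `|y| * `|y| ^+ n.+1.
Proof.
move=> f0 dfg gle.
have cf : continuous f.
  move=> x; apply/differentiable_continuous/derivable1_diffP.
  by case: (dfg x).
have fin c : `|c| <= `|y| -> f y = g c * y -> `|f y| <= expR `|y| * `|y| ^+ n.+1.
  move=> cy ->; rewrite normrM exprSr mulrA ler_wpM2r//.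
  apply: (le_trans (gle c)); apply: ler_pM => //; rewrite ?expR_ge0 ?exprn_ge0//.
    by rewrite ler_expR.
  by rewrite lerXn2r ?nnegrE.
case: (leP 0 y) => y0.
  have [c cI Hc] := MVT_segment y0 (fun x _ => dfg x) (continuous_subspaceT cf).
  apply: (fin c); last by rewrite f0 !subr0 in Hc.
  by move: cI; rewrite in_itv/= => /andP[c0 cy]; rewrite !ger0_norm.
have [c cI Hc] := MVT_segment (ltW y0) (fun x _ => dfg x) (continuous_subspaceT cf).
apply: (fin c); last by rewrite f0 !sub0r mulrN in Hc; apply: oppr_inj.
by move: cI; rewrite in_itv/= => /andP[cy c0]; rewrite !ler0_norm ?lerN2 ?(ltW y0).
Qed.

Lemma expR_taylor1 y : `|expR y - 1| <= expR `|y| * `|y|.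
Proof.
rewrite -[X in _ * X]expr1.
apply: (@norm_le_of_derive 0 (fun x => expR x - 1) expR).
- by rewrite expR0 subrr.
- by move=> x; rewrite -[X in is_derive _ _ _ X]subr0; apply: is_deriveB.
- by move=> x; rewrite expr0 mulr1 ger0_norm ?expR_ge0// ler_expR ler_norm.
Qed.

Lemma expR_taylor2 y : `|expR y - 1 - y| <= expR `|y| * `|y| ^+ 2.
Proof.
apply: (@norm_le_of_derive 1 (fun x => expR x - 1 - x) (fun x => expR x - 1)).
- by rewrite expR0 !subrr.
- move=> x; apply: is_deriveB.
  by rewrite -[X in is_derive _ _ _ X]subr0; apply: is_deriveB.
- by move=> x; rewrite expr1 expR_taylor1.
Qed.

Lemma expR_taylor3 y :
  `|expR y - 1 - y - y ^+ 2 / 2| <= expR `|y| * `|y| ^+ 3.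
Proof.
apply: (@norm_le_of_derive 2 (fun x => expR x - 1 - x - x ^+ 2 / 2)
  (fun x => expR x - 1 - x)).
- by rewrite expR0 expr0n/= mul0r !subrr.
- move=> x; apply: is_deriveB.
    apply: is_deriveB.
    by rewrite -[X in is_derive _ _ _ X]subr0; apply: is_deriveB.
  apply: is_derive_eq; rewrite /GRing.scale/= ?mulr1 ?mulr0 ?add0r ?addr0 ?expr1.
  by rewrite ?expr0 ?mulr1 ?mul0r ?addr0; field.
- by move=> x; exact: expR_taylor2.
Qed.

End exp_taylor.

(** * Stieltjes integrals of continuous functions *)

Section stieltjes.
Context {R : realType}.
Implicit Types (c : cumulative R R) (k : R -> R) (x y s t : R).

(** The half-open interval has measure [c y - c x] and makes the integral additive in its endpoints.
    It is empty for [y <= x], so that [stieltjes c k 0] is a function on the whole line that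
    vanishes at negative times. *)
Definition stieltjes c k x y : R :=
  \int[lebesgue_stieltjes_measure c]_(s in `]x, y]) k s.

Lemma stieltjes_measure_oc c x y : x <= y ->
  lebesgue_stieltjes_measure c `]x, y] = (c y - c x)%:E.
Proof.
move=> xy; rewrite /lebesgue_stieltjes_measure /measure_extension/= measurable_mu_extE/=.
  by rewrite wlength_itv_bnd.
exact: is_ocitv.
Qed.

Lemma stieltjes_integrable c k x y : continuous k ->
  (lebesgue_stieltjes_measure c).-integrable `]x, y] (EFin \o k).
Proof.
move=> ck; have [xy|yx] := leP x y; last first.
  rewrite set_itv_ge ?bnd_simp ?ltW//; first exact: integrable_set0.
  by rewrite -leNgt ltW.
apply: measurable_bounded_integrable => //.
- by rewrite [X in (X < _)%E]stieltjes_measure_oc ?ltry.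
- by apply: measurable_funTS; exact: continuous_measurable_fun.
- have /compact_bounded[M [_ mrt]] :=
    continuous_compact (continuous_subspaceT ck) (@segment_compact R x y).
  exists M; split; first by rewrite num_real.
  move=> r Mr s /=; rewrite in_itv/= => /andP[xs sy]; apply: mrt => //.
  by exists s => //=; rewrite in_itv/= (ltW xs).
Qed.

Lemma stieltjesxx c k x : stieltjes c k x x = 0.
Proof. by rewrite /stieltjes set_itvoc0 Rintegral_set0. Qed.

Lemma stieltjes_ge c k x y : y <= x -> stieltjes c k x y = 0.
Proof.
move=> yx; rewrite /stieltjes set_itv_ge ?Rintegral_set0//.
by rewrite bnd_simp -leNgt.
Qed.

Lemma stieltjesD c k x y z : continuous k -> x <= y -> y <= z ->
  stieltjes c k x z = stieltjes c k x y + stieltjes c k y z.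
Proof.
move=> ck xy yz; rewrite /stieltjes (@itv_bndbnd_setU _ _ _ (BRight y)) ?bnd_simp//.
rewrite Rintegral_setU//=.
- by rewrite -itv_bndbnd_setU ?bnd_simp//; exact: stieltjes_integrable.
- apply/disj_setPS => s [/=]; rewrite 2!in_itv/= => /andP[_ sy] /andP[].
  by rewrite ltNge sy.
Qed.

Lemma eq_stieltjes c k k' x y : (forall s, x < s <= y -> k s = k' s) ->
  stieltjes c k x y = stieltjes c k' x y.
Proof.
move=> kk'; apply: eq_Rintegral => s; rewrite inE/= in_itv/=; exact: kk'.
Qed.

Lemma stieltjes_cst c v x y : x <= y -> stieltjes c (cst v) x y = v * (c y - c x).
Proof.
by move=> xy; rewrite /stieltjes Rintegral_cst// [X in fine X]stieltjes_measure_oc.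
Qed.

Lemma stieltjes_near c k v e x y : continuous k -> x <= y ->
  (forall s, x < s <= y -> `|k s - v| <= e) ->
  `|stieltjes c k x y - v * (c y - c x)| <= e * (c y - c x).
Proof.
move=> ck xy kv.
have le s : x < s <= y -> v - e <= k s <= v + e.
  by move=> /kv; rewrite ler_norml => /andP[]; lra.
have H1 : stieltjes c (cst (v - e)) x y <= stieltjes c k x y.
  apply: le_Rintegral => //; [|exact: stieltjes_integrable|].
    by apply: stieltjes_integrable; exact: cst_continuous.
  by move=> s /=; rewrite in_itv/= => /le /andP[].
have H2 : stieltjes c k x y <= stieltjes c (cst (v + e)) x y.
  apply: le_Rintegral => //; [exact: stieltjes_integrable| |].
    by apply: stieltjes_integrable; exact: cst_continuous.
  by move=> s /=; rewrite in_itv/= => /le /andP[].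
move: H1 H2; rewrite !stieltjes_cst// !mulrDl mulNr => H1 H2.
by rewrite ler_norml; apply/andP; split; lra.
Qed.

Lemma stieltjes_le c k K x y : continuous k -> x <= y ->
  (forall s, x < s <= y -> `|k s| <= K) ->
  `|stieltjes c k x y| <= K * (c y - c x).
Proof.
move=> ck xy kK; have := @stieltjes_near c k 0 K x y ck xy.
by rewrite mul0r subr0; apply=> s /kK; rewrite subr0.
Qed.

Lemma stieltjes_ge0 c k x y : (forall s, 0 <= k s) -> 0 <= stieltjes c k x y.
Proof. by move=> k0; apply: Rintegral_ge0. Qed.

Lemma stieltjesDf c k k' x y : continuous k -> continuous k' ->
  stieltjes c (fun s => k s + k' s) x y = stieltjes c k x y + stieltjes c k' x y.
Proof. by move=> ck ck'; apply: RintegralD => //; exact: stieltjes_integrable. Qed.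

Lemma stieltjesZl c k v x y : continuous k ->
  stieltjes c (fun s => v * k s) x y = v * stieltjes c k x y.
Proof. by move=> ck; apply: RintegralZl => //; exact: stieltjes_integrable. Qed.

Lemma stieltjes_flat c k x y : continuous k -> x <= y -> c x = c y ->
  stieltjes c k x y = 0.
Proof.
move=> ck xy cxy; rewrite /stieltjes /Rintegral null_set_integral//.
  by apply/measurable_EFinP/measurable_funTS; exact: continuous_measurable_fun.
by rewrite [LHS]stieltjes_measure_oc// cxy subrr.
Qed.

Lemma cumulative_le c x y : x <= y -> c x <= c y.
Proof. exact: cumulative_is_nondecreasing. Qed.

(** Increments are at most a bound of [k] times the increments of [c]. The bound is taken on the
    segment up to [|t| + 1], which contains the nonnegative points at distance less than 1 from
    [t]. *)
Lemma stieltjes_continuous c k : continuous (c : R -> R) -> continuous k ->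
  continuous (stieltjes c k 0).
Proof.
move=> cc ck t.
have /compact_bounded[K [_ mrt]] := continuous_compact (continuous_subspaceT ck)
   (@segment_compact R 0 (`|t| + 1)).
have kK s : 0 <= s <= `|t| + 1 -> `|k s| <= `|K| + 1.
  move=> sI; apply: mrt; first by rewrite ltr_pwDr// ler_norm.
  by exists s => //=; rewrite in_itv.
(* Negative times contribute nothing; if [x < 0 < y], only the increment of [c] from 0 to [y] is
   charged. *)
have inc x y : x <= y -> y <= `|t| + 1 ->
    `|stieltjes c k 0 y - stieltjes c k 0 x| <= (`|K| + 1) * (c y - c x).
  move=> xy yt; case: (leP 0 x) => x0.
    rewrite (stieltjesD c ck x0 xy) addrAC subrr add0r.
    apply: stieltjes_le => // s /andP[xs sy].
    by apply: kK; rewrite (le_trans x0 (ltW xs))/= (le_trans sy).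
  rewrite [X in _ - X]stieltjes_ge ?(ltW x0)// subr0.
  have [y0|y0] := leP y 0.
    rewrite stieltjes_ge// normr0 mulr_ge0// ?subr_ge0 ?cumulative_le//.
  apply: (@le_trans _ _ ((`|K| + 1) * (c y - c 0))).
    apply: stieltjes_le; rewrite ?ltW// => s /andP[s0 sy].
    by apply: kK; rewrite (ltW s0)/= (le_trans sy).
  by rewrite ler_wpM2l ?addr_ge0// lerD2l lerN2 cumulative_le// ltW.
apply/cvgrPdist_lt => e e0.
have e1 : 0 < e / (`|K| + 1) by rewrite divr_gt0 ?ltr_wpDl.
have Kgt0 : 0 < `|K| + 1 by rewrite ltr_wpDl.
near=> y.
have yt1 : `|t - y| < 1.
  by near: y; apply: (@cvgr_dist_lt _ _ _ _ _ id t); [exact: cvg_id|].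
have yt : y <= `|t| + 1.
  move: yt1; rewrite distrC => yt1.
  by have := ler_norm (y - t); have := ler_norm t; lra.
have tt : t <= `|t| + 1 by have := ler_norm t; lra.
have cyt : `|c t - c y| < e / (`|K| + 1).
  by near: y; apply: (@cvgr_dist_lt _ _ _ _ _ c (c t)); [exact: cc|].
apply: (@le_lt_trans _ _ ((`|K| + 1) * `|c t - c y|)); last first.
  by rewrite mulrC -ltr_pdivlMr.
case: (leP t y) => ty.
  have h : 0 <= c y - c t by rewrite subr_ge0 cumulative_le.
  by rewrite distrC (distrC (c t)) (ger0_norm h) inc.
have h : 0 <= c t - c y by rewrite subr_ge0 cumulative_le// ltW.
by rewrite (ger0_norm h) inc// ltW.
Unshelve. all: by end_near. Qed.

End stieltjes.

(** * Uniform errors and Riemann sums on grids *)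

Section uniform.
Context {R : realType}.
Implicit Types (c : cumulative R R) (k w : R -> R) (x y s t : R).

Lemma continuous2_diag_unif (K : R -> R -> R) (a b e : R) :
  continuous (fun p : R * R => K p.1 p.2) -> 0 < e ->
  exists2 d : R, 0 < d & forall x x1 x2, a <= x <= b ->
    `|x1 - x| < d -> `|x2 - x| < d -> `|K x1 x2 - K x x| < e.
Proof.
move=> cK e0.
have := @segment_compact R a b; rewrite compact_near_coveringP => cov.
have := cov R (0^'+) (fun d x => forall x1 x2,
    `|x1 - x| < d -> `|x2 - x| < d -> `|K x1 x2 - K x x| < e) _.
case=> [x _|d /= d0 H].
  have e2 : 0 < e / 2 by rewrite divr_gt0.
  have /cvgrPdist_lt /(_ _ e2) [[U V]/=
    [/nbhs_ballP[r r0 rU] /nbhs_ballP[q q0 qV]] UV] := cK (x, x).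
  pose m := Num.min r q.
  have m0 : 0 < m by rewrite /m lt_min r0 q0.
  exists (ball x (m / 2), [set d | 0 < d < m / 2]) => /=.
    split; first by apply: nbhsx_ballx; rewrite divr_gt0.
    near=> d; apply/andP; split; near: d; first exact: nbhs_right_gt.
    by apply: nbhs_right_lt; rewrite divr_gt0.
  move=> [x' d]/= [xx' /andP[d0 dm]] x1 x2 x1x' x2x'.
  have close y : `|y - x'| < d -> U y /\ V y.
    move=> yx'; have : `|x - y| < m.
      move: xx'; rewrite /ball/= => xx'.
      by have := ler_distD x' x y; rewrite (distrC x' y); lra.
    rewrite /m lt_min => /andP[? ?].
    by split; [exact: rU|exact: qV].
  have [Ux1 _] := close _ x1x'; have [_ Vx2] := close _ x2x'.
  have [Ux Vx] : U x' /\ V x' by apply: close; rewrite subrr normr0.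
  have h1 := UV (x1, x2) (conj Ux1 Vx2); have h2 := UV (x', x') (conj Ux Vx).
  rewrite /= in h1 h2.
  by have := ler_distD (K x x) (K x1 x2) (K x' x'); rewrite (distrC (K x1 x2) (K x x)); lra.
exists (d / 2); first by rewrite divr_gt0.
move=> x x1 x2 xI; apply: H => /=; rewrite ?in_itv ?divr_gt0//.
by rewrite sub0r normrN ger0_norm ?divr_ge0 ?ltW// ltr_pdivrMr// ltr_pMr// ltr1n.
Unshelve. all: by end_near. Qed.

Lemma continuous_diag (K : R -> R -> R) :
  continuous (fun z : R * R => K z.1 z.2) -> continuous (fun s => K s s).
Proof. by move=> cK s; apply: (cvg_comp2 cvg_id cvg_id (cK (s, s))). Qed.

(** Error terms that are uniformly negligible against the increments of [w] on short intervals.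
    Summed over a fine grid they telescope to at most [eps * (w b - w a)], hence vanish in the
    limit. *)
Definition smallo (w : R -> R) (a b : R) (e : R -> R -> R) :=
  forall eps : R, 0 < eps -> exists2 d : R, 0 < d &
    forall x y, a <= x -> x <= y -> y <= b -> y - x < d ->
      `|e x y| <= eps * (w y - w x).

Lemma smallo_add w a b e e' : smallo w a b e -> smallo w a b e' ->
  smallo w a b (fun x y => e x y + e' x y).
Proof.
move=> he he' eps eps0; have eps2 : 0 < eps / 2 by rewrite divr_gt0.
have [d d0 hd] := he _ eps2; have [d' d0' hd'] := he' _ eps2.
exists (Num.min d d'); first by rewrite lt_min d0.
move=> x y ax xy yb; rewrite lt_min => /andP[yd yd'].
apply: (le_trans (ler_normD _ _)).
have h1 := hd _ _ ax xy yb yd; have h2 := hd' _ _ ax xy yb yd'.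
by rewrite (splitr eps) mulrDl lerD.
Qed.

Lemma smallo_le w w' a b e :
  (forall x y, x <= y -> w y - w x <= w' y - w' x) ->
  smallo w a b e -> smallo w' a b e.
Proof.
move=> ww' he eps eps0; have [d d0 hd] := he _ eps0; exists d => // x y ax xy yb yxd.
apply: (le_trans (hd _ _ ax xy yb yxd)); apply: ler_wpM2l; [exact: ltW|exact: ww'].
Qed.

Lemma eq_smallo w a b e e' : (forall x y, a <= x -> x <= y -> y <= b -> e x y = e' x y) ->
  smallo w a b e -> smallo w a b e'.
Proof.
move=> ee' he eps eps0; have [d d0 hd] := he _ eps0; exists d => // x y ax xy yb yxd.
by rewrite -ee' ?hd.
Qed.

(* The integrand is frozen at the two endpoints independently. *)
Lemma smallo_stieltjes c (K : R -> R -> R) (p : R -> R) a b :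
  continuous (fun z : R * R => K z.1 z.2) -> continuous p ->
  smallo c a b (fun x y => K x y * stieltjes c p x y -
                           stieltjes c (fun s => K s s * p s) x y).
Proof.
move=> cK cp eps eps0.
have cD := continuous_diag cK.
have /compact_bounded[P [_ mrt]] := continuous_compact (continuous_subspaceT cp)
   (@segment_compact R a b).
have pP s : a <= s <= b -> `|p s| <= `|P| + 1.
  move=> sI; apply: mrt; first by rewrite ltr_pwDr// ler_norm.
  by exists s => //=; rewrite in_itv.
have P0 : 0 < `|P| + 1 by rewrite ltr_wpDl.
have eps1 : 0 < eps / (`|P| + 1) by rewrite divr_gt0.
have [d d0 hd] := continuous2_diag_unif a b cK eps1.
exists d => // x y ax xy yb yxd.
rewrite -stieltjesZl//.
have ck : continuous (fun s => (K x y - K s s) * p s).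
  move=> s; apply: cvgM; last exact: cp.
  by apply: cvgB; [exact: cvg_cst|exact: cD].
rewrite (_ : _ - _ = stieltjes c (fun s => (K x y - K s s) * p s) x y); last first.
  rewrite /stieltjes -RintegralB//.
  - by apply: eq_Rintegral => s _; rewrite mulrBl.
  - by apply: stieltjes_integrable => s; apply: cvgM; [exact: cvg_cst|exact: cp].
  - by apply: stieltjes_integrable => s; apply: cvgM; [exact: cD|exact: cp].
apply: stieltjes_le => // s /andP[xs sy].
rewrite normrM -(divfK (lt0r_neq0 P0) eps).
apply: ler_pM => //; last by apply: pP; lra.
apply: ltW; apply: hd; first lra.
  by rewrite distrC ger0_norm; lra.
by rewrite ger0_norm; lra.
Qed.

(** There are [n.+1] steps, so that the denominator is never zero. *)
Definition grid (a b : R) (n i : nat) : R := a + (b - a) * (i%:R / n.+1%:R).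

Lemma grid0 a b n : grid a b n 0 = a.
Proof. by rewrite /grid mul0r mulr0 addr0. Qed.

Lemma gridn a b n : grid a b n n.+1 = b.
Proof. by rewrite /grid divff ?pnatr_eq0// mulr1 addrC subrK. Qed.

Lemma gridS a b n i : grid a b n i.+1 - grid a b n i = (b - a) / n.+1%:R.
Proof. by rewrite /grid -natr1; field; rewrite lt0r_neq0 ?ltr0n. Qed.

Lemma grid_le a b n i j : a <= b -> (i <= j)%N -> grid a b n i <= grid a b n j.
Proof.
move=> ab ij; rewrite /grid lerD2l ler_wpM2l ?subr_ge0//.
by rewrite ler_pM2r ?invr_gt0 ?ltr0n// ler_nat.
Qed.

Lemma grid_itv a b n i : a <= b -> (i <= n.+1)%N -> a <= grid a b n i <= b.
Proof.
move=> ab i_n; rewrite -{1}(grid0 a b n) -{4}(gridn a b n).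
by rewrite !grid_le.
Qed.

Lemma grid_mesh (a b d : R) : 0 < d -> \forall n \near \oo, (b - a) / n.+1%:R < d.
Proof.
move=> d0; have := @cvgr_dist_lt _ _ _ _ _ (fun n : nat => (b - a) * n.+1%:R^-1) 0.
have /[swap] /[apply] : (b - a) * n.+1%:R^-1 @[n --> \oo] --> (0 : R).
  rewrite -[X in _ --> X](mulr0 (b - a)); apply: cvgMr; exact: cvg_harmonic.
move=> /(_ _ d0) H; near=> n.
have : `|0 - (b - a) / n.+1%:R| < d by near: n.
by rewrite sub0r normrN; apply: le_lt_trans; exact: ler_norm.
Unshelve. all: by end_near. Qed.

Lemma smallo_sum w a b e : a <= b -> smallo w a b e ->
  (forall x y, x <= y -> w x <= w y) ->
  (\sum_(i < n.+1) `|e (grid a b n i) (grid a b n i.+1)|) @[n --> \oo] --> (0 : R).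
Proof.
move=> ab he wnd; apply/cvgrPdist_lt => /= eps eps0.
(* The added 1 keeps the divisor positive when [w] is constant on [[a, b]]. *)
have W0 : 0 < w b - w a + 1 by rewrite ltr_wpDl// subr_ge0 wnd.
have [d d0 hd] := he (eps / (w b - w a + 1)) (divr_gt0 eps0 W0).
near=> n.
rewrite sub0r normrN ger0_norm ?sumr_ge0//.
have mesh : (b - a) / n.+1%:R < d by near: n; exact: grid_mesh.
apply: (@le_lt_trans _ _ (\sum_(i < n.+1) (eps / (w b - w a + 1)) *
   (w (grid a b n i.+1) - w (grid a b n i)))).
  apply: ler_sum => i _; have i_n := ltn_ord i.
  apply: hd; rewrite ?gridS//.
  - by have /andP[] := grid_itv ab (ltnW i_n).
  - exact: grid_le.
  - by have /andP[] := grid_itv ab i_n.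
rewrite -mulr_sumr -(big_mkord xpredT (fun i => w (grid a b n i.+1) - w (grid a b n i))).
rewrite telescope_sumr// gridn grid0 mulrAC ltr_pdivrMr// ltr_pM2l//; lra.
Unshelve. all: by end_near. Qed.

(** This exhibits the integral as a limit of finite sums, from which its adaptedness is deduced
    later. The error is that of [smallo_stieltjes] for a kernel that depends on the left endpoint
    alone. *)
Lemma stieltjes_riemann c k a b : a <= b -> continuous k ->
  (\sum_(i < n.+1) k (grid a b n i) * (c (grid a b n i.+1) - c (grid a b n i)))
    @[n --> \oo] --> stieltjes c k a b.
Proof.
move=> ab ck.
have cK : continuous (fun z : R * R => k z.1).
  by move=> z; apply: continuous_comp; [exact: cvg_fst|exact: ck].
have c1 : continuous (cst 1 : R -> R) by exact: cst_continuous.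
have := @smallo_stieltjes c (fun x _ => k x) (cst 1) a b cK c1.
move=> /(smallo_sum ab) /(_ (@cumulative_le _ c)) h.
have st n : stieltjes c k a b =
    \sum_(i < n.+1) stieltjes c k (grid a b n i) (grid a b n i.+1).
  transitivity (\sum_(0 <= i < n.+1) (stieltjes c k a (grid a b n i.+1) -
      stieltjes c k a (grid a b n i))).
    by rewrite telescope_sumr// gridn grid0 stieltjesxx subr0.
  rewrite big_mkord; apply: eq_bigr => i _; have i_n := ltn_ord i.
  have /andP[ai _] := grid_itv ab (ltnW i_n).
  by rewrite (@stieltjesD _ _ _ a (grid a b n i))// ?grid_le// addrAC subrr add0r.
apply/cvgrPdist_le => /= eps eps0.
have /cvgrPdist_le /(_ _ eps0) hn := h.
near=> n.
have : `|0 - \sum_(i < n.+1) `|k (grid a b n i) *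
    stieltjes c (cst 1) (grid a b n i) (grid a b n i.+1) -
    stieltjes c (fun s => k s * cst 1 s) (grid a b n i) (grid a b n i.+1)| | <= eps by near: n.
rewrite sub0r normrN ger0_norm ?sumr_ge0//; apply: le_trans.
rewrite (st n) distrC -sumrB; apply: (le_trans (ler_norm_sum _ _ _)).
apply: ler_sum => i _; rewrite stieltjes_cst ?grid_le// mul1r.
by rewrite (@eq_stieltjes _ _ (fun s => k s * cst 1 s) k)// => s _; rewrite /= mulr1.
Unshelve. all: by end_near. Qed.

End uniform.

Opaque stieltjes.

(** * The price as a functional of a path *)

Section yield.
Context {R : realType}.
Implicit Types a x : R.

(** The solution in [a] of the Riccati equation [q' = - q ^ 2 / 2] with value [x] at [a = 0]. With
    [a = A_t], the drift [- M ^ 2 * q ^ 2 / 2] of [M * q] cancels half of its bracket, so that the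
    exponential of [M * q] has no drift. *)
Definition yld a x : R := 2 * x / (2 + a * x).

Lemma yld_den a x : 0 <= a -> 0 <= x -> 2 <= 2 + a * x.
Proof. by move=> a0 x0; rewrite lerDl mulr_ge0. Qed.

Lemma yld_den_gt0 a x : 0 <= a -> 0 <= x -> 0 < 2 + a * x.
Proof. by move=> a0 x0; rewrite (lt_le_trans _ (yld_den a0 x0)). Qed.

Lemma yld_ge0 a x : 0 <= a -> 0 <= x -> 0 <= yld a x.
Proof. by move=> a0 x0; rewrite divr_ge0 ?mulr_ge0// ltW ?yld_den_gt0. Qed.

Lemma yld_le a x : 0 <= a -> 0 <= x -> yld a x <= x.
Proof.
move=> a0 x0; rewrite ler_pdivrMr ?yld_den_gt0// mulrC.
by rewrite ler_wpM2l// yld_den.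
Qed.

Lemma yldx0 a : yld a 0 = 0.
Proof. by rewrite /yld mulr0 mul0r. Qed.

(** For [x > 0] the reciprocal [1 / yld a x = 1 / x + a / 2] is affine in [a], hence a difference
    formula without remainder. The same holds in the variable [1 / x], which gives [yldBr]. *)
Lemma yldBl a a' x : 0 <= a -> 0 <= a' -> 0 <= x ->
  yld a' x - yld a x = - (1 / 2) * (yld a x * yld a' x) * (a' - a).
Proof.
move=> a0 a0' x0; rewrite /yld.
have h1 := lt0r_neq0 (yld_den_gt0 a0 x0); have h2 := lt0r_neq0 (yld_den_gt0 a0' x0).
by field; rewrite h1 h2.
Qed.

Lemma yldBr a x x' : 0 <= a -> 0 <= x -> 0 <= x' ->
  yld a x' - yld a x = 4 / ((2 + a * x') * (2 + a * x)) * (x' - x).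
Proof.
move=> a0 x0 x0'; rewrite /yld.
have h1 := lt0r_neq0 (yld_den_gt0 a0 x0); have h2 := lt0r_neq0 (yld_den_gt0 a0 x0').
by field; rewrite h1 h2.
Qed.

Lemma yld_lt a x x' : 0 <= a -> 0 <= x -> x < x' -> yld a x < yld a x'.
Proof.
move=> a0 x0 xx'; have x0' : 0 <= x' by rewrite (le_trans x0)// ltW.
by rewrite -subr_gt0 yldBr// mulr_gt0 ?subr_gt0// divr_gt0// mulr_gt0// yld_den_gt0.
Qed.

Lemma cvg_yld {T : topologicalType} (t : T) (a x : T -> R) :
  0 <= a t -> 0 <= x t -> {for t, continuous a} -> {for t, continuous x} ->
  {for t, continuous (fun s => yld (a s) (x s))}.
Proof.
move=> a0 x0 ca cx; apply: cvgM; first by apply: cvgM; [exact: cvg_cst|].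
apply: cvgV; first exact: lt0r_neq0 (yld_den_gt0 a0 x0).
by apply: cvgD; [exact: cvg_cst|exact: cvgM].
Qed.

End yield.

Section path.
Context {R : realType}.
Variables (lam : R) (c : cumulative R R).
Implicit Types (m : R -> R) (t s x y : R).
Hypothesis lam0 : 0 <= lam.
Hypothesis cc : continuous (c : R -> R).
Hypothesis c0 : forall t, c t <= 0.

Local Notation idc := (idfun : cumulative R R).

Definition area m t := stieltjes idc m 0 t.

Definition expo m t := yld (area m t) lam - yld (area m t) (- c t).

Definition price m t := expR (m t * expo m t).

(* Since [-c] is the forward curve, the drift of [price] is
   [drift_dt dt + drift_dc dc]. *)
Definition drift_dt m t :=
  - (m t ^+ 2 * price m t * yld (area m t) (- c t) * expo m t).

Definition drift_dc m t := m t * price m t * (4 / (2 + area m t * - c t) ^+ 2).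

Definition fvpart m t :=
  stieltjes idc (drift_dt m) 0 t + stieltjes c (drift_dc m) 0 t.

Definition mpart m t := price m t - fvpart m t.

(* The part of the increment of [mpart] that is a function of [m] at [x] and [y]
   and of the state at [x] only. *)
Definition mart_incr m x y := expR (m y * expo m x) - price m x
  - (y - x) / 2 * (m x ^+ 2 * expo m x ^+ 2 * price m x).

Definition pathwise_err m x y := mpart m y - mpart m x - mart_incr m x y.

Lemma idc_continuous : continuous (idc : R -> R).
Proof. by move=> t; exact: cvg_id. Qed.

Lemma Nc_ge0 t : 0 <= - c t. Proof. by rewrite oppr_ge0. Qed.

Lemma Nc_continuous : continuous (fun t => - c t).
Proof. by move=> t; apply: cvgN; exact: cc. Qed.

Section continuity.
Variable m : R -> R.
Hypothesis cm : continuous m.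
Hypothesis m0 : forall t, 0 <= m t.

Lemma area_ge0 t : 0 <= area m t.
Proof. exact: stieltjes_ge0. Qed.

Lemma area_continuous : continuous (area m).
Proof. by apply: stieltjes_continuous => //; exact: idc_continuous. Qed.

Lemma yld_area_continuous (f : R -> R) : continuous f -> (forall t, 0 <= f t) ->
  continuous (fun t => yld (area m t) (f t)).
Proof.
move=> cf f0 t; apply: cvg_yld => //; first exact: area_ge0.
  exact: area_continuous.
exact: cf.
Qed.

Lemma expo_continuous : continuous (expo m).
Proof.
move=> t; apply: cvgB; apply: yld_area_continuous => //.
- by move=> s; exact: cvg_cst.
- exact: Nc_continuous.
- exact: Nc_ge0.
Qed.

Lemma price_continuous : continuous (price m).
Proof.
move=> t; apply: continuous_comp; last exact: continuous_expR.
by apply: cvgM; [exact: cm|exact: expo_continuous].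
Qed.

Lemma drift_dt_continuous : continuous (drift_dt m).
Proof.
move=> t; apply: cvgN; apply: cvgM; last exact: expo_continuous.
apply: cvgM; last first.
  by apply: yld_area_continuous; [exact: Nc_continuous|exact: Nc_ge0].
by apply: cvgM; [apply: cvgM; exact: cm|exact: price_continuous].
Qed.

Lemma drift_dc_continuous : continuous (drift_dc m).
Proof.
move=> t; apply: cvgM; first by apply: cvgM; [exact: cm|exact: price_continuous].
apply: cvgM; first exact: cvg_cst.
apply: cvgV.
  by rewrite expf_neq0// lt0r_neq0// yld_den_gt0 ?area_ge0 ?Nc_ge0.
have h : {for t, continuous (fun t => 2 + area m t * - c t)}.
  apply: cvgD; first exact: cvg_cst.
  by apply: cvgM; [exact: area_continuous|exact: Nc_continuous].
by apply: cvgM; exact: h.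
Qed.

Lemma fvpart_continuous : continuous (fvpart m).
Proof.
move=> t; apply: cvgD; apply: stieltjes_continuous => //.
- exact: idc_continuous.
- exact: drift_dt_continuous.
- exact: drift_dc_continuous.
Qed.

Lemma fvpartB x y : 0 <= x -> x <= y ->
  fvpart m y - fvpart m x =
  stieltjes idc (drift_dt m) x y + stieltjes c (drift_dc m) x y.
Proof.
move=> x0 xy; rewrite /fvpart (stieltjesD idc drift_dt_continuous x0 xy).
rewrite (stieltjesD c drift_dc_continuous x0 xy).
move: (stieltjes idc _ 0 x) (stieltjes idc _ x y) (stieltjes c _ 0 x) => u u' v.
by move: (stieltjes c _ x y) => v'; ring.
Qed.

Lemma mpart_continuous : continuous (mpart m).
Proof. by move=> t; apply: cvgB; [exact: price_continuous|exact: fvpart_continuous]. Qed.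

Lemma fvpart0 : fvpart m 0 = 0.
Proof. by rewrite /fvpart !stieltjesxx addr0. Qed.

End continuity.

Section locality.
Variables (m m' : R -> R) (t : R).
Hypothesis mm' : forall s, 0 <= s <= t -> m s = m' s.

Lemma eq_area s : 0 <= s <= t -> area m s = area m' s.
Proof.
move=> /andP[s0 st]; apply: eq_stieltjes => r /andP[r0 rs]; apply: mm'.
by rewrite (ltW r0) (le_trans rs).
Qed.

Lemma eq_price s : 0 <= s <= t -> price m s = price m' s.
Proof. by move=> sI; rewrite /price /expo (eq_area sI) (mm' sI). Qed.

Lemma eq_fvpart s : 0 <= s <= t -> fvpart m s = fvpart m' s.
Proof.
move=> /andP[s0 st]; rewrite /fvpart.
have rI r : 0 < r <= s -> 0 <= r <= t.
  by move=> /andP[r0 rs]; rewrite (ltW r0) (le_trans rs).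
rewrite (@eq_stieltjes _ _ (drift_dt m) (drift_dt m')); last first.
  by move=> r /rI h; rewrite /drift_dt /expo (eq_area h) (eq_price h) (mm' h).
rewrite (@eq_stieltjes _ _ (drift_dc m) (drift_dc m')); first by [].
by move=> r /rI h; rewrite /drift_dc (eq_area h) (eq_price h) (mm' h).
Qed.

(** This locality allows a path to be replaced by its truncation up to the time at which the two
    part. *)
Lemma eq_mpart s : 0 <= s <= t -> mpart m s = mpart m' s.
Proof. by move=> sI; rewrite /mpart (eq_price sI) (eq_fvpart sI). Qed.

End locality.

Section bounded_path.
Variables (K F : R) (m : R -> R).
Hypothesis cm : continuous m.
Hypothesis m0 : forall t, 0 <= m t.
Hypothesis mK : forall t, m t <= K.
Hypothesis cF : forall t, - c t <= F.

Lemma bounded_area_ge0 t : 0 <= area m t. Proof. exact: area_ge0. Qed.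
Definition fwd t := - c t.
Lemma fwd_ge0 t : 0 <= fwd t. Proof. exact: Nc_ge0. Qed.
Lemma bound_ge0 : 0 <= K. Proof. exact: le_trans (m0 0) (mK 0). Qed.
Lemma fwd_bound_ge0 : 0 <= F. Proof. exact: le_trans (fwd_ge0 0) (cF 0). Qed.

#[local] Hint Resolve bounded_area_ge0 fwd_ge0 bound_ge0 fwd_bound_ge0 Nc_ge0 : core.

Lemma norm_expo_le t : `|expo m t| <= lam + F.
Proof.
apply: (le_trans (ler_normB _ _)).
rewrite !ger0_norm ?yld_ge0 ?Nc_ge0//; apply: lerD.
  exact: yld_le.
by apply: (le_trans (yld_le (bounded_area_ge0 t) (fwd_ge0 t))); exact: cF.
Qed.

Lemma expR_expo_le x y : expR (m y * expo m x) <= expR (K * (lam + F)).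
Proof.
rewrite ler_expR (le_trans (ler_norm _))// normrM ger0_norm//.
by apply: ler_pM => //; exact: norm_expo_le.
Qed.

Lemma norm_price_le t : `|price m t| <= expR (K * (lam + F)).
Proof. by rewrite ger0_norm ?expR_ge0// expR_expo_le. Qed.

(** Its increments dominate those of time and those of [c], so that errors against [dt] and against
    [dc] are compared with one nondecreasing function. *)
Definition clock t : R := t + c t.

Lemma clock_nd x y : x <= y -> clock x <= clock y.
Proof. by move=> xy; apply: lerD => //; exact: cumulative_le. Qed.

Lemma clockB x y : clock y - clock x = (y - x) + (c y - c x).
Proof. by rewrite /clock opprD addrACA. Qed.

(** On the diagonal, [area_coef] and [curve_coef] are the partial derivatives of [expo] in the area
    and in [c]; the off-diagonal values make the increment formula exact. *)
Definition area_coef x y := (1 / 2) * (yld (area m x) (fwd y) * yld (area m y) (fwd y)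
  - yld (area m x) lam * yld (area m y) lam).

Definition curve_coef x y := 4 / ((2 + area m x * fwd y) * (2 + area m x * fwd x)).

Lemma expoB x y : 0 <= x -> x <= y ->
  expo m y - expo m x = area_coef x y * stieltjes idc m x y + curve_coef x y * (c y - c x).
Proof.
move=> x0 xy.
have e1 := yldBl (bounded_area_ge0 x) (bounded_area_ge0 y) lam0.
have e2 := yldBl (bounded_area_ge0 x) (bounded_area_ge0 y) (fwd_ge0 y).
have e3 := yldBr (bounded_area_ge0 x) (fwd_ge0 x) (fwd_ge0 y).
have e4 : area m y - area m x = stieltjes idc m x y.
  by rewrite /area (stieltjesD _ cm x0 xy) addrAC subrr add0r.
rewrite /area_coef /curve_coef -e4.
(* The curve moves first, at the area of [x], and then the area moves, at the curve value of [y]. *)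
have -> : expo m y - expo m x = (yld (area m y) lam - yld (area m x) lam)
   - (yld (area m y) (fwd y) - yld (area m x) (fwd y))
   - (yld (area m x) (fwd y) - yld (area m x) (fwd x)).
  by rewrite /expo /fwd; ring.
by rewrite e1 e2 e3 /fwd; ring.
Qed.

(** A Lipschitz constant of [expo] along [clock]: [lam ^+ 2 + F ^+ 2] bounds [area_coef], [K] the
    path and 1 [curve_coef]. *)
Definition expo_cst := (lam ^+ 2 + F ^+ 2) * K + 1.

Lemma mul_yld_le x y g G : (forall t, 0 <= g t) -> (forall t, g t <= G) ->
  0 <= yld (area m x) (g y) * yld (area m y) (g y) <= G ^+ 2.
Proof.
move=> g0 gG; rewrite mulr_ge0 ?yld_ge0//= expr2.
by apply: ler_pM; rewrite ?yld_ge0// (le_trans (yld_le _ _)).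
Qed.

Lemma area_coef_le x y : `|area_coef x y| <= lam ^+ 2 + F ^+ 2.
Proof.
have /andP[h1 h2] := @mul_yld_le x y fwd F fwd_ge0 cF.
have /andP[h3 h4] := @mul_yld_le x y (cst lam) lam (fun=> lam0) (fun=> lexx _).
rewrite /area_coef ler_norml /=; rewrite /= in h3 h4.
by have := sqr_ge0 F; have := sqr_ge0 lam; lra.
Qed.

Lemma curve_coef_le x y : 0 <= curve_coef x y <= 1.
Proof.
have h1 := yld_den (bounded_area_ge0 x) (fwd_ge0 y).
have h2 := yld_den (bounded_area_ge0 x) (fwd_ge0 x).
have h3 : 4 <= (2 + area m x * fwd y) * (2 + area m x * fwd x) :> R.
  by rewrite (_ : 4 = 2 * 2 :> R) ?ler_pM// -natrM.
have h4 : 0 < (2 + area m x * fwd y) * (2 + area m x * fwd x) by rewrite (lt_le_trans _ h3).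
by rewrite /curve_coef divr_ge0 ?(ltW h4)//= ler_pdivrMr// mul1r.
Qed.

Lemma expoB_le x y : 0 <= x -> x <= y ->
  `|expo m y - expo m x| <= expo_cst * (clock y - clock x).
Proof.
move=> x0 xy; rewrite expoB//; apply: (le_trans (ler_normD _ _)).
have h1 : `|stieltjes idc m x y| <= K * (y - x).
  by apply: stieltjes_le => // s _; rewrite ger0_norm.
have h2 : 0 <= c y - c x by rewrite subr_ge0 cumulative_le.
have h3 : `|area_coef x y * stieltjes idc m x y| <= (lam ^+ 2 + F ^+ 2) * (K * (y - x)).
  by rewrite normrM; apply: ler_pM => //; exact: area_coef_le.
have /andP[h4 h5] := curve_coef_le x y.
have h6 : `|curve_coef x y * (c y - c x)| <= c y - c x.
  by rewrite ger0_norm ?(mulr_ge0 h4 h2)//; apply: ler_piMl.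
have h7 : 0 <= (lam ^+ 2 + F ^+ 2) * K * (c y - c x).
  by rewrite mulr_ge0// mulr_ge0// addr_ge0// sqr_ge0.
rewrite clockB /expo_cst.
move: (c y - c x) (area_coef x y * _) (curve_coef x y * _) h2 h3 h6 h7 => dc u v h2 h3 h6 h7.
by lra.
Qed.

(** [kernel_area] and [kernel_curve] are the first-order coefficients of the price when [expo] moves
    and [m y] stays. [kernel_square] is the second-order Ito term that [mart_incr] subtracts. *)
Definition kernel_area x y := expR (m y * expo m x) * m y * area_coef x y.
Definition kernel_curve x y := expR (m y * expo m x) * m y * curve_coef x y.
Definition kernel_square x := (1 / 2) * (m x ^+ 2 * expo m x ^+ 2 * price m x).
Definition price_rem x y := expR (m y * expo m x) * (expR (m y * (expo m y - expo m x)) - 1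
  - m y * (expo m y - expo m x)).

Lemma continuous_comp_fst (h : R -> R) : continuous h -> continuous (fun z : R * R => h z.1).
Proof. by move=> ch z; apply: continuous_comp; [exact: cvg_fst|exact: ch]. Qed.

Lemma continuous_comp_snd (h : R -> R) : continuous h -> continuous (fun z : R * R => h z.2).
Proof. by move=> ch z; apply: continuous_comp; [exact: cvg_snd|exact: ch]. Qed.

Lemma yld_pair_continuous (h : R -> R) : continuous h -> (forall t, 0 <= h t) ->
  continuous (fun z : R * R => yld (area m z.1) (h z.2)).
Proof.
move=> ch h0 z.
apply: (@cvg_yld R (R * R)%type z (fun z => area m z.1) (fun z => h z.2)) => //=.
- by apply: continuous_comp_fst; exact: area_continuous.
- exact: continuous_comp_snd.
Qed.

Lemma expR_expo_continuous : continuous (fun z : R * R => expR (m z.2 * expo m z.1) * m z.2).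
Proof.
move=> z; apply: cvgM; last exact: continuous_comp_snd.
apply: (@continuous_comp _ _ _ (fun z : R * R => m z.2 * expo m z.1) expR);
  last exact: continuous_expR.
apply: cvgM; first exact: continuous_comp_snd.
by apply: continuous_comp_fst; exact: expo_continuous.
Qed.

Lemma kernel_area_continuous : continuous (fun z : R * R => kernel_area z.1 z.2).
Proof.
have hl : continuous (cst lam : R -> R) by exact: cst_continuous.
move=> z; apply: cvgM; first exact: expR_expo_continuous.
apply: cvgM; first exact: cvg_cst.
apply: cvgB; apply: cvgM.
- exact: (yld_pair_continuous Nc_continuous fwd_ge0).
- apply: (continuous_comp_snd (h := fun t => yld (area m t) (fwd t))).
  exact: yld_area_continuous Nc_continuous fwd_ge0.
- exact: (yld_pair_continuous hl (fun=> lam0)).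
- apply: (continuous_comp_snd (h := fun t => yld (area m t) lam)).
  exact: (yld_area_continuous cm m0 hl (fun=> lam0)).
Qed.

Lemma kernel_curve_continuous : continuous (fun z : R * R => kernel_curve z.1 z.2).
Proof.
move=> z; apply: cvgM; first exact: expR_expo_continuous.
apply: cvgM; first exact: cvg_cst.
have den (u v : R * R -> R) : {for z, continuous u} -> {for z, continuous v} ->
    {for z, continuous (fun z : R * R => 2 + u z * v z)}.
  by move=> cu cv; apply: cvgD; [exact: cvg_cst|exact: cvgM].
have c1 : {for z, continuous (fun z : R * R => area m z.1)}.
  by apply: continuous_comp_fst; exact: area_continuous.
apply: cvgV.
  by rewrite mulf_neq0// lt0r_neq0// yld_den_gt0 ?area_ge0 ?Nc_ge0.
apply: cvgM; apply: den => //.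
  by apply: (continuous_comp_snd (h := fwd)); exact: Nc_continuous.
by apply: (continuous_comp_fst (h := fwd)); exact: Nc_continuous.
Qed.

Lemma kernel_square_continuous : continuous kernel_square.
Proof.
move=> t; apply: cvgM; first exact: cvg_cst.
apply: cvgM; last exact: price_continuous.
by apply: cvgM; apply: cvgM; first [exact: cm|exact: expo_continuous].
Qed.

(** Three errors of freezing an integrand and one Taylor remainder. Since [m] is held at its right
    endpoint, only the increment of [expo] is expanded, and that has bounded variation; no increment
    of the rough path [m] occurs. *)
Lemma pathwise_errE x y : 0 <= x -> x <= y -> pathwise_err m x y =
  (kernel_area x y * stieltjes idc m x y - stieltjes idc (fun s => kernel_area s s * m s) x y) +
  (kernel_curve x y * stieltjes c (cst 1) x y -
     stieltjes c (fun s => kernel_curve s s * cst 1 s) x y) +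
  (kernel_square x * stieltjes idc (cst 1) x y -
     stieltjes idc (fun s => kernel_square s * cst 1 s) x y) +
  price_rem x y.
Proof.
move=> x0 xy.
have e1 : fvpart m y - fvpart m x = stieltjes idc (drift_dt m) x y
    + stieltjes c (drift_dc m) x y by exact: fvpartB.
have c1 : continuous (fun s => kernel_area s s * m s).
  by move=> s; apply: cvgM; [exact: (continuous_diag kernel_area_continuous)|exact: cm].
have c3 : continuous (fun s => kernel_square s * cst 1 s).
  by move=> s; apply: cvgM; [exact: kernel_square_continuous|exact: cvg_cst].
(* The Ito cancellation that gives [drift_dt] its form: with [u = yld (area m s) (fwd s)] and
   [v = yld (area m s) lam], [(u ^ 2 - v ^ 2) / 2 + (v - u) ^ 2 / 2 = - u * (v - u)]. *)
have e2 : stieltjes idc (drift_dt m) x y = stieltjes idc (fun s => kernel_area s s * m s) x y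
    + stieltjes idc (fun s => kernel_square s * cst 1 s) x y.
  rewrite -stieltjesDf//; apply: eq_stieltjes => s _.
  rewrite /drift_dt /kernel_area /kernel_square /area_coef -/(price m s) /expo -/(fwd s) /=.
  move: (price m s) (yld _ (fwd s)) (yld _ lam) (m s) => p u v n.
  by field.
have e3 : stieltjes c (drift_dc m) x y = stieltjes c (fun s => kernel_curve s s * cst 1 s) x y.
  apply: eq_stieltjes => s _.
  rewrite /drift_dc /kernel_curve /curve_coef -/(price m s) /= -/(fwd s) expr2 mulr1.
  by rewrite (mulrC (m s)).
have e4 : price m y = expR (m y * expo m x) * expR (m y * (expo m y - expo m x)).
  by rewrite -expRD /price; congr expR; ring.
rewrite /pathwise_err /mart_incr /mpart /price_rem.
have -> : price m y - fvpart m y - (price m x - fvpart m x) =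
   price m y - price m x - (fvpart m y - fvpart m x) by ring.
rewrite e1 e2 e3 e4 (stieltjes_cst idc 1 xy) (stieltjes_cst c 1 xy).
rewrite [idc y - idc x](_ : _ = y - x) //.
have := expoB x0 xy; rewrite /kernel_area /kernel_curve /kernel_square.
move: (stieltjes idc (fun s => expR _ * _ * _ * _) x y) => I1.
move: (stieltjes idc (fun s => 1 / 2 * _ * _) x y) (stieltjes c _ x y) => I3 I2.
move: (stieltjes idc m x y) (curve_coef x y) (area_coef x y) (c y - c x) => A sl co dc.
move: (expR (m y * (expo m y - expo m x))) => E0.
move: (expR (m y * expo m x)) (price m x) (expo m x) (expo m y) => E p u v e5.
have -> : v = u + (co * A + sl * dc) by rewrite -e5; ring.
by field.
Qed.

Lemma clock_incr_ge0 x y : x <= y -> 0 <= clock y - clock x.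
Proof. by move=> xy; rewrite subr_ge0 clock_nd. Qed.

Lemma norm_mul_expoB_le x y : `|m y * (expo m y - expo m x)| <= K * (2 * (lam + F)).
Proof.
rewrite normrM; apply: ler_pM => //; first by rewrite ger0_norm.
apply: (le_trans (ler_normB _ _)).
by have := norm_expo_le x; have := norm_expo_le y; lra.
Qed.

Definition price_rem_cst :=
  expR (K * (lam + F)) * (expR (K * (2 * (lam + F))) * (K * expo_cst) ^+ 2).

(** The remainder is quadratic in the increment of [expo], which is Lipschitz along [clock];
    continuity of [clock] then makes it negligible. *)
Lemma price_rem_le x y : 0 <= x -> x <= y ->
  `|price_rem x y| <= price_rem_cst * (clock y - clock x) ^+ 2.
Proof.
move=> x0 xy; rewrite /price_rem normrM /price_rem_cst -mulrA; apply: ler_pM => //.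
  by rewrite ger0_norm ?expR_ge0// expR_expo_le.
apply: (le_trans (expR_taylor2 _)); rewrite -mulrA; apply: ler_pM.
- exact: expR_ge0.
- exact: exprn_ge0.
- by rewrite ler_expR norm_mul_expoB_le.
have h : `|m y * (expo m y - expo m x)| <= K * expo_cst * (clock y - clock x).
  rewrite normrM -mulrA; apply: ler_pM => //; first by rewrite ger0_norm.
  exact: expoB_le.
by rewrite -exprMn; apply: lerXn2r => //; rewrite nnegrE (le_trans _ h).
Qed.

Lemma price_rem_smallo a b : 0 <= a -> smallo clock a b price_rem.
Proof.
move=> a_ge0 eps eps0.
have R0 : 0 <= price_rem_cst.
  apply: mulr_ge0; first exact: expR_ge0.
  by apply: mulr_ge0; [exact: expR_ge0|exact: sqr_ge0].
have R1 : 0 < price_rem_cst + 1 by rewrite ltr_wpDl.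
have cw : continuous (fun z : R * R => clock z.2).
  apply: continuous_comp_snd => t; apply: cvgD; [exact: cvg_id|exact: cc].
(* For a kernel that ignores its first argument this is the uniform continuity of [clock] on
   [[a, b]]. *)
have [d d0 hd] := @continuous2_diag_unif _ (fun _ t => clock t) a b _ cw (divr_gt0 eps0 R1).
exists d => // x y ax xy yb yxd; have x0 := le_trans a_ge0 ax.
apply: (le_trans (price_rem_le x0 xy)); rewrite expr2 mulrA.
apply: ler_wpM2r; first exact: clock_incr_ge0.
have := hd x x y; rewrite subrr normr0 ger0_norm ?subr_ge0// ax (le_trans xy yb).
move=> /(_ isT d0 yxd); rewrite ger0_norm ?clock_incr_ge0// ltr_pdivlMr// => h.
apply: (@le_trans _ _ ((clock y - clock x) * (price_rem_cst + 1))); last exact: ltW.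
by rewrite mulrC; apply: ler_wpM2l; [exact: clock_incr_ge0|rewrite lerDl].
Qed.

Lemma pathwise_err_smallo a b : 0 <= a ->
  smallo (fun t => t + c t) a b (pathwise_err m).
Proof.
move=> a_ge0.
have wc x y : x <= y -> c y - c x <= clock y - clock x.
  by rewrite /clock; lra.
have wid x y : x <= y -> idc y - idc x <= clock y - clock x.
  by move=> xy; have := cumulative_le c xy; rewrite /clock /=; lra.
have c1 : continuous (cst 1 : R -> R) by exact: cst_continuous.
have h1 := smallo_le wid (@smallo_stieltjes _ idc kernel_area m a b kernel_area_continuous cm).
have h2 := smallo_le wc (@smallo_stieltjes _ c kernel_curve (cst 1) a b kernel_curve_continuous c1).
have h3 := smallo_le wid (@smallo_stieltjes _ idc (fun x _ => kernel_square x) (cst 1) a b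
  (continuous_comp_fst kernel_square_continuous) c1).
have := smallo_add (smallo_add (smallo_add h1 h2) h3) (@price_rem_smallo a b a_ge0).
by apply: eq_smallo => x y ax xy _; rewrite pathwise_errE// (le_trans a_ge0).
Qed.

Lemma norm_drift_dt_le t :
  `|drift_dt m t| <= K ^+ 2 * (expR (K * (lam + F)) * (F * (lam + F))).
Proof.
have h1 : `|m t ^+ 2| <= K ^+ 2 by rewrite normrX ger0_norm// lerXn2r ?nnegrE.
have h2 : `|yld (area m t) (- c t)| <= F.
  by rewrite ger0_norm ?yld_ge0//; apply: (le_trans (yld_le _ _)).
have := norm_expo_le t; have := norm_price_le t => h3 h4.
rewrite /drift_dt normrN 3!normrM [leRHS]mulrA [leRHS]mulrA.
by apply: ler_pM => //; apply: ler_pM => //; apply: ler_pM.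
Qed.

Lemma norm_drift_dc_le t : `|drift_dc m t| <= K * expR (K * (lam + F)).
Proof.
have /andP[h1 h2] := curve_coef_le t t.
have h3 : `|m t| <= K by rewrite ger0_norm.
have := norm_price_le t => h4.
have h5 : `|4 / (2 + area m t * - c t) ^+ 2| <= 1 by rewrite expr2 ger0_norm.
rewrite /drift_dc normrM -[leRHS]mulr1; apply: ler_pM => //.
by rewrite normrM; apply: ler_pM.
Qed.

Definition drift_dt_cst := K ^+ 2 * (expR (K * (lam + F)) * (F * (lam + F))).

Definition drift_dc_cst := K * expR (K * (lam + F)).

Lemma fvpart_incr_le x y : 0 <= x -> x <= y ->
  `|fvpart m y - fvpart m x| <=
  drift_dt_cst * (y - x) + drift_dc_cst * (c y - c x).
Proof.
move=> x0 xy.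
rewrite (fvpartB cm m0 x0 xy).
apply: (le_trans (ler_normD _ _)); apply: lerD.
  apply: (@stieltjes_le _ idc) => //; first exact: drift_dt_continuous.
  by move=> s _; exact: norm_drift_dt_le.
apply: stieltjes_le => //; first exact: drift_dc_continuous.
by move=> s _; exact: norm_drift_dc_le.
Qed.

Lemma drift_cst_ge0 : 0 <= drift_dt_cst /\ 0 <= drift_dc_cst.
Proof.
by split; [apply: le_trans (norm_drift_dt_le 0)|apply: le_trans (norm_drift_dc_le 0)].
Qed.

(** Per unit of [clock], the three summands bound the change of the price at fixed [m y], the drift,
    and the second-order term of [mart_incr]. *)
Definition path_cst := expR (K * (lam + F)) *
     (expR (K * (2 * (lam + F))) * (K * expo_cst)) +
   (drift_dt_cst + drift_dc_cst) +
   K ^+ 2 * ((lam + F) ^+ 2 * expR (K * (lam + F))).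

(* The bound depends on the path [m] only through [K]. *)
Lemma norm_pathwise_err_le x y : 0 <= x -> x <= y ->
  `|pathwise_err m x y| <= path_cst * ((y - x) + (c y - c x)).
Proof.
move=> x0 xy; have dc0 : 0 <= c y - c x by rewrite subr_ge0 cumulative_le.
have dt0 : 0 <= y - x by rewrite subr_ge0.
have [D1 D2] := drift_cst_ge0.
have h1 : `|price m y - expR (m y * expo m x)| <= expR (K * (lam + F)) *
     (expR (K * (2 * (lam + F))) * (K * expo_cst)) * ((y - x) + (c y - c x)).
  have -> : price m y = expR (m y * expo m x) * expR (m y * (expo m y - expo m x)).
    by rewrite -expRD /price; congr expR; ring.
  rewrite -{2}[expR (m y * expo m x)]mulr1 -mulrBr normrM -!mulrA.
  apply: ler_pM => //; first by rewrite ger0_norm ?expR_ge0// expR_expo_le.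
  apply: (le_trans (expR_taylor1 _)); apply: ler_pM; rewrite ?expR_ge0//.
    by rewrite ler_expR norm_mul_expoB_le.
  rewrite normrM; apply: ler_pM => //; first by rewrite ger0_norm.
  by rewrite -clockB; exact: expoB_le.
have h2 := fvpart_incr_le x0 xy.
have h3 : `|m x ^+ 2 * expo m x ^+ 2 * price m x| <=
    K ^+ 2 * ((lam + F) ^+ 2 * expR (K * (lam + F))).
  rewrite -mulrA normrM; apply: ler_pM => //.
    by rewrite normrX ger0_norm// lerXn2r ?nnegrE.
  rewrite normrM; apply: ler_pM => //; last exact: norm_price_le.
  rewrite normrX; apply: lerXn2r; rewrite ?nnegrE//; last exact: norm_expo_le.
  exact: addr_ge0.
have -> : pathwise_err m x y = (price m y - expR (m y * expo m x)) -
    (fvpart m y - fvpart m x) +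
    (y - x) / 2 * (m x ^+ 2 * expo m x ^+ 2 * price m x).
  by rewrite /pathwise_err /mart_incr /mpart; ring.
apply: (le_trans (ler_normD _ _)).
rewrite /path_cst [leRHS]mulrDl; apply: lerD.
  rewrite [leRHS]mulrDl; apply: (le_trans (ler_normB _ _)); apply: lerD => //.
  apply: (le_trans h2); rewrite [leRHS]mulrDl; apply: lerD; apply: ler_wpM2l => //.
    by rewrite lerDl.
  by rewrite lerDr.
rewrite normrM mulrC; apply: ler_pM => //.
rewrite ger0_norm ?divr_ge0//; apply: (@le_trans _ _ (y - x)); last by rewrite lerDl.
by rewrite ler_pdivrMr// ler_peMr// ler1n.
Qed.

Lemma norm_mpart_le T x : 0 <= x <= T ->
  `|mpart m x| <= expR (K * (lam + F)) + (drift_dt_cst * T + drift_dc_cst * F).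
Proof.
move=> /andP[x0 xT]; have [D1 D2] := drift_cst_ge0.
apply: (le_trans (ler_normB _ _)); apply: lerD; first exact: norm_price_le.
have := fvpart_incr_le (lexx 0) x0; rewrite fvpart0 !subr0 => h.
apply: (le_trans h); apply: lerD; apply: ler_wpM2l => //.
by rewrite -[leRHS]add0r; exact: (lerD (c0 x) (cF 0)).
Qed.

End bounded_path.
End path.

(** * Moments of a lognormal increment *)

Section normal_density.
Context {R : realType}.
Variables (mean s : R).
Local Notation mu := (@lebesgue_measure R).
Local Notation N := (@normal_prob R mean s).
Local Open Scope ereal_scope.

Import HBNNSimple.

Let integral_normal_nnsfun (h : {nnsfun measurableTypeR R >-> R}) :
  \int[N]_x (h x)%:E = \int[mu]_x ((h x)%:E * (normal_pdf mean s x)%:E).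
Proof.
have mpdf : measurable_fun setT (fun x : R => (normal_pdf mean s x)%:E).
  by apply/measurable_EFinP; exact: measurable_normal_pdf.
have pdf0 x : 0 <= (normal_pdf mean s x)%:E by rewrite lee_fin normal_pdf_ge0.
under [LHS]eq_integral do rewrite fimfunE -fsumEFin//.
rewrite [LHS]ge0_integral_fsum//; last 2 first.
  - by move=> r; exact/measurable_EFinP/measurableT_comp.
  - by move=> n x _; rewrite EFinM nnfun_muleindic_ge0.
under [RHS]eq_integral.
  move=> x xD; rewrite fimfunE -fsumEFin// ge0_mule_fsuml; last first.
    by move=> r; rewrite EFinM nnfun_muleindic_ge0.
  over.
rewrite [RHS]ge0_integral_fsum//; last 2 first.
  - move=> r; apply: emeasurable_funM => //.
    by apply/measurable_EFinP; do 2 apply/measurableT_comp => //.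
  - by move=> n x _; rewrite mule_ge0// EFinM nnfun_muleindic_ge0.
apply: eq_fsbigr => r _.
rewrite integralZl_indic_nnsfun//= integral_indic// setIT.
(* A negative [r] is not a value of [h] and both sides vanish; otherwise [r] is a nonnegative factor
   and can leave the integral. *)
have [r0|r0] := ltP r 0%R.
  rewrite (_ : h @^-1` [set r] = set0); last exact: preimage_nnfun0.
  rewrite measure0 mule0 integral0_eq// => x _.
  by rewrite indicE in_set0 mulr0 mul0e.
under eq_integral do rewrite EFinM -muleA.
rewrite ge0_integralZl//; last 2 first.
  - apply: emeasurable_funM => //.
    by apply/measurable_EFinP; exact: measurable_indic.
  - by move=> x _; rewrite mule_ge0// lee_fin.
congr (_ * _); rewrite /normal_prob [LHS]integral_mkcond.
apply: eq_integral => x _; rewrite patchE indicE.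
by case: ifPn; rewrite ?mul1e ?mul0e.
Qed.

(** The measure is defined by its density on sets; functions follow by simple approximation and
    monotone convergence. *)
Lemma ge0_integral_normal_prob (f : measurableTypeR R -> \bar R) :
  measurable_fun setT f -> (forall x, 0 <= f x) ->
  \int[N]_x f x = \int[mu]_x (f x * (normal_pdf mean s x)%:E).
Proof.
move=> mf f0.
have mpdf : measurable_fun setT (fun x : R => (normal_pdf mean s x)%:E).
  by apply/measurable_EFinP; exact: measurable_normal_pdf.
have pdf0 x : 0 <= (normal_pdf mean s x)%:E by rewrite lee_fin normal_pdf_ge0.
pose f_ := nnsfun_approx measurableT mf.
transitivity (lim (\int[N]_x (f_ n x)%:E @[n --> \oo])).
  rewrite -monotone_convergence//=.
  - apply: eq_integral => ? /[!inE] xD; apply/esym/cvg_lim => //=.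
    exact: cvg_nnsfun_approx.
  - by move=> n; apply/measurable_EFinP; exact: (measurable_funP (f_ n)).
  - by move=> n ? _; rewrite lee_fin.
  - by move=> ? _ ? ? mn; rewrite lee_fin; exact/lefP/nd_nnsfun_approx.
transitivity (lim (\int[mu]_x ((f_ n x)%:E * (normal_pdf mean s x)%:E) @[n --> \oo])).
  by apply: congr_lim; apply/funext => n /=; exact: integral_normal_nnsfun.
rewrite -monotone_convergence//=.
- apply: eq_integral => x _; apply/cvg_lim => //.
  apply: cvgeZr => //; exact: cvg_nnsfun_approx.
- move=> n; apply: emeasurable_funM => //.
  by apply/measurable_EFinP; exact: (measurable_funP (f_ n)).
- by move=> n x _; rewrite mule_ge0// lee_fin.
- move=> x _ a b ab; apply: lee_wpmul2r => //.
  by rewrite lee_fin; exact/lefP/nd_nnsfun_approx.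
Qed.

End normal_density.

Section normal_moments.
Context {R : realType}.
Local Open Scope ereal_scope.

(** Completing the square: the exponential factor shifts the mean of the normal density to
    [theta * s ^+ 2] and leaves a constant. *)
Lemma normal_prob_mgf (s theta : R) : s != 0%R ->
  \int[normal_prob 0 s]_x (expR (theta * x))%:E =
  (expR (theta ^+ 2 * s ^+ 2 / 2))%:E.
Proof.
move=> s0; rewrite ge0_integral_normal_prob; last 2 first.
- apply/measurable_EFinP/measurableT_comp => //.
- by move=> x; rewrite lee_fin expR_ge0.
transitivity (\int[lebesgue_measure]_x ((expR (theta ^+ 2 * s ^+ 2 / 2))%:E *
    (normal_pdf (theta * s ^+ 2) s x)%:E)).
  apply: eq_integral => x _; rewrite -!EFinM; congr EFin.
  rewrite !normal_pdfE// mulrCA [RHS]mulrCA; congr (_ * _)%R.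
  rewrite /normal_fun -!expRD; congr expR; field.
  by rewrite s0.
rewrite integralZl//; last exact: integrable_normal_pdf.
by rewrite integral_normal_pdf mule1.
Qed.

End normal_moments.

Section independence.
Context {d : measure_display} {Omega : measurableType d} {R : realType}.
Variables (P : probability Omega R) (G : set (set Omega)).
Hypothesis GM : G `<=` measurable.
Local Open Scope ereal_scope.

Lemma sub_measurable_fun (X : Omega -> R) :
  sub_measurable G X -> measurable_fun setT X.
Proof. by move=> GX _ U mU; rewrite setTI; apply/GM/GX. Qed.

Lemma ge0_integral_indep (xi D : Omega -> R) (psi : R -> R) :
  sub_measurable G xi -> measurable_fun setT D -> independent_of P D G ->
  (forall w, 0 <= xi w)%R -> measurable_fun setT psi -> (forall x, 0 <= psi x)%R ->
  \int[P]_w (xi w * psi (D w))%:E =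
  (\int[P]_w (xi w)%:E) * (\int[P]_w (psi (D w))%:E).
Proof.
move=> Gxi mD indep xi0 mpsi psi0.
have mxi := sub_measurable_fun Gxi.
pose X : {RV P >-> R} := HB.pack xi (isMeasurableFun.Build _ _ _ _ _ mxi).
pose Y : {RV P >-> R} := HB.pack D (isMeasurableFun.Build _ _ _ _ _ mD).
have mXY : measurable_fun setT (fun w => (X w, Y w)) by exact: measurable_fun_pair.
(* The maximum makes [f] nonnegative on the whole plane; it changes nothing at the values of
   [xi]. *)
pose f (z : R * R) := (Num.max z.1 0 * psi z.2)%:E.
have mf : measurable_fun setT f.
  apply/measurable_EFinP/measurable_funM; last by apply: measurableT_comp.
  by apply: measurable_maxr => //.
have f0 z : 0 <= f z by rewrite lee_fin mulr_ge0// le_max lexx orbT.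
transitivity (\int[pushforward P (fun w => (X w, Y w))]_z f z).
  rewrite ge0_integral_pushforward//=.
  by rewrite preimage_setT; apply: eq_integral => w _; rewrite /f /= max_l.
transitivity (\int[(distribution P X) \x (distribution P Y)]_z f z).
  apply: eq_measure_integral => A mA _.
  apply/esym/product_measure_unique => // U V mU mV.
  exact: (indep _ _ (Gxi _ mU) mV).
rewrite fubini_tonelli1//; rewrite /fubini_F /f /=.
under eq_integral => x _.
  under eq_integral do rewrite EFinM.
  rewrite ge0_integralZl//; last 3 first.
  - by apply/measurable_EFinP.
  - by move=> y _; rewrite lee_fin.
  - by rewrite lee_fin le_max lexx orbT.
  over.
rewrite ge0_integralZr//; last 3 first.
- by apply/measurable_EFinP; apply: measurable_maxr.
- by move=> y _; rewrite lee_fin le_max lexx orbT.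
- by apply: integral_ge0 => y _; rewrite lee_fin.
rewrite /distribution ge0_integral_pushforward//=; last 2 first.
- by apply/measurable_EFinP; apply: measurable_maxr.
- by move=> y _; rewrite lee_fin le_max lexx orbT.
rewrite ge0_integral_pushforward//=; last 2 first.
- by apply/measurable_EFinP.
- by move=> y _; rewrite lee_fin.
rewrite !preimage_setT; congr (_ * _).
by apply: eq_integral => w _ /=; rewrite max_l.
Qed.

End independence.

Lemma sub_measurable_comp {d : measure_display} {Omega : measurableType d}
    {R : realType} (G : set (set Omega)) (X : Omega -> R) (f : R -> R) :
  measurable_fun setT f -> sub_measurable G X -> sub_measurable G (f \o X).
Proof.
move=> mf GX U mU; rewrite comp_preimage; apply: GX.
by rewrite -[X in measurable X]setTI; exact: mf.
Qed.

Section expectation.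
Context {d : measure_display} {Omega : measurableType d} {R : realType}.
Variable P : probability Omega R.
Implicit Types f g : Omega -> R.

Lemma bounded_integrable f B : measurable_fun setT f -> (forall w, `|f w| <= B) ->
  P.-integrable setT (EFin \o f).
Proof.
move=> mf fB; apply: measurable_bounded_integrable => //.
  by rewrite [X in (X < _)%E]probability_setT ltry.
exists B; split; first exact: num_real.
by move=> r Br w _; apply: (le_trans (fB w)); exact: ltW.
Qed.

Lemma integrable_dominated f g : measurable_fun setT f ->
  P.-integrable setT (EFin \o g) -> (forall w, `|f w| <= g w) ->
  P.-integrable setT (EFin \o f).
Proof.
move=> mf ig fg; apply: (le_integrable _ _ _ ig) => //.
  exact/measurable_EFinP.
by move=> w _ /=; rewrite lee_fin (le_trans (fg w))// ler_norm.
Qed.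

Lemma norm_expectation_le f g : P.-integrable setT (EFin \o f) ->
  P.-integrable setT (EFin \o g) -> (forall w, `|f w| <= g w) ->
  `|\int[P]_w f w| <= \int[P]_w g w.
Proof.
move=> intf intg fg; apply: (le_trans (le_normr_Rintegral _ _)) => //.
apply: le_Rintegral => //.
rewrite (_ : _ \o _ = abse \o (EFin \o f)); first exact: integrable_abse.
by apply/funext.
Qed.

Lemma Rintegral_prob_cst (r : R) : \int[P]_w r = r.
Proof. by rewrite Rintegral_cst// [X in fine X]probability_setT mulr1. Qed.

Lemma RintegralE f (r : R) : (\int[P]_w (f w)%:E = r%:E)%E -> \int[P]_w f w = r.
Proof. by rewrite /Rintegral => ->. Qed.

End expectation.

Section exp_bounds.
Context {R : realType}.
Implicit Types h x : R.

(** On this interval [expR x <= 1 / (1 - x) <= 2], which turns the Taylor remainder into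
    [2 * x ^+ 2]. *)
Lemma expR_le_quadratic x : 0 <= x -> x <= 1 / 2 -> expR x <= 1 + x + 2 * x ^+ 2.
Proof.
move=> x0 x1.
have h1 := expR_ge1Dx (- x).
have h2 : expR x * expR (- x) = 1 by rewrite -expRD subrr expR0.
have h3 := expR_gt0 x.
have h4 : expR x * (1 - x) <= expR x * expR (- x) by rewrite ler_wpM2l// ltW.
have h5 : expR x <= 2.
  have : expR x * (1 / 2) <= expR x * (1 - x) by rewrite ler_wpM2l ?(ltW h3)//; lra.
  by lra.
have h6 : expR x * x ^+ 2 <= 2 * x ^+ 2 by rewrite ler_wpM2r// sqr_ge0.
have := expR_taylor2 x; rewrite ger0_norm; last by have := expR_ge1Dx x; lra.
by rewrite ger0_norm//; lra.
Qed.

(* [q] is the square root of [h]. *)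
Lemma lognormal_third_moment_bound h q : 0 < h -> h <= 1 / 12 -> 0 < q -> h = q * q ->
  1 / 2 * (q * (expR h - 1) +
    q^-1 * (expR (6 * h) - 4 * expR (3 * h) + 6 * expR h - 3)) <= 43 * (h * q).
Proof.
move=> h0 h12 q0 hq.
have e1 : expR h <= 1 + h + 2 * h ^+ 2.
  by apply: expR_le_quadratic; [exact: ltW|lra].
(* The origin of the threshold [1 / 12]: it puts [6 * h] in the range of [expR_le_quadratic]. *)
have e6 : expR (6 * h) <= 1 + 6 * h + 2 * (6 * h) ^+ 2.
  by apply: expR_le_quadratic; [apply: mulr_ge0 => //; exact: ltW|lra].
have f3 := expR_ge1Dx (3 * h).
have h2 : h ^+ 2 <= h * (1 / 12) by rewrite expr2 ler_wpM2l// ltW.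
have a2 : expR h - 1 <= 2 * h by lra.
(* The terms of order 0 and 1 cancel in this fourth moment, and the quadratic ones add up to
   [72 + 12 = 84]. The final constant is [43 = (2 + 84) / 2]. *)
have a4 : expR (6 * h) - 4 * expR (3 * h) + 6 * expR h - 3 <= 84 * h ^+ 2.
  by rewrite exprMn in e6; lra.
have b2 : q * (expR h - 1) <= q * (2 * h) by rewrite ler_wpM2l// ltW.
have b4 : q^-1 * (expR (6 * h) - 4 * expR (3 * h) + 6 * expR h - 3) <= 84 * (h * q).
  rewrite mulrC ler_pdivrMr//; apply: (le_trans a4).
  by rewrite -!mulrA -hq expr2.
by move: b2 b4; rewrite mulrCA (mulrC q h); lra.
Qed.

End exp_bounds.

Section lognormal_increment.
Context {d : measure_display} {Omega : measurableType d} {R : realType}.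
Variables (P : probability Omega R) (G : set (set Omega)) (D : Omega -> R) (h : R).
Hypothesis GM : G `<=` measurable.
Hypothesis mD : measurable_fun setT D.
Hypothesis indD : independent_of P D G.
Hypothesis h0 : 0 < h.
Hypothesis lawD : forall U : set R, measurable U ->
  P (D @^-1` U) = normal_prob 0 (Num.sqrt h) U.

Lemma integral_expR_normal (theta : R) :
  (\int[P]_w (expR (theta * D w))%:E = (expR (theta ^+ 2 * h / 2))%:E)%E.
Proof.
have s0 : Num.sqrt h != 0 by rewrite gt_eqF// sqrtr_gt0.
have := normal_prob_mgf theta s0; rewrite (sqr_sqrtr (ltW h0)) => <-.
have mexp : measurable_fun setT (fun x : R => (expR (theta * x))%:E).
  by apply/measurable_EFinP/measurableT_comp.
transitivity (\int[pushforward P (D : Omega -> measurableTypeR R)]_x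
    (expR (theta * x))%:E)%E.
  have := @ge0_integral_pushforward _ _ _ (measurableTypeR R) R D mD P setT _ measurableT mexp.
  rewrite preimage_setT => ->// x _; rewrite lee_fin; exact: expR_ge0.
by apply: eq_measure_integral => A mA _; exact: lawD.
Qed.

(** The ratio of the values of [M] at the two ends of a step of length [h]; it has mean 1, and [u]
    below is the relative increment of [M]. *)
Let g w : R := expR (D w - h / 2).

Let mg : measurable_fun setT g.
Proof. by apply: measurableT_comp => //; apply: measurable_funB. Qed.

Let integral_gX (k : nat) :
  (\int[P]_w ((g w) ^+ k)%:E = (expR ((k%:R ^+ 2 - k%:R) * h / 2))%:E)%E.
Proof.
have e w : (g w) ^+ k = expR (k%:R * D w) * expR (- (k%:R * h / 2)).
  by rewrite /g -expRM_natl -expRD; congr expR; ring.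
under eq_integral do rewrite e EFinM.
rewrite ge0_integralZr//; last first.
  by apply/measurable_EFinP; apply: measurableT_comp => //; exact: measurable_funM.
by rewrite integral_expR_normal -EFinM -expRD; congr (expR _)%:E; ring.
Qed.

Let igX (k : nat) : P.-integrable setT (EFin \o (fun w => g w ^+ k)).
Proof.
apply/integrableP; split; first by apply/measurable_EFinP/measurable_funX.
rewrite (eq_integral (fun w => (g w ^+ k)%:E)) ?integral_gX ?ltry// => w _ /=.
by rewrite ger0_norm// exprn_ge0// expR_ge0.
Qed.

Let EgX (k : nat) : \int[P]_w (g w ^+ k) = expR ((k%:R ^+ 2 - k%:R) * h / 2).
Proof. exact/RintegralE/integral_gX. Qed.

Let Eg1 : \int[P]_w (g w ^+ 1) = 1.
Proof. by rewrite EgX (_ : _ * h / 2 = 0) ?expR0//; field. Qed.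

Let Eg2 : \int[P]_w (g w ^+ 2) = expR h.
Proof. by rewrite EgX; congr expR; field. Qed.

Let Eg3 : \int[P]_w (g w ^+ 3) = expR (3 * h).
Proof. by rewrite EgX; congr expR; field. Qed.

Let Eg4 : \int[P]_w (g w ^+ 4) = expR (6 * h).
Proof. by rewrite EgX; congr expR; field. Qed.

Let u w : R := g w - 1.

Let mu : measurable_fun setT u.
Proof. exact: measurable_funB. Qed.

Let ic (r : R) : P.-integrable setT (EFin \o cst r).
Proof. exact: (@bounded_integrable _ _ _ P _ `|r|). Qed.

Let iD (f f' : Omega -> R) : P.-integrable setT (EFin \o f) ->
  P.-integrable setT (EFin \o f') -> P.-integrable setT (EFin \o (f \+ f')).
Proof. by move=> i1 i2; apply: eq_integrable (integrableD measurableT i1 i2). Qed.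

Let iZ (r : R) (f : Omega -> R) : P.-integrable setT (EFin \o f) ->
  P.-integrable setT (EFin \o (fun w => r * f w)).
Proof. by move=> i1; apply: eq_integrable (integrableZl measurableT r i1). Qed.

Let u2E w : u w ^+ 2 = g w ^+ 2 + ((-2) * g w ^+ 1 + 1).
Proof. by rewrite /u; ring. Qed.

Let u4E w : u w ^+ 4 = g w ^+ 4 + ((-4) * g w ^+ 3 + (6 * g w ^+ 2 + ((-4) * g w ^+ 1 + 1))).
Proof. by rewrite /u; ring. Qed.

Let iu2 : P.-integrable setT (EFin \o (fun w => u w ^+ 2)).
Proof.
rewrite (_ : (fun w => _) = (fun w => g w ^+ 2) \+ ((fun w => (-2) * g w ^+ 1) \+ cst 1)).
  by apply: iD; [exact: igX|apply: iD; [apply: iZ; exact: igX|exact: ic]].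
by apply/funext => w; rewrite u2E.
Qed.

Let iu4 : P.-integrable setT (EFin \o (fun w => u w ^+ 4)).
Proof.
rewrite (_ : (fun w => _) = (fun w => g w ^+ 4) \+ ((fun w => (-4) * g w ^+ 3) \+
   ((fun w => 6 * g w ^+ 2) \+ ((fun w => (-4) * g w ^+ 1) \+ cst 1)))).
  apply: iD; first exact: igX.
  apply: iD; first by apply: iZ; exact: igX.
  apply: iD; first by apply: iZ; exact: igX.
  by apply: iD; [apply: iZ; exact: igX|exact: ic].
by apply/funext => w; rewrite u4E.
Qed.

Let Eu2 : \int[P]_w (u w ^+ 2) = expR h - 1.
Proof.
under eq_Rintegral do rewrite u2E.
have i1 := iD (iZ (-2) (igX 1)) (ic 1).
rewrite (RintegralD measurableT (igX 2) i1).
rewrite (RintegralD measurableT (iZ (-2) (igX 1)) (ic 1)).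
rewrite (RintegralZl (-2) measurableT (igX 1)) Eg1 Eg2 Rintegral_prob_cst.
by ring.
Qed.

Let Eu4 : \int[P]_w (u w ^+ 4) = expR (6 * h) - 4 * expR (3 * h) + 6 * expR h - 3.
Proof.
under eq_Rintegral do rewrite u4E.
have i1 := iD (iZ (-4) (igX 1)) (ic 1).
have i2 := iD (iZ 6 (igX 2)) i1.
have i3 := iD (iZ (-4) (igX 3)) i2.
rewrite (RintegralD measurableT (igX 4) i3).
rewrite (RintegralD measurableT (iZ (-4) (igX 3)) i2).
rewrite (RintegralD measurableT (iZ 6 (igX 2)) i1).
rewrite (RintegralD measurableT (iZ (-4) (igX 1)) (ic 1)).
rewrite (RintegralZl (-4) measurableT (igX 3)) (RintegralZl 6 measurableT (igX 2)).
rewrite (RintegralZl (-4) measurableT (igX 1)) Eg1 Eg2 Eg3 Eg4 Rintegral_prob_cst.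
by ring.
Qed.

Let Eu3 : h <= 1 / 12 ->
  \int[P]_w (1 / 2 * (Num.sqrt h * u w ^+ 2 + (Num.sqrt h)^-1 * u w ^+ 4)) <=
  43 * (h * Num.sqrt h).
Proof.
move=> h12.
have q0 : 0 < Num.sqrt h by rewrite sqrtr_gt0.
have hq : h = Num.sqrt h * Num.sqrt h by rewrite -expr2 sqr_sqrtr// ltW.
move: (Num.sqrt h) q0 hq => q q0 hq.
have i1 := iZ q iu2; have i2 := iZ q^-1 iu4.
rewrite (RintegralZl (1 / 2) measurableT (iD i1 i2)) (RintegralD measurableT i1 i2).
rewrite (RintegralZl q measurableT iu2) (RintegralZl q^-1 measurableT iu4) Eu2 Eu4.
exact: lognormal_third_moment_bound.
Qed.

(** [xi] may change sign, while the product formula for independent variables asks for nonnegative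
    factors: [xi] is shifted by its bound, and [g] has mean 1. *)
Lemma expectation_mul_incr (xi : Omega -> R) B : sub_measurable G xi ->
  (forall w, `|xi w| <= B) ->
  P.-integrable setT (EFin \o (fun w => xi w * u w)) /\ \int[P]_w (xi w * u w) = 0.
Proof.
move=> Gxi xiB; pose xi' w := xi w + B.
have xi0 w : 0 <= xi' w.
  by rewrite /xi' -lerBlDr sub0r; have := xiB w; rewrite ler_norml => /andP[].
have Gxi' : sub_measurable G xi'.
  apply: (@sub_measurable_comp _ _ _ _ xi (fun x => x + B)) => //.
  exact: measurable_funD.
have mxi := sub_measurable_fun GM Gxi; have mxi' := sub_measurable_fun GM Gxi'.
have ixi' : P.-integrable setT (EFin \o xi').
  apply: (@bounded_integrable _ _ _ P _ (B + B)) => // w.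
  by rewrite ger0_norm// lerD2r; have := xiB w; rewrite ler_norml => /andP[].
have e : (\int[P]_w (xi' w * g w)%:E = \int[P]_w (xi' w)%:E)%E.
  have := @ge0_integral_indep _ _ _ P G GM xi' D (fun x => expR (x - h / 2)) Gxi' mD indD xi0.
  rewrite (_ : (fun w => _) = (fun w => (xi' w * g w)%:E))// => ->.
  - have := integral_gX 1; rewrite (_ : _ * h / 2 = 0) ?expR0; last by field.
    by rewrite /g => ->; rewrite mule1.
  - by apply: measurableT_comp => //; exact: measurable_funB.
  - by move=> x; exact: expR_ge0.
have ixg : P.-integrable setT (EFin \o (fun w => xi' w * g w)).
  apply/integrableP; split; first by apply/measurable_EFinP/measurable_funM.
  rewrite (eq_integral (fun w => (xi' w * g w)%:E)) ?e; last first.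
    by move=> w _ /=; rewrite ger0_norm// mulr_ge0// expR_ge0.
  move/integrableP : ixi' => [_]; apply: le_lt_trans.
  by apply: ge0_le_integral => //=; [move=> w _; rewrite lee_fin|exact/measurable_EFinP
    |by apply/measurable_EFinP; exact: measurableT_comp|move=> w _; rewrite lee_fin ler_norm].
have eq w : xi w * u w = xi' w * g w + ((-1) * xi' w + ((- B) * g w ^+ 1 + B)).
  by rewrite /xi' /u; ring.
have i1 := iD (iZ (- B) (igX 1)) (ic B).
have i2 := iD (iZ (-1) ixi') i1.
split.
  rewrite (_ : (fun w => _) = (fun w => xi' w * g w) \+ ((fun w => (-1) * xi' w) \+
    ((fun w => (- B) * g w ^+ 1) \+ cst B))); first exact: iD ixg i2.
  by apply/funext => w; rewrite eq.
under eq_Rintegral do rewrite eq.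
rewrite (RintegralD measurableT ixg i2) (RintegralD measurableT (iZ (-1) ixi') i1).
rewrite (RintegralD measurableT (iZ (- B) (igX 1)) (ic B)).
rewrite (RintegralZl (-1) measurableT ixi') (RintegralZl (-B) measurableT (igX 1)).
rewrite Eg1 Rintegral_prob_cst [X in X + _](_ : _ = \int[P]_w xi' w).
  by ring.
by rewrite /Rintegral e.
Qed.

Lemma expectation_mul_incr2 (xi : Omega -> R) B : sub_measurable G xi ->
  (forall w, 0 <= xi w <= B) ->
  P.-integrable setT (EFin \o (fun w => xi w * u w ^+ 2)) /\
  \int[P]_w (xi w * u w ^+ 2) = (\int[P]_w xi w) * (expR h - 1).
Proof.
move=> Gxi xiB; have mxi := sub_measurable_fun GM Gxi.
have xi0 w : 0 <= xi w by have /andP[] := xiB w.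
split.
  apply: (@integrable_dominated _ _ _ P _ (fun w => B * u w ^+ 2)).
  - by apply: measurable_funM => //; exact: measurable_funX.
  - exact: iZ iu2.
  - move=> w; rewrite normrM !ger0_norm ?sqr_ge0// ler_wpM2r ?sqr_ge0//.
    by have /andP[] := xiB w.
have := @ge0_integral_indep _ _ _ P G GM xi D
  (fun x => (expR (x - h / 2) - 1) ^+ 2) Gxi mD indD xi0.
move=> e; rewrite -Eu2 /Rintegral -fineM.
- rewrite -[in RHS]e//; last by move=> x; exact: sqr_ge0.
  apply: measurable_funX; apply: measurable_funB => //.
  by apply: measurableT_comp => //; exact: measurable_funB.
- apply: integrable_fin_num => //; apply: (@bounded_integrable _ _ _ P _ B) => // w.
  by rewrite ger0_norm//; have /andP[] := xiB w.
- exact: integrable_fin_num iu2.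
Qed.

(* The integrand dominates [|u| ^+ 3]. *)
Lemma expectation_incr3 : h <= 1 / 12 ->
  P.-integrable setT (EFin \o (fun w => 1 / 2 *
    (Num.sqrt h * u w ^+ 2 + (Num.sqrt h)^-1 * u w ^+ 4))) /\
  \int[P]_w (1 / 2 * (Num.sqrt h * u w ^+ 2 + (Num.sqrt h)^-1 * u w ^+ 4)) <=
  43 * (h * Num.sqrt h).
Proof. by move=> h12; split; [exact: (iZ (1 / 2) (iD (iZ _ iu2) (iZ _ iu4)))|exact: Eu3]. Qed.

End lognormal_increment.

(** * Expansion of the truncated exponential *)

Section clamp_taylor.
Context {R : realType}.
Implicit Types (K Phi m phi g : R).

(** The first summand serves when the truncation is inactive; the factor 3 there is 1 for the
    prefactor [expR (m * phi)] and 2 for the increment of the exponent. The second summand serves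
    when the truncation acts. *)
Definition clamp_cst K Phi : R :=
  expR (3 * (K * Phi)) * (K * Phi) ^+ 3 + expR (K * Phi) * K ^+ 3 * (2 + Phi + Phi ^+ 2).

(* When the truncation at [K] is active, [m * (g - 1) > 1], so that the cubic
   term absorbs the whole left-hand side. *)
Lemma clamp_taylor K Phi m phi g : 0 <= m -> m <= K - 1 -> 0 < g -> `|phi| <= Phi ->
  `|expR (Num.min (m * g) K * phi) - expR (m * phi)
    - expR (m * phi) * phi * m * (g - 1)
    - 1 / 2 * (expR (m * phi) * phi ^+ 2 * m ^+ 2) * (g - 1) ^+ 2| <=
  clamp_cst K Phi * `|g - 1| ^+ 3.
Proof.
move=> m0 mK g0 phiP.
have P0 : 0 <= Phi by apply: le_trans phiP.
have K0 : 0 <= K by lra.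
have mK' : m <= K by lra.
have KP0 : 0 <= K * Phi by exact: mulr_ge0.
have xle y : 0 <= y -> y <= K -> `|y * phi| <= K * Phi.
  by move=> y0 yK; rewrite normrM ger0_norm//; apply: ler_pM.
have ele y : 0 <= y -> y <= K -> expR (y * phi) <= expR (K * Phi).
  by move=> y0 yK; rewrite ler_expR (le_trans (ler_norm _))// xle.
have emp : expR (m * phi) <= expR (K * Phi) by exact: ele.
have c1 : 0 <= expR (3 * (K * Phi)) * (K * Phi) ^+ 3 by rewrite mulr_ge0 ?expR_ge0 ?exprn_ge0.
have c2 : 0 <= expR (K * Phi) * K ^+ 3 * (2 + Phi + Phi ^+ 2).
  by rewrite mulr_ge0 ?mulr_ge0 ?expR_ge0 ?exprn_ge0// !addr_ge0// sqr_ge0.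
have [mgK|Kmg] := leP (m * g) K.
  pose y := m * phi * (g - 1).
  have e : m * g * phi = m * phi + y by rewrite /y; ring.
  have -> : expR (m * g * phi) - expR (m * phi) - expR (m * phi) * phi * m * (g - 1)
      - 1 / 2 * (expR (m * phi) * phi ^+ 2 * m ^+ 2) * (g - 1) ^+ 2 =
      expR (m * phi) * (expR y - 1 - y - y ^+ 2 / 2).
    by rewrite e expRD /y; field.
  have yle : `|y| <= 2 * (K * Phi).
    have -> : y = m * g * phi - m * phi by rewrite e; ring.
    apply: (le_trans (ler_normB _ _)).
    have mg0 : 0 <= m * g by rewrite mulr_ge0// ltW.
    by have := xle _ mg0 mgK; have := xle _ m0 mK'; lra.
  rewrite normrM ger0_norm ?expR_ge0// /clamp_cst mulrDl.
  apply: (@le_trans _ _ (expR (3 * (K * Phi)) * (K * Phi) ^+ 3 * `|g - 1| ^+ 3)); last first.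
    by rewrite lerDl mulr_ge0// exprn_ge0.
  apply: (@le_trans _ _ (expR (K * Phi) * (expR (2 * (K * Phi)) * `|y| ^+ 3))).
    apply: ler_pM => //.
    apply: (le_trans (expR_taylor3 y)); apply: ler_pM; rewrite ?expR_ge0 ?exprn_ge0//.
    by rewrite ler_expR.
  rewrite mulrA -expRD (_ : K * Phi + _ = 3 * (K * Phi)); last by ring.
  rewrite -mulrA ler_wpM2l ?expR_ge0// -exprMn lerXn2r ?nnegrE ?mulr_ge0//.
  by rewrite /y normrM ler_wpM2r// xle.
have mpos : 0 < m.
  by rewrite lt_neqAle m0 andbT; apply/eqP => m00; move: Kmg; rewrite -m00 mul0r; lra.
have mu1 : 1 < m * (g - 1) by rewrite mulrBr mulr1; lra.
have u0 : 0 < g - 1 by rewrite -(pmulr_rgt0 _ mpos); lra.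
set u := g - 1; rewrite -/u in u0 mu1.
(* Since [K * u >= 1], its cube dominates its lower powers, and each of the four terms is bounded
   separately; [2 + Phi + Phi ^+ 2] collects their coefficients. *)
have Ku1 : 1 <= K * u.
  by apply: ltW; apply: (lt_le_trans mu1); rewrite ler_wpM2r// ltW.
have u00 := ltW u0.
have Ku0 : 0 <= K * u by exact: mulr_ge0.
have E0 := expR_ge0 (m * phi).
have Ku13 : 1 <= (K * u) ^+ 3 by rewrite exprn_ege1.
have Ku23 : (K * u) ^+ 2 <= (K * u) ^+ 3 by rewrite [leRHS]exprS ler_peMl// exprn_ge0.
have Ku12 : K * u <= (K * u) ^+ 3.
  by rewrite exprS ler_peMr// exprn_ege1.
have t1 : `|expR (K * phi)| <= expR (K * Phi) * (K * u) ^+ 3.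
  rewrite ger0_norm ?expR_ge0// -[leLHS]mulr1; apply: ler_pM => //; rewrite ?expR_ge0//.
  by apply: ele.
have t2 : `|expR (m * phi)| <= expR (K * Phi) * (K * u) ^+ 3.
  by rewrite ger0_norm// -[leLHS]mulr1; apply: ler_pM.
have mu0 : 0 <= m * u by exact: mulr_ge0.
have muK : m * u <= K * u by rewrite ler_wpM2r.
have t3 : `|expR (m * phi) * phi * m * u| <= expR (K * Phi) * (Phi * (K * u) ^+ 3).
  rewrite -!mulrA normrM (ger0_norm E0); apply: ler_pM => //.
  rewrite normrM; apply: ler_pM => //.
  by rewrite ger0_norm//; exact: le_trans Ku12.
have t4 : `|1 / 2 * (expR (m * phi) * phi ^+ 2 * m ^+ 2) * u ^+ 2| <=
    expR (K * Phi) * (Phi ^+ 2 * (K * u) ^+ 3).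
  have -> : 1 / 2 * (expR (m * phi) * phi ^+ 2 * m ^+ 2) * u ^+ 2 =
    expR (m * phi) * (phi ^+ 2 * ((m * u) ^+ 2 * (1 / 2))) by rewrite exprMn; ring.
  rewrite normrM (ger0_norm E0); apply: ler_pM => //.
  rewrite normrM normrX; apply: ler_pM; rewrite ?exprn_ge0//.
    by rewrite lerXn2r ?nnegrE.
  rewrite ger0_norm ?mulr_ge0 ?exprn_ge0//; apply: le_trans Ku23.
  rewrite -[leRHS]mulr1; apply: ler_pM; rewrite ?exprn_ge0//.
    by rewrite lerXn2r ?nnegrE.
  by lra.
apply: (@le_trans _ _ (expR (K * Phi) * (K * u) ^+ 3 + expR (K * Phi) * (K * u) ^+ 3 +
   expR (K * Phi) * (Phi * (K * u) ^+ 3) + expR (K * Phi) * (Phi ^+ 2 * (K * u) ^+ 3))).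
  apply: (le_trans (ler_normB _ _)); apply: lerD => //.
  apply: (le_trans (ler_normB _ _)); apply: lerD => //.
  by apply: (le_trans (ler_normB _ _)); apply: lerD.
rewrite (_ : _ + _ = expR (K * Phi) * K ^+ 3 * (2 + Phi + Phi ^+ 2) * `|u| ^+ 3).
  by rewrite /clamp_cst mulrDl lerDr mulr_ge0// exprn_ge0.
by rewrite ger0_norm// exprMn; ring.
Qed.

(** The expansion of a square. For [q] the square root of [h] the two terms balance: second and
    fourth moments of orders [h] and [h ^ 2] both turn into [h ^ (3/2)], and no odd absolute moment
    has to be computed. *)
Lemma cube_le_incr3 (q u : R) : 0 < q ->
  `|u| ^+ 3 <= 1 / 2 * (q * u ^+ 2 + q^-1 * u ^+ 4).
Proof.
move=> q0; have := sqr_ge0 (q * `|u| - u ^+ 2) => sq.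
rewrite -(ler_pM2l q0).
have -> : q * (1 / 2 * (q * u ^+ 2 + q^-1 * u ^+ 4)) = 1 / 2 * (q ^+ 2 * u ^+ 2 + u ^+ 4).
  by field; rewrite lt0r_neq0.
have e2 : `|u| ^+ 2 = u ^+ 2 by rewrite -normrX ger0_norm ?sqr_ge0.
have e : (q * `|u| - u ^+ 2) ^+ 2 = q ^+ 2 * u ^+ 2 + u ^+ 4 - 2 * (q * `|u| ^+ 3).
  have -> : u ^+ 4 = (u ^+ 2) ^+ 2 by rewrite -exprM.
  by rewrite -e2; move: `|u| => v; ring.
by rewrite e in sq; lra.
Qed.

End clamp_taylor.

(** * Measurability with respect to a sub-sigma-algebra *)

Lemma sub_measurableP {d : measure_display} {Omega : measurableType d}
    {R : realType} (G : set (set Omega)) (X : Omega -> R) : sigma_algebra setT G ->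
  sub_measurable G X <-> measurable_fun setT (X : g_sigma_algebraType G -> R).
Proof.
move=> sG; split=> [GX _ U mU|mX U mU].
  by rewrite setTI; apply: sub_sigma_algebra; exact: GX.
have := mX measurableT _ mU; rewrite setTI.
by rewrite /measurable/= (sigma_algebra_id sG).
Qed.

Section sub_measurable.
Context {d : measure_display} {Omega : measurableType d} {R : realType}.
Variable G : set (set Omega).
Hypothesis sG : sigma_algebra setT G.
Implicit Types f g : Omega -> R.

Lemma sub_measurable_cst (r : R) : sub_measurable G (cst r).
Proof. by apply/(sub_measurableP _ sG); exact: measurable_cst. Qed.

Lemma sub_measurable_add f g : sub_measurable G f -> sub_measurable G g ->
  sub_measurable G (fun w => f w + g w).
Proof.
move=> /(sub_measurableP _ sG) mf /(sub_measurableP _ sG) mg.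
by apply/(sub_measurableP _ sG)/measurable_funD.
Qed.

Lemma sub_measurable_sub f g : sub_measurable G f -> sub_measurable G g ->
  sub_measurable G (fun w => f w - g w).
Proof.
move=> /(sub_measurableP _ sG) mf /(sub_measurableP _ sG) mg.
by apply/(sub_measurableP _ sG)/measurable_funB.
Qed.

Lemma sub_measurable_mul f g : sub_measurable G f ->
  sub_measurable G g -> sub_measurable G (fun w => f w * g w).
Proof.
move=> /(sub_measurableP _ sG) mf /(sub_measurableP _ sG) mg.
by apply/(sub_measurableP _ sG)/measurable_funM.
Qed.

Lemma sub_measurable_indic (A : set Omega) : G A -> sub_measurable G (\1_A : Omega -> R).
Proof.
move=> GA; apply/(sub_measurableP _ sG).
apply: (@measurable_indic _ (g_sigma_algebraType G)).
by rewrite /measurable/= (sigma_algebra_id sG).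
Qed.

Lemma sub_measurable_expR f : sub_measurable G f ->
  sub_measurable G (fun w => expR (f w)).
Proof. by apply: sub_measurable_comp. Qed.

Lemma sub_measurable_sum (I : Type) (r : seq I) (F : I -> Omega -> R) :
  (forall i, sub_measurable G (F i)) ->
  sub_measurable G (fun w => \sum_(i <- r) F i w).
Proof.
move=> mF; apply/(sub_measurableP _ sG).
apply: (@measurable_sum _ (g_sigma_algebraType G) _ setT) => i.
exact/(sub_measurableP _ sG).
Qed.

Lemma sub_measurable_cvg (F : nat -> Omega -> R) f :
  (forall n, sub_measurable G (F n)) ->
  (forall w, F n w @[n --> \oo] --> f w) -> sub_measurable G f.
Proof.
move=> mF Ff; apply/(sub_measurableP _ sG).
apply: (@measurable_fun_cvg _ (g_sigma_algebraType G) R setT F f).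
  by move=> n; exact/(sub_measurableP _ sG).
by move=> w _; exact: Ff.
Qed.

Lemma sub_measurable_yld f g : sub_measurable G f -> sub_measurable G g ->
  (forall w, 0 <= f w) -> (forall w, 0 <= g w) ->
  sub_measurable G (fun w => yld (f w) (g w)).
Proof.
(* The denominators are at least 2, so that the inverse can be replaced by a function that is
   continuous on the whole line. *)
move=> mf mg f0 g0; pose inv2 (x : R) := (Num.max x 2)^-1.
have cinv : continuous inv2.
  move=> x; apply: cvgV.
    by rewrite gt_eqF// (@lt_le_trans _ _ 2)// le_max lexx orbT.
  exact: (continuous_max cvg_id (cvg_cst _)).
rewrite (_ : (fun w => _) = (fun w => 2 * g w * inv2 (2 + f w * g w))).
  apply: sub_measurable_mul => //.
    by apply: sub_measurable_mul => //; exact: sub_measurable_cst.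
  apply: (@sub_measurable_comp _ _ _ _ _ inv2).
    exact: continuous_measurable_fun.
  by apply: sub_measurable_add; [exact: sub_measurable_cst|exact: sub_measurable_mul].
by apply/funext => w; rewrite /yld /inv2 max_l ?yld_den.
Qed.

End sub_measurable.

(** * The mean of one step *)

Section one_step.
Context {d : measure_display} {Omega : measurableType d} {R : realType}.
Variables (P : probability Omega R) (G : set (set Omega)) (D : Omega -> R) (h : R).
Hypothesis GM : G `<=` measurable.
Hypothesis mD : measurable_fun setT D.
Hypothesis indD : independent_of P D G.
Hypothesis h0 : 0 < h.
Hypothesis h12 : h <= 1 / 12.
Hypothesis lawD : forall U : set R, measurable U ->
  P (D @^-1` U) = normal_prob 0 (Num.sqrt h) U.
Variables (mx my phi : Omega -> R) (C : set Omega) (K Phi : R).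
Hypothesis sG : sigma_algebra setT G.
Hypothesis GC : G C.
Hypothesis Gmx : sub_measurable G mx.
Hypothesis Gphi : sub_measurable G phi.
Hypothesis mmy : measurable_fun setT my.
Hypothesis mxK : forall w, 0 <= mx w <= K.
Hypothesis myK : forall w, 0 <= my w <= K.
Hypothesis phiP : forall w, `|phi w| <= Phi.
Hypothesis Cmx : forall w, C w -> mx w <= K - 1.
Hypothesis Cmy : forall w, C w -> my w = Num.min (mx w * expR (D w - h / 2)) K.

(** The first term is the cubic Taylor remainder times the third-moment constant 43; the second pays
    for replacing the variance [expR h - 1] of the increment by [h]. *)
Definition one_step_cst := 43 * clamp_cst K Phi + expR (K * Phi) * Phi ^+ 2 * K ^+ 2.

(** Taylor expansion in the relative increment [u] of [M]: the linear term has mean zero, the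
    quadratic one is offset by the subtracted term up to [expR h - 1 - h], and the rest is cubic.
    Conditioning is expressed by the factor [\1_C] with [C] in [G]. *)
Lemma one_step_le :
  `|\int[P]_w (\1_C w * (expR (my w * phi w) - expR (mx w * phi w)
     - h / 2 * (mx w ^+ 2 * phi w ^+ 2 * expR (mx w * phi w))))| <=
  one_step_cst * (h * Num.sqrt h).
Proof.
have P0 : 0 <= Phi by apply: le_trans (phiP point).
have K0 : 0 <= K by have /andP[h1 h2] := mxK point; exact: le_trans h2.
have KP0 : 0 <= K * Phi by exact: mulr_ge0.
have q0 : 0 < Num.sqrt h by rewrite sqrtr_gt0.
have hq : h = Num.sqrt h * Num.sqrt h by rewrite -expr2 sqr_sqrtr// ltW.
(* This charges the error [2 * h ^+ 2] of [expR h - 1 - h] to [h * Num.sqrt h]. *)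
have hleq : h <= Num.sqrt h.
  have h1 : h <= 1 by apply: (le_trans h12); rewrite ler_pdivrMr// mul1r ler1n.
  have q1 : Num.sqrt h <= 1 by rewrite -[X in _ <= X]sqrtr1 ler_sqrt.
  by rewrite {1}hq ler_piMl// ltW.
have elex m w : 0 <= m <= K -> expR (m * phi w) <= expR (K * Phi).
  move=> /andP[m0 mK]; rewrite ler_expR (le_trans (ler_norm _))// normrM ger0_norm//.
  exact: ler_pM.
have ind01 w : 0 <= (\1_C w : R) <= 1.
  by rewrite indicE; case: (w \in C); rewrite ?ler01 ?lexx.
have mD' : measurable_fun setT (fun w => expR (D w - h / 2)).
  by apply: measurableT_comp => //; exact: measurable_funB.
pose u w := expR (D w - h / 2) - 1.
pose E w := expR (mx w * phi w).
pose xi1 w := \1_C w * (E w * (phi w * mx w)).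
pose xi2 w := \1_C w * (1 / 2 * (E w * ((phi w * phi w) * (mx w * mx w)))).
pose S w := \1_C w * (expR (my w * phi w) - expR (mx w * phi w)
     - h / 2 * (mx w ^+ 2 * phi w ^+ 2 * expR (mx w * phi w))).
pose W w := 1 / 2 * (Num.sqrt h * u w ^+ 2 + (Num.sqrt h)^-1 * u w ^+ 4).
have GE : sub_measurable G E by apply: sub_measurable_expR; exact: (sub_measurable_mul sG).
have Gxi1 : sub_measurable G xi1.
  apply: (sub_measurable_mul sG); first exact: (sub_measurable_indic sG).
  by apply: (sub_measurable_mul sG) => //; exact: (sub_measurable_mul sG).
have Gxi2 : sub_measurable G xi2.
  apply: (sub_measurable_mul sG); first exact: (sub_measurable_indic sG).
  apply: (@sub_measurable_comp _ _ _ _ _ (fun x => 1 / 2 * x)); first exact: measurable_funM.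
  apply: (sub_measurable_mul sG) => //; apply: (sub_measurable_mul sG);
    exact: (sub_measurable_mul sG).
have E0 w : 0 <= E w <= expR (K * Phi) by rewrite expR_ge0 elex.
have mxw w : `|mx w| <= K by have /andP[m0 m1] := mxK w; rewrite ger0_norm.
have xi1B w : `|xi1 w| <= 1 * (expR (K * Phi) * (Phi * K)).
  have /andP[i0 i1] := ind01 w; have /andP[E1 E2] := E0 w.
  rewrite /xi1 normrM (ger0_norm i0); apply: ler_pM => //.
  rewrite normrM (ger0_norm E1); apply: ler_pM => //.
  by rewrite normrM; apply: ler_pM.
have xi2B w : 0 <= xi2 w <= 1 * (1 / 2 * (expR (K * Phi) * ((Phi * Phi) * (K * K)))).
  have /andP[i0 i1] := ind01 w; have /andP[E1 E2] := E0 w.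
  have p2 : 0 <= phi w * phi w by rewrite -expr2 sqr_ge0.
  have m2 : 0 <= mx w * mx w by rewrite -expr2 sqr_ge0.
  have pp : phi w * phi w * (mx w * mx w) <= (Phi * Phi) * (K * K).
    have pP : `|phi w| * `|phi w| <= Phi * Phi by apply: ler_pM.
    have mK : `|mx w| * `|mx w| <= K * K by apply: ler_pM.
    by rewrite -!normrM !ger0_norm// in pP mK; apply: ler_pM.
  have EE : E w * (phi w * phi w * (mx w * mx w)) <= expR (K * Phi) * ((Phi * Phi) * (K * K)).
    by apply: ler_pM => //; exact: mulr_ge0.
  have EE0 : 0 <= E w * (phi w * phi w * (mx w * mx w)) by rewrite mulr_ge0// mulr_ge0.
  have hE0 : 0 <= 1 / 2 * (E w * (phi w * phi w * (mx w * mx w))) by exact: mulr_ge0.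
  rewrite /xi2; apply/andP; split; first exact: mulr_ge0.
  by apply: ler_pM => //; exact: ler_wpM2l.
have [i1 e1] := expectation_mul_incr GM mD indD h0 lawD Gxi1 xi1B.
have [i2 e2] := expectation_mul_incr2 GM mD indD h0 lawD Gxi2 xi2B.
have [i3 e3] := expectation_incr3 mD h0 lawD h12.
have mxi2 := sub_measurable_fun GM Gxi2.
have ixi2 : P.-integrable setT (EFin \o xi2).
  apply: bounded_integrable mxi2 _ => w.
  by have /andP[x0 x1] := xi2B w; rewrite ger0_norm; [exact: x1|exact: x0].
have mmx := sub_measurable_fun GM Gmx; have mphi := sub_measurable_fun GM Gphi.
have mE := sub_measurable_fun GM GE.
have mC : measurable C by exact: GM.
have mS : measurable_fun setT S.
  apply: measurable_funM; first exact: measurable_indic.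
  apply: measurable_funB.
    apply: measurable_funB; last exact: mE.
    by apply: measurableT_comp => //; exact: measurable_funM.
  apply: measurable_funM => //; apply: measurable_funM; last exact: mE.
  by apply: measurable_funM; exact: measurable_funX.
have iS : P.-integrable setT (EFin \o S).
  apply: (@bounded_integrable _ _ _ P S (1 * (expR (K * Phi) + expR (K * Phi) +
     h / 2 * (K ^+ 2 * Phi ^+ 2 * expR (K * Phi))))) => // w.
  have /andP[j0 j1] := ind01 w; have /andP[E1 E2] := E0 w.
  rewrite /S normrM (ger0_norm j0); apply: ler_pM => //.
  apply: (le_trans (ler_normB _ _)); apply: lerD.
    apply: (le_trans (ler_normB _ _)).
    by apply: lerD; rewrite ger0_norm ?expR_ge0// elex.
  rewrite normrM (ger0_norm (_ : 0 <= h / 2)); last by rewrite divr_ge0// ltW.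
  apply: ler_pM => //; first by rewrite divr_ge0// ltW.
  rewrite normrM; apply: ler_pM => //; last by rewrite ger0_norm// expR_ge0.
  by rewrite normrM; apply: ler_pM => //; rewrite normrX lerXn2r ?nnegrE.
(* The term [h * xi2] undoes the correction contained in [S], so that [Rr] is on [C] exactly the
   Taylor remainder of [clamp_taylor]. *)
pose Rr w := S w + ((-1) * (xi1 w * u w) + ((-1) * (xi2 w * u w ^+ 2) + h * xi2 w)).
have iZ (r : R) (f : Omega -> R) : P.-integrable setT (EFin \o f) ->
    P.-integrable setT (EFin \o (fun w => r * f w)).
  by move=> j1; apply: eq_integrable (integrableZl measurableT r j1).
have iD (f f' : Omega -> R) : P.-integrable setT (EFin \o f) ->
    P.-integrable setT (EFin \o f') -> P.-integrable setT (EFin \o (f \+ f')).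
  by move=> j1 j2; apply: eq_integrable (integrableD measurableT j1 j2).
have k3 := iD _ _ (iZ (-1) _ i2) (iZ h _ ixi2).
have k2 := iD _ _ (iZ (-1) _ i1) k3.
have iR : P.-integrable setT (EFin \o Rr) by exact: iD _ _ iS k2.
have ER : \int[P]_w Rr w = \int[P]_w S w +
    ((-1) * 0 + ((-1) * (\int[P]_w xi2 w * (expR h - 1)) + h * \int[P]_w xi2 w)).
  rewrite (RintegralD measurableT iS k2) (RintegralD measurableT (iZ (-1) _ i1) k3).
  rewrite (RintegralD measurableT (iZ (-1) _ i2) (iZ h _ ixi2)).
  rewrite (RintegralZl (-1) measurableT i1) (RintegralZl (-1) measurableT i2).
  by rewrite (RintegralZl h measurableT ixi2) e1 e2.
have cc0 : 0 <= clamp_cst K Phi.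
  rewrite /clamp_cst addr_ge0// ?mulr_ge0 ?mulr_ge0 ?expR_ge0 ?exprn_ge0//.
  by rewrite !addr_ge0// sqr_ge0.
have RW w : `|Rr w| <= clamp_cst K Phi * W w.
  have h3 := cube_le_incr3 (u w) q0.
  have [wC|wC] := pselect (C w); last first.
    have -> : Rr w = 0.
      have c0 : \1_C w = 0 :> R by rewrite indicE memNset.
      by rewrite /Rr /S /xi1 /xi2 c0; ring.
    rewrite normr0 mulr_ge0//; apply: le_trans h3; exact: exprn_ge0.
  apply: (@le_trans _ _ (clamp_cst K Phi * `|u w| ^+ 3)); last exact: ler_wpM2l.
  have /andP[m0 m1] := mxK w.
  have := clamp_taylor m0 (Cmx wC) (expR_gt0 (D w - h / 2)) (phiP w).
  rewrite -(Cmy wC); apply: le_trans; rewrite le_eqVlt; apply/orP; left.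
  have c1 : \1_C w = 1 :> R by rewrite indicE mem_set.
  apply/eqP; congr (`|_|); rewrite /Rr /S /xi1 /xi2 c1 /E -/(u w).
  by field.
have := norm_expectation_le iR (iZ (clamp_cst K Phi) _ i3) RW.
rewrite (RintegralZl _ measurableT i3) => RR.
have RR' : `|\int[P]_w Rr w| <= clamp_cst K Phi * (43 * (h * Num.sqrt h)).
  by apply: (le_trans RR); exact: ler_wpM2l.
set b := 1 * (1 / 2 * (expR (K * Phi) * ((Phi * Phi) * (K * K)))) in xi2B.
have ib : P.-integrable setT (EFin \o cst b) by exact: (@bounded_integrable _ _ _ P _ `|b|).
have ab : `|\int[P]_w xi2 w| <= b.
  apply: (le_trans (norm_expectation_le ixi2 ib _)); last by rewrite /= Rintegral_prob_cst.
  by move=> w; have /andP[x0 x1] := xi2B w; rewrite ger0_norm; [exact: x1|exact: x0].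
have eh : `|expR h - 1 - h| <= 2 * (h * Num.sqrt h).
  have eh0 : 0 <= expR h - 1 - h by rewrite -addrA -opprD subr_ge0 expR_ge1Dx.
  have eh1 : expR h <= 1 + h + 2 * h ^+ 2.
    apply: expR_le_quadratic; first exact: ltW.
    apply: (le_trans h12); rewrite ler_pM2l// lef_pV2 ?posrE//; exact: ler_nat.
  rewrite ger0_norm// -addrA -opprD lerBlDl (le_trans eh1)// lerD2l ler_wpM2l// expr2.
  by rewrite ler_wpM2l// ltW.
(* Beside the remainder, only the gap between the variance of the increment and [h] survives. *)
have -> : \int[P]_w S w = \int[P]_w Rr w + (\int[P]_w xi2 w) * (expR h - 1 - h).
  by rewrite ER; ring.
apply: (le_trans (ler_normD _ _)); rewrite /one_step_cst mulrDl; apply: lerD.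
  by rewrite (mulrC 43) -mulrA.
rewrite normrM; apply: (@le_trans _ _ (b * (2 * (h * Num.sqrt h)))).
  exact: ler_pM.
rewrite le_eqVlt; apply/orP; left.
by apply/eqP; rewrite /b; field.
Qed.

End one_step.

(** * Adaptedness of the path functionals *)

Section adapted_path.
Context {d : measure_display} {Omega : measurableType d} {R : realType}.
Variables (Fil : R -> set (set Omega)) (lam : R) (c : cumulative R R).
Hypothesis filF : is_filtration Fil.
Hypothesis lam0 : 0 <= lam.
Hypothesis cc : continuous (c : R -> R).
Hypothesis c0 : forall t, c t <= 0.
Variable X : Omega -> R -> R.
Hypothesis Xc : forall w, continuous (X w).
Hypothesis X0 : forall w t, 0 <= X w t.
Hypothesis Xad : forall t, 0 <= t -> sub_measurable (Fil t) (X ^~ t).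

Lemma filtration_sigma t : 0 <= t -> sigma_algebra setT (Fil t).
Proof. by case: filF => h _ _; exact: h. Qed.

Lemma sub_measurable_mono s t (f : Omega -> R) : 0 <= s -> s <= t ->
  sub_measurable (Fil s) f -> sub_measurable (Fil t) f.
Proof.
by move=> s0 st mf U mU; case: filF => _ _ h; exact: (h s t s0 st _ (mf U mU)).
Qed.

(** The Riemann sums use the integrand at times up to [t] only and converge at every outcome, so
    that no null sets have to belong to [Fil t]. *)
Lemma sub_measurable_stieltjes (c' : cumulative R R) (k : Omega -> R -> R) t : 0 <= t ->
  (forall w, continuous (k w)) ->
  (forall s, 0 <= s -> sub_measurable (Fil s) (k ^~ s)) ->
  sub_measurable (Fil t) (fun w => stieltjes c' (k w) 0 t).
Proof.
move=> t0 ck mk; have sF := filtration_sigma t0.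
apply: (sub_measurable_cvg sF (F := fun n w => \sum_(i < n.+1)
  k w (grid 0 t n i) * (c' (grid 0 t n i.+1) - c' (grid 0 t n i)))); last first.
  by move=> w; exact: stieltjes_riemann.
move=> n; apply: sub_measurable_sum => // i.
apply: sub_measurable_mul => //; last exact: sub_measurable_cst.
have /andP[g0 gt] := grid_itv t0 (ltnW (ltn_ord i)).
exact: sub_measurable_mono (mk _ g0).
Qed.

Section at_time.
Variable t : R.
Hypothesis t0 : 0 <= t.

Lemma sub_measurable_area : sub_measurable (Fil t) (fun w => area (X w) t).
Proof. exact: sub_measurable_stieltjes. Qed.

Lemma sub_measurable_expo : sub_measurable (Fil t) (fun w => expo lam c (X w) t).
Proof.
have sF := filtration_sigma t0.
apply: sub_measurable_sub => //.
  apply: sub_measurable_yld => //; [exact: sub_measurable_area|exact: sub_measurable_cst|].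
  by move=> w; exact: area_ge0.
apply: sub_measurable_yld => //; [exact: sub_measurable_area|exact: sub_measurable_cst| |].
  by move=> w; exact: area_ge0.
by move=> w; exact: Nc_ge0.
Qed.

Lemma sub_measurable_price : sub_measurable (Fil t) (fun w => price lam c (X w) t).
Proof.
have sF := filtration_sigma t0.
apply: sub_measurable_expR; apply: sub_measurable_mul => //; first exact: Xad.
exact: sub_measurable_expo.
Qed.

End at_time.

Lemma sub_measurable_fvpart t : 0 <= t ->
  sub_measurable (Fil t) (fun w => fvpart lam c (X w) t).
Proof.
move=> t0; have sF := filtration_sigma t0.
have my s : 0 <= s -> sub_measurable (Fil s) (fun w => yld (area (X w) s) (- c s)).
  move=> s0; have sFs := filtration_sigma s0.
  apply: sub_measurable_yld => //; [exact: sub_measurable_area|exact: sub_measurable_cst| |].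
    by move=> w; exact: area_ge0.
  by move=> w; exact: Nc_ge0.
apply: sub_measurable_add => //; apply: sub_measurable_stieltjes => //.
- by move=> w; exact: drift_dt_continuous.
- move=> s s0; have sFs := filtration_sigma s0; rewrite /drift_dt.
  apply: (@sub_measurable_comp _ _ _ _ _ -%R) => //.
  apply: sub_measurable_mul => //; last exact: sub_measurable_expo.
  apply: sub_measurable_mul => //; last exact: my.
  apply: sub_measurable_mul => //; last exact: sub_measurable_price.
  by apply: (@sub_measurable_comp _ _ _ _ _ (fun x => x ^+ 2)) => //; exact: Xad.
- by move=> w; exact: drift_dc_continuous.
- move=> s s0; have sFs := filtration_sigma s0.
  (* With [1 - a * yld a x / 2 = 2 / (2 + a * x)], the derivative becomes a polynomial in quantities
     already known to be measurable. *)
  have e w : 4 / (2 + area (X w) s * - c s) ^+ 2 =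
      (1 - area (X w) s * yld (area (X w) s) (- c s) * (1 / 2)) ^+ 2.
    have h := lt0r_neq0 (yld_den_gt0 (area_ge0 (X0 w) s) (Nc_ge0 c0 s)).
    by rewrite /yld; field.
  rewrite /drift_dc (_ : (fun w => _) = (fun w => X w s * price lam c (X w) s *
      (1 - area (X w) s * yld (area (X w) s) (- c s) * (1 / 2)) ^+ 2)); last first.
    by apply/funext => w; rewrite e.
  apply: sub_measurable_mul => //.
    by apply: sub_measurable_mul => //; [exact: Xad|exact: sub_measurable_price].
  apply: (@sub_measurable_comp _ _ _ _ _ (fun x => x ^+ 2)) => //.
  apply: sub_measurable_sub => //; first exact: sub_measurable_cst.
  apply: sub_measurable_mul => //; last exact: sub_measurable_cst.
  by apply: sub_measurable_mul => //; [exact: sub_measurable_area|exact: my].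
Qed.

Lemma sub_measurable_mpart t : 0 <= t ->
  sub_measurable (Fil t) (fun w => mpart lam c (X w) t).
Proof.
move=> t0; have sF := filtration_sigma t0.
apply: sub_measurable_sub => //; first exact: sub_measurable_price.
exact: sub_measurable_fvpart.
Qed.

End adapted_path.

(** * Hitting times and stopped sums *)

Section stopped_sum.
Context {R : realType}.
Implicit Types (f : R -> R) (tau : \bar R) (s t : R).

(** The condition is tested at the left end of each step, where it is known. The sum overshoots
    [tau] by at most one step, a price paid for having deterministic steps. *)
Definition stopped_sum f tau s t (n : nat) : R :=
  \sum_(i < n.+1) (if ((grid s t n i)%:E < tau)%E then
                     f (grid s t n i.+1) - f (grid s t n i) else 0).

(** The grid increases, so the steps begun before [tau] form an initial segment and their increments
    telescope. *)
Lemma stopped_sum_telescope f tau s t n N : s <= t ->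
  exists j, [/\ (j <= N)%N,
    \sum_(0 <= i < N) (if ((grid s t n i)%:E < tau)%E then
        f (grid s t n i.+1) - f (grid s t n i) else 0) =
      f (grid s t n j) - f (grid s t n 0),
    forall i, (i < j)%N -> ((grid s t n i)%:E < tau)%E
  & j = N \/ (tau <= (grid s t n j)%:E)%E].
Proof.
move=> st; elim: N => [|N [j [jN sumE jlt jN']]].
  by exists 0; split => //; [rewrite big_geq// subrr|left].
rewrite big_nat_recr//= sumE; case: jN' => [jE|taule].
  subst j; case: ifPn => lttau.
    exists N.+1; split => //; [by rewrite addrC addrA subrK|move=> i|by left].
    by rewrite ltnS leq_eqVlt => /predU1P[->//|]; exact: jlt.
  by exists N; split => //; [rewrite addr0|right; rewrite leNgt].
rewrite ifF; last first.
  apply/negbTE; rewrite -leNgt (le_trans taule)// lee_fin; exact: grid_le.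
by exists j; split => //; [exact: leqW|rewrite addr0|right].
Qed.

Lemma stopped_sumE f tau s t n : s <= t -> exists2 j, (j <= n.+1)%N &
  stopped_sum f tau s t n = f (grid s t n j) - f s /\
  ((s%:E < tau)%E -> `|grid s t n j - fine (mine t%:E tau)| <= (t - s) / n.+1%:R).
Proof.
move=> st; have [j [jN sumE jlt jN']] := stopped_sum_telescope f tau n n.+1 st.
exists j => //; split; first by move: sumE; rewrite big_mkord grid0.
move=> stau.
have j0 : (0 < j)%N.
  case: j jN {sumE} jlt jN' => // _ _ [//|].
  by rewrite grid0 leNgt stau.
(* The previous grid point lies before [tau], and the point [j] is either the last one or past
   [tau]: hence [mine t%:E tau] lies within the last step taken. *)
have jp := jlt j.-1; rewrite prednK// in jp; have {}jp := jp (leqnn _).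
have gj : grid s t n j - grid s t n j.-1 = (t - s) / n.+1%:R.
  by rewrite -{1}(prednK j0) gridS.
have /andP[_ gjt] := grid_itv (n := n) st jN.
have mesh0 : 0 <= (t - s) / n.+1%:R by rewrite divr_ge0// subr_ge0.
case: tau jlt jN' stau jp {sumE} => [r| |] //= jlt jN' stau jp.
- rewrite lte_fin in jp.
  case: jN' => [jE|]; rewrite /mine/=.
    rewrite jE gridn in gj gjt *.
    case: ifPn; rewrite lte_fin -?leNgt => tr.
      by rewrite subrr normr0.
    by rewrite /= ger0_norm ?subr_ge0// -gj lerD2l lerN2 -jE ltW// {2}jE.
  rewrite lee_fin => rg; case: ifPn; rewrite lte_fin -?leNgt => tr /=.
    by move: (lt_le_trans tr rg); rewrite ltNge gjt.
  by rewrite ger0_norm ?subr_ge0// -gj lerD2l lerN2 ltW.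
- case: jN' => [jE|]; last by rewrite leye_eq.
  by rewrite /mine ltry /= jE gridn subrr normr0.
Qed.

Lemma stopped_sum_cvg f tau s t : continuous f -> s <= t ->
  stopped_sum f tau s t n @[n --> \oo] -->
  f (fine (mine t%:E tau)) - f (fine (mine s%:E tau)).
Proof.
move=> cf st; have [stau|taus] := ltP s%:E tau; last first.
  have -> : mine t%:E tau = tau.
    by apply/min_idPr; rewrite (le_trans taus)// lee_fin.
  rewrite subrr (_ : stopped_sum f tau s t = cst 0); first exact: cvg_cst.
  apply/funext => n; rewrite /stopped_sum big1// => i _.
  rewrite ifF//; apply/negbTE; rewrite -leNgt (le_trans taus)// lee_fin.
  by have /andP[] := grid_itv st (ltnW (ltn_ord i)).
set r := fine (mine t%:E tau).
apply/cvgrPdist_lt => /= e e0.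
have /cvgrPdist_lt /(_ _ e0) [d /= d0 fd] := cf r.
near=> n.
have [j _ [-> /(_ stau) jr]] := stopped_sumE f tau n st.
rewrite opprB addrA subrK; apply: fd => /=; rewrite distrC.
apply: (le_lt_trans jr); near: n; exact: grid_mesh.
Unshelve. all: by end_near. Qed.

(** Because of the telescoping, the bound does not grow with the number of steps, as bounded
    convergence requires. *)
Lemma norm_stopped_sum_le f tau s t n Z : s <= t ->
  (forall x, s <= x <= t -> `|f x| <= Z) -> `|stopped_sum f tau s t n| <= Z + Z.
Proof.
move=> st fZ; have [j jn [-> _]] := stopped_sumE f tau n st.
apply: (le_trans (ler_normB _ _)); apply: lerD; apply: fZ; first exact: grid_itv.
by rewrite lexx.
Qed.

End stopped_sum.

Section clamp_itv.
Context {R : realType}.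

(** The retraction of the line onto [[0, t]]. It extends functions given on a segment to continuous
    functions on the line, and samples a path at rationals without leaving the segment. *)
Definition clamp_itv (t x : R) : R := Num.min (Num.max x 0) t.

Lemma clamp_itvP (t x : R) : 0 <= t -> 0 <= clamp_itv t x <= t.
Proof. by move=> t0; rewrite /clamp_itv le_min le_max lexx orbT t0 ge_min lexx orbT. Qed.

Lemma clamp_itv_id (t x : R) : 0 <= x <= t -> clamp_itv t x = x.
Proof. by move=> /andP[x0 xt]; rewrite /clamp_itv max_l// min_l. Qed.

Lemma clamp_itv_continuous (t : R) : continuous (clamp_itv t).
Proof.
move=> x; have h : {for x, continuous (fun x : R => Num.max x 0)}.
  exact: (continuous_max cvg_id (cvg_cst _)).
exact: (continuous_min h (cvg_cst _)).
Qed.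

End clamp_itv.

Section hitting_time.
Context {d : measure_display} {Omega : measurableType d} {R : realType}.
Variables (Fil : R -> set (set Omega)) (X : Omega -> R -> R).
Hypothesis filF : is_filtration Fil.
Hypothesis Xc : forall w, continuous (X w).
Hypothesis Xad : forall t, 0 <= t -> sub_measurable (Fil t) (X ^~ t).
Implicit Types (v t s : R) (w : Omega).

(** The infimum is [+oo] for a path that never reaches [v]. The set to be hit is closed, which makes
    this a stopping time without right-continuity of the filtration. *)
Definition hitting v w : \bar R :=
  ereal_inf [set s%:E | s in [set s | 0 <= s /\ v <= X w s]].

Lemma hitting_ge0 v w : (0 <= hitting v w)%E.
Proof. by apply: le_ereal_inf_tmp => _ [s [s0 _] <-]; rewrite lee_fin. Qed.

Lemma hitting_le v w s : 0 <= s -> v <= X w s -> (hitting v w <= s%:E)%E.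
Proof. by move=> s0 vs; apply: ereal_inf_lbound; exists s. Qed.

(** Continuity at [t] keeps the path below [v] a little longer, hence the strict inequality on the
    left. *)
Lemma hitting_gtP v w t : 0 <= t ->
  (t%:E < hitting v w)%E <-> (forall s, 0 <= s <= t -> X w s < v).
Proof.
move=> t0; split=> [tv s /andP[s0 st]|Xv].
  rewrite ltNge; apply/negP => vs; move: tv; rewrite ltNge.
  by rewrite (le_trans (hitting_le s0 vs)).
have : X w t < v by apply: Xv; rewrite t0 lexx.
move=> /(@cvgr_lt _ _ _ _ (X w) (X w t) (@Xc w t)) [e /= e0 Xe].
apply: (@lt_le_trans _ _ (t + e)%:E); first by rewrite lte_fin ltrDl.
apply: le_ereal_inf_tmp => _ [s [s0 vs] <-]; rewrite lee_fin leNgt.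
apply/negP => std; move: vs; apply/negP; rewrite -ltNge.
have [st|ts] := leP s t; first by apply: Xv; rewrite s0.
by apply: Xe => /=; rewrite distrC ger0_norm ?subr_ge0 ?(ltW ts)// ltrBlDl.
Qed.

Lemma hitting_nd v v' w : v <= v' -> (hitting v w <= hitting v' w)%E.
Proof.
move=> vv'; apply: le_ereal_inf_tmp => _ [s [s0 vs] <-].
by apply: hitting_le => //; exact: le_trans vs.
Qed.

(** A path that starts above [v] is stopped at 0 and violates the bound there; positivity of the
    stopped time excludes this. At the stopped time itself the bound follows from earlier times by
    continuity. *)
Lemma before_hitting_le v w t s : 0 <= t ->
  0 < fine (mine t%:E (hitting v w)) ->
  0 <= s <= fine (mine t%:E (hitting v w)) -> X w s <= v.
Proof.
move=> t0; set r := fine _ => r0 /andP[s0 sr].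
have rE : r%:E = mine t%:E (hitting v w).
  rewrite /r fineK// /mine; case: ifPn => //; rewrite -leNgt => ht.
  by rewrite ge0_fin_numE ?hitting_ge0// (le_lt_trans ht)// ltry.
have lt_le x : 0 <= x -> x < r -> X w x < v.
  move=> x0 xr; have : (x%:E < hitting v w)%E.
    have : (x%:E < mine t%:E (hitting v w))%E by rewrite -rE lte_fin.
    by rewrite lt_min => /andP[].
  by move/(hitting_gtP _ _ x0); apply; rewrite x0 lexx.
have [xr|rs|->] := ltgtP s r; first by apply: ltW; exact: lt_le.
  by move: sr; rewrite leNgt rs.
rewrite leNgt; apply/negP => /(@cvgr_gt _ _ _ _ (X w) (X w r) (@Xc w r)) [e /= e0 Xe].
pose x := Num.max 0 (r - e / 2).
have x0 : 0 <= x by rewrite le_max lexx.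
have xr : x < r by rewrite gt_max r0/= ltrBlDr ltrDl divr_gt0.
have := Xe x; rewrite /= ger0_norm ?subr_ge0 ?(ltW xr)//.
have xd : r - x < e.
  by rewrite ltrBlDl -ltrBlDr lt_max ltrD2l ltrN2 ltr_pdivrMr// ltr_pMr// ltr1n orbT.
by move=> /(_ xd); rewrite ltNge (ltW (lt_le _ x0 xr)).
Qed.

(** A countable description of the event, by values at times in [[0, t]]. Density of the rationals
    gives one inclusion; for the other, a path below [v] on [[0, t]] attains its maximum and stays
    away from [v] by some [1 / k.+1]. *)
Lemma hitting_leE v t : 0 <= t ->
  [set w | (hitting v w <= t%:E)%E] =
  \bigcap_k \bigcup_(q : rat) [set w | v - k.+1%:R^-1 < X w (clamp_itv t (ratr q))].
Proof.
move=> t0; apply/seteqP; split=> w /=.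
  move=> ht k _.
  have [s /andP[s0 st] vs] : exists2 s, 0 <= s <= t & v <= X w s.
    apply: contrapT => ex; have : (t%:E < hitting v w)%E.
      apply/(hitting_gtP _ _ t0) => s sI; rewrite ltNge; apply/negP => vs.
      by apply: ex; exists s.
    by rewrite ltNge ht.
  have cX : continuous (X w \o clamp_itv t).
    by move=> x; apply: continuous_comp; [exact: clamp_itv_continuous|exact: Xc].
  have oA : open ((X w \o clamp_itv t) @^-1` [set x | v - k.+1%:R^-1 < x]).
    by apply: open_comp => [x _|]; [exact: cX|exact: open_gt].
  have [|x [Ax [q _ qx]]] := @dense_rat R _ _ oA.
    exists s; rewrite /= clamp_itv_id ?s0//; apply: lt_le_trans vs.
    by rewrite ltrBlDr ltrDl invr_gt0 ltr0n.
  by exists q => //=; rewrite qx.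
move=> H; rewrite leNgt; apply/negP => /(hitting_gtP _ _ t0) Xv.
have [m mI Xm] := EVT_max t0 (continuous_subspaceT (@Xc w)).
rewrite in_itv/= in mI.
have := Xv _ mI; rewrite -subr_gt0 => vm.
have [k _ km] : exists2 k : nat, True & k.+1%:R^-1 < v - X w m.
  have /(_ _ _ vm) := @cvgr_lt _ _ _ _ (fun k : nat => k.+1%:R^-1 : R) 0 (@cvg_harmonic R).
  by move=> [N _ hN]; exists N => //; exact: (hN N (leqnn N)).
have [q _ /=] := H k Logic.I.
have := Xm (clamp_itv t (ratr q)); rewrite in_itv/= => /(_ (clamp_itvP _ t0)).
move=> h1 h2; have := lt_le_trans h2 h1.
by rewrite ltrBlDr -ltrBlDl ltNge (ltW km).
Qed.

Lemma hitting_stopping v : stopping_time Fil (hitting v).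
Proof.
split=> [w|t t0]; first exact: hitting_ge0.
have sF : sigma_algebra setT (Fil t) by case: filF => h _ _; exact: h.
rewrite hitting_leE//.
have mm : forall A, Fil t A <-> @measurable _ (g_sigma_algebraType (Fil t)) A.
  by move=> A; rewrite /measurable/= (sigma_algebra_id sF).
apply/mm; apply: bigcapT_measurable => k; apply: bigcupT_measurable_rat => q; apply/mm.
have /andP[c0 ct] := clamp_itvP (ratr q) t0.
rewrite [X in Fil t X](_ : _ = (X ^~ (clamp_itv t (ratr q))) @^-1` `]v - k.+1%:R^-1, +oo[).
  case: filF => _ _ h; apply: (h _ _ c0 ct); apply: Xad => //; exact: measurable_itv.
by apply/seteqP; split => w /=; rewrite in_itv/= andbT.
Qed.

Lemma hitting_cvg w : hitting n%:R w @[n --> \oo] --> +oo%E.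
Proof.
apply/cvgeyPgt => A; pose t := Num.max A 0.
have t0 : 0 <= t by rewrite le_max lexx orbT.
have [m mI Xm] := EVT_max t0 (continuous_subspaceT (@Xc w)).
near=> n; apply: (@le_lt_trans _ _ t%:E); first by rewrite lee_fin le_max lexx.
apply/(hitting_gtP _ _ t0) => s sI; apply: (le_lt_trans (Xm _ _)); first by rewrite in_itv.
near: n; exact: nbhs_infty_gtr.
Unshelve. all: by end_near. Qed.

End hitting_time.

Lemma continuous_comp_within {R : realType} (A : set R) (f h : R -> R) :
  {within A, continuous f} -> continuous h -> (forall x, A (h x)) ->
  continuous (f \o h).
Proof.
move=> /subspace_continuousP cf ch Ah x; apply: cvg_comp; last exact: cf.
move=> U /= HU; apply: (@filterS _ (nbhs x) _ (h @^-1` [set y | A y -> U y])).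
  by move=> y /(_ (Ah y)).
exact: (ch x _ HU).
Qed.

Lemma Rintegral_sum {d : measure_display} {Omega : measurableType d} {R : realType}
    (P : probability Omega R) (I : Type) (r : seq I) (f : I -> Omega -> R) :
  (forall i, P.-integrable setT (EFin \o f i)) ->
  P.-integrable setT (EFin \o (fun w => \sum_(i <- r) f i w)) /\
  \int[P]_w (\sum_(i <- r) f i w) = \sum_(i <- r) \int[P]_w f i w.
Proof.
move=> intf; elim: r => [|i r [IH1 IH2]].
  have -> : (fun w => \sum_(i <- [::]) f i w) = cst 0.
    by apply/funext => w; rewrite big_nil.
  rewrite big_nil Rintegral_prob_cst; split => //.
  by apply: (@bounded_integrable _ _ _ P (cst 0) 0) => // w; rewrite normr0.
rewrite big_cons -IH2 -(RintegralD measurableT (intf i) IH1); split; last first.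
  by apply: eq_Rintegral => w _; rewrite big_cons.
apply: eq_integrable (integrableD measurableT (intf i) IH1) => // w _ /=.
by rewrite big_cons.
Qed.

Lemma bounded_convergence {d : measure_display} {Omega : measurableType d}
    {R : realType} (P : probability Omega R) (f_ : nat -> Omega -> R)
    (f : Omega -> R) (b : R) :
  (forall n, measurable_fun setT (f_ n)) -> measurable_fun setT f ->
  (forall n w, `|f_ n w| <= b) -> (forall w, f_ n w @[n --> \oo] --> f w) ->
  \int[P]_w f_ n w @[n --> \oo] --> \int[P]_w f w.
Proof.
move=> mf_ mf fb ff.
have ib : P.-integrable setT (EFin \o cst b) by exact: (@bounded_integrable _ _ _ P _ `|b|).
have ff' w : (f_ n w)%:E @[n --> \oo] --> (f w)%:E.
  by apply: cvg_EFin; [exact: nearW|exact: ff].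
have [i1 _ lim] := @dominated_convergence _ _ R P setT measurableT
  (fun n w => (f_ n w)%:E) (EFin \o f) (EFin \o cst b)
  (fun n => (measurable_EFinP _ _).2 (mf_ n)) ((measurable_EFinP _ _).2 mf)
  (aeW _ (fun w _ => ff' w)) ib
  (aeW _ (fun w n _ => fb n w)).
apply: fine_cvg; rewrite fineK; last exact: integrable_fin_num.
exact: lim.
Qed.

(** * The martingale property of the compensated price *)

Section price_process.
Context {d : measure_display} {Omega : measurableType d} {R : realType}.
Variables (P : probability Omega R) (Fil : R -> set (set Omega)) (B : R -> Omega -> R).
Hypothesis filF : is_filtration Fil.
Hypothesis bmB : brownian_motion P Fil B.

(* The paths of [M] extended by a constant to negative times. *)
Definition mpath (w : Omega) (t : R) : R := expR (B (Num.max t 0) w - Num.max t 0 / 2).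

Lemma mpath_gt0 w t : 0 < mpath w t.
Proof. exact: expR_gt0. Qed.

Lemma mpath_continuous w : continuous (mpath w).
Proof.
have cm : continuous (fun t : R => Num.max t 0).
  by move=> t; exact: (continuous_max cvg_id (cvg_cst _)).
have cB : continuous ((B ^~ w) \o (fun t : R => Num.max t 0)).
  apply: (@continuous_comp_within _ `[0, +oo[) => // [|x].
    by case: bmB => _ _ h _ _; exact: h.
  by rewrite /= in_itv/= andbT le_max lexx orbT.
rewrite (_ : mpath w = expR \o (fun t => B (Num.max t 0) w - Num.max t 0 / 2))//.
move=> t; apply: continuous_comp; last exact: continuous_expR.
by apply: cvgB; [exact: cB|apply: cvgM; [exact: cm|exact: cvg_cst]].
Qed.

Lemma mpathE w t : 0 <= t -> mpath w t = Mproc B t w.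
Proof. by move=> t0; rewrite /mpath max_l. Qed.

Lemma mpath_adapted t : 0 <= t -> sub_measurable (Fil t) (mpath ^~ t).
Proof.
move=> t0; rewrite (_ : mpath ^~ t = (fun x => expR (x - t / 2)) \o B t).
  apply: sub_measurable_comp; last by case: bmB => h _ _ _ _; exact: h.
  by apply: measurableT_comp => //; exact: measurable_funB.
by apply/funext => w; rewrite mpathE.
Qed.

Lemma mpath_incr w s t : 0 <= s -> s <= t ->
  mpath w t = mpath w s * expR (B t w - B s w - (t - s) / 2).
Proof.
move=> s0 st; rewrite !mpathE// ?(le_trans s0)// /Mproc -expRD.
by congr expR; field.
Qed.

Section truncation.
Variables (lam F : R) (c : cumulative R R) (n : nat).
Hypothesis lam0 : 0 <= lam.
Hypothesis cc : continuous (c : R -> R).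
Hypothesis c0 : forall t, c t <= 0.
Hypothesis cF : forall t, - c t <= F.

Local Notation K := (n%:R + 1 : R).
Local Notation tau := (hitting mpath n%:R).

(* Truncating one unit above the stopping level leaves room for [clamp_taylor]. *)
Definition tpath w t : R := Num.min (mpath w t) K.

Definition tmpart w t : R := mpart lam c (tpath w) t.

Lemma tpath_continuous w : continuous (tpath w).
Proof. by move=> t; exact: (continuous_min (@mpath_continuous w t) (cvg_cst _)). Qed.

Lemma tpath_ge0 w t : 0 <= tpath w t.
Proof. by rewrite /tpath le_min ltW ?mpath_gt0//= addr_ge0. Qed.

Lemma tpath_le w t : tpath w t <= K.
Proof. by rewrite /tpath ge_min lexx orbT. Qed.

Lemma tpath_adapted t : 0 <= t -> sub_measurable (Fil t) (tpath ^~ t).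
Proof.
move=> t0; apply: (@sub_measurable_comp _ _ _ _ (mpath ^~ t) (fun x => Num.min x K)).
  by apply: measurable_minr => //.
exact: mpath_adapted.
Qed.

Lemma tmpart_continuous w : continuous (tmpart w).
Proof.
apply: mpart_continuous => //; [exact: tpath_continuous|exact: tpath_ge0].
Qed.

Lemma tmpart_adapted t : 0 <= t -> sub_measurable (Fil t) (tmpart ^~ t).
Proof.
apply: sub_measurable_mpart => //; [exact: tpath_continuous|exact: tpath_ge0|].
exact: tpath_adapted.
Qed.

Definition stoptime w t := fine (mine t%:E (tau w)).

Lemma stoptime0 w : stoptime w 0 = 0.
Proof. by rewrite /stoptime min_l ?hitting_ge0. Qed.

Lemma stoptime_ge0 w t : 0 <= t -> 0 <= stoptime w t.
Proof. by move=> t0; rewrite fine_ge0// le_min lee_fin t0 hitting_ge0. Qed.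

Lemma stoptime_le w t : 0 <= t -> stoptime w t <= t.
Proof.
move=> t0; rewrite /stoptime -lee_fin fineK ?ge_min ?lexx//.
rewrite ge0_fin_numE; first by rewrite gt_min ltry.
by rewrite le_min lee_fin t0 hitting_ge0.
Qed.

Lemma stopped_mpart w t : 0 <= t ->
  stopped (fun t w => mpart lam c (mpath w) t - mpart lam c (mpath w) 0) tau t w =
  tmpart w (stoptime w t) - tmpart w 0.
Proof.
move=> t0; rewrite /stopped -/(stoptime w t).
(* If the path is stopped at once, its initial value may exceed the truncation level and differ from
   the truncated one; both increments from time 0 are then zero. This is why initial values are
   subtracted. *)
have [r0|rn0] := eqVneq (stoptime w t) 0; first by rewrite r0 [LHS]subrr [RHS]subrr.
have r0 : 0 < stoptime w t by rewrite lt0r rn0 stoptime_ge0.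
have E s : 0 <= s <= stoptime w t -> mpath w s = tpath w s.
  move=> sI; rewrite /tpath min_l// (@le_trans _ _ n%:R) ?lerDl//.
  by apply: (before_hitting_le mpath_continuous t0 r0 sI).
by rewrite /tmpart -!(eq_mpart _ _ E)// ?lexx ltW.
Qed.

Lemma before_tau_measurable x : 0 <= x -> Fil x [set w | (x%:E < tau w)%E].
Proof.
move=> x0; have [_ h] := hitting_stopping filF mpath_continuous mpath_adapted n%:R.
have [_ hC _] := filtration_sigma filF x0.
rewrite (_ : mkset _ = setT `\` [set w | (tau w <= x%:E)%E]); first exact: hC (h x x0).
by apply/seteqP; split=> w /=; rewrite ltNge; [move/negP|move=> [_ /negP]].
Qed.

Lemma stopped_sum_adapted s t N : 0 <= s -> s <= t ->
  sub_measurable (Fil t) (fun w => stopped_sum (tmpart w) (tau w) s t N).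
Proof.
move=> s0 st; have t0 := le_trans s0 st; have sF := filtration_sigma filF t0.
apply: sub_measurable_sum => // i.
have /andP[si it] := grid_itv st (ltnW (ltn_ord i)).
have /andP[si' it'] := grid_itv st (ltn_ord i).
set x := grid s t N i in si it *; set y := grid s t N i.+1 in si' it' *.
have x0 := le_trans s0 si; have y0 := le_trans s0 si'.
rewrite (_ : (fun w => _) = (fun w => \1_[set w | (x%:E < tau w)%E] w *
    (tmpart w y - tmpart w x))); last first.
  apply/funext => w; rewrite indicE; case: ifPn => h.
    by rewrite mem_set// mul1r.
  by rewrite memNset ?mul0r//; exact/negP.
apply: sub_measurable_mul => //.
  apply: sub_measurable_indic => //.
  by case: filF => _ _ h; apply: (h _ _ x0 it); exact: before_tau_measurable.
apply: sub_measurable_sub => //.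
  exact: (sub_measurable_mono filF y0 it' (tmpart_adapted y0)).
exact: (sub_measurable_mono filF x0 it (tmpart_adapted x0)).
Qed.

(** On the event [x < tau] the path at [x] is below [n], one unit under the truncation level: there
    it equals its truncation, as [one_step_le] requires. *)
Lemma tmart_incr_le s t x (A : set Omega) : 0 <= s -> s <= x -> x < t ->
  t - x <= 1 / 12 -> Fil s A ->
  `|\int[P]_w (\1_(A `&` [set w | (x%:E < tau w)%E]) w * mart_incr lam c (tpath w) x t)|
  <= one_step_cst K (lam + F) * ((t - x) * Num.sqrt (t - x)).
Proof.
move=> s0 sx xt h12 FA; have x0 := le_trans s0 sx; have t0 := le_trans x0 (ltW xt).
have sF := filtration_sigma filF x0.
have GM : Fil x `<=` measurable by case: filF => _ h _; exact: h.
have GMt : Fil t `<=` measurable by case: filF => _ h _; exact: h.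
case: bmB => Bad _ _ Bind Blaw.
have mD : measurable_fun setT (fun w => B t w - B x w).
  have mBt := sub_measurable_fun GMt (Bad _ t0).
  have mBx := sub_measurable_fun GM (Bad _ x0).
  exact: measurable_funB mBt mBx.
apply: (@one_step_le _ _ _ P (Fil x) (fun w => B t w - B x w) (t - x) GM mD
  (Bind _ _ x0 xt) _ h12 (Blaw _ _ x0 xt) (tpath ^~ x) (tpath ^~ t)
  (fun w => expo lam c (tpath w) x)) => //.
- by rewrite subr_gt0.
- have mm : forall A, Fil x A <-> @measurable _ (g_sigma_algebraType (Fil x)) A.
    by move=> ?; rewrite /measurable/= (sigma_algebra_id sF).
  apply/mm/measurableI; apply/mm; last exact: before_tau_measurable.
  by case: filF => _ _ h; exact: (h _ _ s0 sx).
- exact: tpath_adapted.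
- apply: sub_measurable_expo => //; [exact: tpath_continuous|exact: tpath_ge0|].
  exact: tpath_adapted.
- by have := sub_measurable_fun GMt (tpath_adapted t0).
- by move=> w; rewrite tpath_ge0 tpath_le.
- by move=> w; rewrite tpath_ge0 tpath_le.
- by move=> w; apply: norm_expo_le => //; exact: tpath_ge0.
- move=> w [_ /= /(hitting_gtP mpath_continuous _ _ x0) /(_ x)].
  rewrite x0 lexx => /(_ isT) Mx; rewrite addrK /tpath.
  by rewrite ge_min (ltW Mx).
- move=> w [_ /= /(hitting_gtP mpath_continuous _ _ x0) /(_ x)].
  rewrite x0 lexx => /(_ isT) Mx; rewrite /tpath.
  rewrite (mpath_incr w x0 (ltW xt)) (min_l (x := mpath w x))//.
  by rewrite (le_trans (ltW Mx))// lerDl.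
Qed.

(** Evaluation at a random time is measurable as a pointwise limit of adapted sums, which takes the
    place of progressive measurability. *)
Lemma tmpart_incr_adapted s t : 0 <= s -> s <= t ->
  sub_measurable (Fil t) (fun w => tmpart w (stoptime w t) - tmpart w (stoptime w s)).
Proof.
move=> s0 st; apply: (sub_measurable_cvg (filtration_sigma filF (le_trans s0 st))
  (fun N => stopped_sum_adapted N s0 st)).
by move=> w; apply: stopped_sum_cvg => //; exact: tmpart_continuous.
Qed.

Definition tmpart_cst (T : R) : R :=
  expR (K * (lam + F)) + (drift_dt_cst lam K F * T + drift_dc_cst lam K F * F).

Lemma norm_tmpart_le T w x : 0 <= x <= T -> `|tmpart w x| <= tmpart_cst T.
Proof.
move=> xI; apply: (norm_mpart_le lam0 cc c0 (@tpath_continuous w) (tpath_ge0 w)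
  (tpath_le w) cF xI).
Qed.

Lemma tmpart_stop_le w t : 0 <= t -> `|tmpart w (stoptime w t)| <= tmpart_cst t.
Proof. by move=> t0; apply: norm_tmpart_le; rewrite stoptime_ge0// stoptime_le. Qed.

Lemma mart_incr_measurable x y : 0 <= x -> x <= y ->
  sub_measurable (Fil y) (fun w => mart_incr lam c (tpath w) x y).
Proof.
move=> x0 xy; have y0 := le_trans x0 xy; have sF := filtration_sigma filF y0.
have Ge : sub_measurable (Fil y) (fun w => expo lam c (tpath w) x).
  apply: (sub_measurable_mono filF x0 xy); apply: sub_measurable_expo => //.
  - exact: tpath_continuous.
  - exact: tpath_ge0.
  - exact: tpath_adapted.
have Gp : sub_measurable (Fil y) (fun w => price lam c (tpath w) x).
  apply: (sub_measurable_mono filF x0 xy); apply: sub_measurable_price => //.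
  - exact: tpath_continuous.
  - exact: tpath_ge0.
  - exact: tpath_adapted.
have Gx := sub_measurable_mono filF x0 xy (tpath_adapted x0).
apply: sub_measurable_sub => //.
  apply: sub_measurable_sub => //; apply: sub_measurable_expR.
  by apply: sub_measurable_mul => //; exact: tpath_adapted.
apply: sub_measurable_mul => //; first exact: sub_measurable_cst.
apply: sub_measurable_mul => //.
by apply: sub_measurable_mul => //;
  apply: (@sub_measurable_comp _ _ _ _ _ (fun x => x ^+ 2)).
Qed.

Lemma pathwise_err_measurable x y : 0 <= x -> x <= y ->
  sub_measurable (Fil y) (fun w => pathwise_err lam c (tpath w) x y).
Proof.
move=> x0 xy; have y0 := le_trans x0 xy; have sF := filtration_sigma filF y0.
apply: sub_measurable_sub => //; last exact: mart_incr_measurable.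
apply: sub_measurable_sub => //; first exact: tmpart_adapted.
exact: (sub_measurable_mono filF x0 xy (tmpart_adapted x0)).
Qed.

Lemma fil_measurable_fun t (f : Omega -> R) : 0 <= t -> sub_measurable (Fil t) f ->
  measurable_fun setT f.
Proof. by move=> t0; apply: sub_measurable_fun; case: filF => _ h _; exact: h. Qed.

Section vanishing_mean.
Variables (s t : R) (A : set Omega).
Hypothesis s0 : 0 <= s.
Hypothesis st : s < t.
Hypothesis FA : Fil s A.

Definition err_sum N w : R :=
  \sum_(i < N.+1) `|pathwise_err lam c (tpath w) (grid s t N i) (grid s t N i.+1)|.

Lemma err_sum_measurable N : measurable_fun setT (err_sum N).
Proof.
have t0 := le_trans s0 (ltW st); have sF := filtration_sigma filF t0.
apply: (fil_measurable_fun t0); apply: sub_measurable_sum => // i.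
have /andP[si _] := grid_itv (ltW st) (ltnW (ltn_ord i)).
have /andP[si' it'] := grid_itv (ltW st) (ltn_ord i).
apply: (@sub_measurable_comp _ _ _ _ _ Num.norm) => //.
apply: (sub_measurable_mono filF (le_trans s0 si') it').
apply: pathwise_err_measurable; first exact: le_trans si.
by apply: grid_le => //; exact: ltW.
Qed.

(** The bounds for the steps telescope along [t + c t], so the result depends neither on [N] nor on
    the outcome. *)
Lemma err_sum_le N w : 0 <= err_sum N w <=
  path_cst lam K F * ((t - s) + (c t - c s)).
Proof.
rewrite sumr_ge0//=.
apply: (@le_trans _ _ (\sum_(0 <= i < N.+1) path_cst lam K F *
  (((grid s t N i.+1) + c (grid s t N i.+1)) - (grid s t N i + c (grid s t N i))))).
  rewrite big_mkord; apply: ler_sum => i _.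
  have /andP[si _] := grid_itv (ltW st) (ltnW (ltn_ord i)).
  rewrite opprD addrACA.
  apply: (norm_pathwise_err_le lam0 cc c0 (@tpath_continuous w) (tpath_ge0 w)
    (tpath_le w) cF); first exact: le_trans si.
  by apply: grid_le => //; exact: ltW.
rewrite -mulr_sumr (telescope_sumr (fun i => grid s t N i + c (grid s t N i)))//.
by rewrite gridn grid0 opprD addrACA.
Qed.

Lemma err_sum_cvg0 : \int[P]_w err_sum N w @[N --> \oo] --> (0 : R).
Proof.
rewrite -(Rintegral_prob_cst P 0).
apply: (bounded_convergence (b := path_cst lam K F * ((t - s) + (c t - c s)))) => //.
- exact: err_sum_measurable.
- by move=> N w; have /andP[e0 e1] := err_sum_le N w; rewrite ger0_norm.
move=> w; apply: (smallo_sum (w := fun t => t + c t)); first exact: ltW.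
  exact: (pathwise_err_smallo lam0 cc c0 (@tpath_continuous w) (tpath_ge0 w)
    (tpath_le w) cF).
by move=> x y xy; apply: lerD => //; exact: cumulative_le.
Qed.

Let ind i N w : R := \1_(A `&` [set w | ((grid s t N i)%:E < tau w)%E]) w.

(** Each of the [N.+1] steps has length [h = (t - s) / N.+1] and contributes a mean of order
    [h * sqrt h]; together they give [(t - s) * sqrt h], which still vanishes. *)
Lemma stopped_sum_mean_le N : (t - s) / N.+1%:R <= 1 / 12 ->
  `|\int[P]_w (\1_A w * stopped_sum (tmpart w) (tau w) s t N)| <=
  \int[P]_w err_sum N w +
  one_step_cst K (lam + F) * ((t - s) * Num.sqrt ((t - s) / N.+1%:R)).
Proof.
move=> h12; have t0 := le_trans s0 (ltW st); have st' := ltW st.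
have mes N' (f : Omega -> R) (t1 : 0 <= N') := @fil_measurable_fun N' f t1.
have GM : Fil s `<=` measurable by case: filF => _ h _; exact: h.
have mA : measurable A by exact: GM.
have gx i : (i < N.+1)%N -> 0 <= grid s t N i.
  by move=> iN; have /andP[h _] := grid_itv st' (ltnW iN); exact: le_trans h.
have gy i : (i < N.+1)%N -> 0 <= grid s t N i.+1 <= t.
  by move=> iN; have /andP[h ->] := grid_itv st' iN; rewrite andbT (le_trans s0).
have gxy i : grid s t N i <= grid s t N i.+1 by apply: grid_le.
have ind01 i w : `|ind i N w| <= 1.
  by rewrite /ind indicE; case: (_ \in _); rewrite ?normr1 ?normr0.
have mind i : (i < N.+1)%N -> measurable_fun setT (ind i N).
  move=> iN; apply: measurable_indic; apply: measurableI => //.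
  have h := before_tau_measurable (gx _ iN).
  by case: filF => _ hh _; exact: (hh _ (gx _ iN) _ h).
pose m_ (i : 'I_N.+1) w := ind i N w *
  mart_incr lam c (tpath w) (grid s t N i) (grid s t N i.+1).
have im_ i : P.-integrable setT (EFin \o m_ i).
  have iN := ltn_ord i; have /andP[y0 yt] := gy _ iN.
  apply: (@bounded_integrable _ _ _ P _ (1 * ((tmpart_cst t + tmpart_cst t) +
    path_cst lam K F * ((grid s t N i.+1 - grid s t N i) +
                        (c (grid s t N i.+1) - c (grid s t N i)))))).
    apply: measurable_funM; first exact: mind.
    exact: fil_measurable_fun y0 (mart_incr_measurable (gx _ iN) (gxy _)).
  move=> w; rewrite normrM; apply: ler_pM => //.
  have -> : mart_incr lam c (tpath w) (grid s t N i) (grid s t N i.+1) =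
      (tmpart w (grid s t N i.+1) - tmpart w (grid s t N i)) -
      pathwise_err lam c (tpath w) (grid s t N i) (grid s t N i.+1).
    by rewrite /pathwise_err /tmpart; ring.
  apply: (le_trans (ler_normB _ _)); apply: lerD.
    apply: (le_trans (ler_normB _ _)); apply: lerD; apply: norm_tmpart_le.
      by rewrite y0.
    by rewrite gx//= (le_trans (gxy _)).
  exact: (norm_pathwise_err_le lam0 cc c0 (@tpath_continuous w) (tpath_ge0 w)
    (tpath_le w) cF (gx _ iN) (gxy _)).
have iS : P.-integrable setT
    (EFin \o (fun w => \1_A w * stopped_sum (tmpart w) (tau w) s t N)).
  apply: (@bounded_integrable _ _ _ P _ (1 * (tmpart_cst t + tmpart_cst t))).
    apply: measurable_funM; first exact: measurable_indic.
    exact: fil_measurable_fun t0 (stopped_sum_adapted N s0 st').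
  move=> w; rewrite normrM; apply: ler_pM => //.
    by rewrite indicE; case: (_ \in _); rewrite ?normr1 ?normr0.
  apply: norm_stopped_sum_le => // x /andP[sx xt]; apply: norm_tmpart_le.
  by rewrite (le_trans s0).
pose Q w := \1_A w * stopped_sum (tmpart w) (tau w) s t N + (-1) * \sum_i m_ i w.
have [iM EM] := Rintegral_sum (index_enum 'I_N.+1) im_.
have iQ : P.-integrable setT (EFin \o Q).
  by apply: eq_integrable (integrableD measurableT iS (integrableZl measurableT (-1) iM)).
have QE w : Q w = \sum_(i < N.+1) ind i N w *
    pathwise_err lam c (tpath w) (grid s t N i) (grid s t N i.+1).
  rewrite /Q mulN1r /stopped_sum mulr_sumr -sumrB; apply: eq_bigr => i _.
  have -> : \1_A w * (if ((grid s t N i)%:E < tau w)%E then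
       tmpart w (grid s t N i.+1) - tmpart w (grid s t N i) else 0) =
      ind i N w * (tmpart w (grid s t N i.+1) - tmpart w (grid s t N i)).
    rewrite /ind !indicE in_setI; case: ifPn => ti.
      by rewrite (_ : (w \in [set w | _]) = true) ?andbT//; exact: mem_set.
    rewrite (_ : (w \in [set w | _]) = false) ?andbF ?mulr0 ?mul0r//.
    by apply/negbTE; rewrite notin_setE /=; exact/negP.
  by rewrite /m_ -mulrBr.
have QErr w : `|Q w| <= err_sum N w.
  rewrite QE; apply: (le_trans (ler_norm_sum _ _ _)); apply: ler_sum => i _.
  by rewrite normrM ler_piMl.
have ierr : P.-integrable setT (EFin \o err_sum N).
  apply: (@bounded_integrable _ _ _ P _ (path_cst lam K F * ((t - s) + (c t - c s)))).
    exact: err_sum_measurable.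
  by move=> w; have /andP[e0 e1] := err_sum_le N w; rewrite ger0_norm.
have -> : \int[P]_w (\1_A w * stopped_sum (tmpart w) (tau w) s t N) =
    \int[P]_w Q w + \sum_i \int[P]_w m_ i w.
  rewrite -EM (RintegralD measurableT iS (integrableZl measurableT (-1) iM)).
  by rewrite (RintegralZl (-1) measurableT iM) mulN1r subrK.
apply: (le_trans (ler_normD _ _)); apply: lerD; first exact: norm_expectation_le.
apply: (le_trans (ler_norm_sum _ _ _)).
apply: (@le_trans _ _ (\sum_(i < N.+1) one_step_cst K (lam + F) *
  ((t - s) / N.+1%:R * Num.sqrt ((t - s) / N.+1%:R)))).
  apply: ler_sum => i _; rewrite -(gridS s t N i); apply: tmart_incr_le s0 _ _ _ FA.
  - by have /andP[] := grid_itv st' (ltnW (ltn_ord i)).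
  - by rewrite -subr_gt0 gridS divr_gt0// subr_gt0.
  - by rewrite gridS.
rewrite sumr_const card_ord -mulr_natr le_eqVlt; apply/orP; left; apply/eqP.
by field; rewrite ?nat1r pnatr_eq0.
Qed.

(** The integral does not involve the grid: by bounded convergence it is the limit of the means of
    the stopped sums, and these tend to 0. *)
Lemma stopped_incr_mean0 :
  \int[P]_w (\1_A w * (tmpart w (stoptime w t) - tmpart w (stoptime w s))) = 0.
Proof.
have t0 := le_trans s0 (ltW st); have st' := ltW st.
have GM : Fil s `<=` measurable by case: filF => _ h _; exact: h.
have mA : measurable A by exact: GM.
have lim : \int[P]_w (\1_A w * stopped_sum (tmpart w) (tau w) s t N) @[N --> \oo] -->
    \int[P]_w (\1_A w * (tmpart w (stoptime w t) - tmpart w (stoptime w s))).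
  apply: (bounded_convergence (b := 1 * (tmpart_cst t + tmpart_cst t))).
  - move=> N; apply: measurable_funM; first exact: measurable_indic.
    exact: fil_measurable_fun t0 (stopped_sum_adapted N s0 st').
  - apply: measurable_funM; first exact: measurable_indic.
    exact: fil_measurable_fun t0 (tmpart_incr_adapted s0 st').
  - move=> N w; rewrite normrM; apply: ler_pM => //.
      by rewrite indicE; case: (_ \in _); rewrite ?normr1 ?normr0.
    apply: norm_stopped_sum_le => // x /andP[sx xt]; apply: norm_tmpart_le.
    by rewrite (le_trans s0).
  - move=> w; apply: cvgM; first exact: cvg_cst.
    by apply: stopped_sum_cvg => //; exact: tmpart_continuous.
have mesh0 : (t - s) / N.+1%:R @[N --> \oo] --> (0 : R).
  rewrite -[X in _ --> X](mulr0 (t - s)); apply: cvgMr; exact: cvg_harmonic.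
have lim0 : \int[P]_w err_sum N w +
    one_step_cst K (lam + F) * ((t - s) * Num.sqrt ((t - s) / N.+1%:R))
    @[N --> \oo] --> (0 : R).
  rewrite -[X in _ --> X](addr0 0); apply: cvgD; first exact: err_sum_cvg0.
  rewrite -[X in _ --> X](mulr0 (one_step_cst K (lam + F))); apply: cvgMr.
  rewrite -[X in _ --> X](mulr0 (t - s)); apply: cvgMr.
  rewrite -[X in _ --> X](@sqrtr0 R).
  by apply: cvg_comp mesh0 _; exact: sqrt_continuous.
have : \int[P]_w (\1_A w * stopped_sum (tmpart w) (tau w) s t N) @[N --> \oo] --> (0 : R).
  apply/norm_cvg0P; apply: (@squeeze_cvgr _ _ _ _ (cst 0)) lim0.
  - near=> N; rewrite normr_ge0/=; apply: stopped_sum_mean_le.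
    apply: ltW; near: N; apply: grid_mesh; exact: divr_gt0.
  - exact: cvg_cst.
by move=> lim'; exact: (cvg_unique _ lim lim').
Unshelve. all: by end_near. Qed.

End vanishing_mean.

End truncation.
End price_process.

(** * Stability of martingales and local martingales *)

Section local_martingales.
Context {d : measure_display} {Omega : measurableType d} {R : realType}.
Variables (P : probability Omega R) (Fil : R -> set (set Omega)).
Hypothesis filF : is_filtration Fil.

Lemma fil_subset t : 0 <= t -> Fil t `<=` measurable.
Proof. by move=> t0; case: filF => _ h _; exact: h. Qed.

Lemma integral_indicM (A : set Omega) (f : Omega -> R) : measurable A ->
  P.-integrable setT (EFin \o f) ->
  (\int[P]_(w in A) (f w)%:E = (\int[P]_w (\1_A w * f w))%:E)%E.
Proof.
move=> mA intf.
have iA : P.-integrable A (EFin \o f) by exact: integrableS intf.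
rewrite -[LHS]fineK; last exact: integrable_fin_num.
congr EFin; rewrite -/(Rintegral P A f) Rintegral_mkcond; apply: eq_Rintegral => w _.
rewrite patchE indicE; case: ifPn; rewrite ?mul1r ?mul0r//.
Qed.

Lemma eq_cadlag T (f g : R -> R) : (forall t, 0 <= t <= T -> f t = g t) ->
  cadlag T f -> cadlag T g.
Proof.
move=> fg [fr fl]; split=> t.
  move=> /andP[t0 tT]; rewrite -fg ?t0 ?ltW//.
  apply: cvg_trans (fr _ _); last by rewrite t0.
  apply: near_eq_cvg; near=> x; apply: fg.
  have tx : t < x by near: x; exact: nbhs_right_gt.
  rewrite (le_trans t0 (ltW tx))/= ltW//; near: x; exact: nbhs_right_lt.
move=> /andP[t0 tT].
have /cvg_ex[l fll] : cvg (f x @[x --> t^'-]) by apply: fl; rewrite t0.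
apply/cvg_ex; exists l; apply: cvg_trans fll.
apply: near_eq_cvg; near=> x; apply: fg.
have tx : x < t by near: x; exact: nbhs_left_lt.
rewrite (le_trans (ltW tx) tT) andbT ltW//; near: x; exact: nbhs_left_gt.
Unshelve. all: by end_near. Qed.

Lemma continuous_cadlag T (f : R -> R) : continuous f -> cadlag T f.
Proof.
move=> cf; split=> t _.
  by apply: cvg_within_filter; exact: cf.
by apply/cvg_ex; exists (f t); apply: cvg_within_filter; exact: cf.
Qed.

Lemma cadlagD T (f g : R -> R) : cadlag T f -> cadlag T g ->
  cadlag T (fun t => f t + g t).
Proof.
move=> [fr fl] [gr gl]; split=> t tI; first by apply: cvgD; [exact: fr|exact: gr].
by apply: is_cvgD; [exact: fl|exact: gl].
Qed.

Lemma stopped_time_itv T (tau : \bar R) t : (0 <= tau)%E -> 0 <= t <= T ->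
  0 <= fine (mine t%:E tau) <= T.
Proof.
move=> tau0 /andP[t0 tT].
have m0 : (0 <= mine t%:E tau)%E by rewrite le_min lee_fin t0.
rewrite fine_ge0//= -lee_fin fineK; first by rewrite ge_min lee_fin tT.
by rewrite ge0_fin_numE// gt_min ltry.
Qed.

Lemma eq_martingale T (X Y : R -> Omega -> R) :
  (forall t w, 0 <= t <= T -> X t w = Y t w) ->
  martingale P Fil T X -> martingale P Fil T Y.
Proof.
move=> XY [aX iX cX].
have E t : 0 <= t <= T -> X t = Y t by move=> tI; apply/funext => w; exact: XY.
split=> [t tI|t tI|s t s0 st tT]; first by rewrite -E//; exact: aX.
  by rewrite -E//; exact: iX.
by rewrite -!E ?s0 ?(le_trans s0)// ?(le_trans st)//; exact: cX.
Qed.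

(** The bond formula agrees with the path functional on [[0, T]] only; stopped times stay in this
    interval, so values beyond it are never seen. *)
Lemma eq_local_martingale T (X Y : R -> Omega -> R) :
  (forall t w, 0 <= t <= T -> X t w = Y t w) ->
  local_martingale P Fil T X -> local_martingale P Fil T Y.
Proof.
move=> XY [aX cX [tau [st nd cv mt]]]; split.
- move=> t tI; rewrite (_ : Y t = X t); first exact: aX.
  by apply/funext => w; rewrite XY.
- by move=> w; apply: eq_cadlag (cX w) => t tI; exact: XY.
exists tau; split=> // n; apply: eq_martingale (mt n) => t w tI.
by rewrite /stopped XY// stopped_time_itv//; case: (st n).
Qed.

Lemma martingale_add_initial T (Y : Omega -> R) (X : R -> Omega -> R) :
  sub_measurable (Fil 0) Y -> P.-integrable setT (EFin \o Y) ->
  martingale P Fil T X -> martingale P Fil T (fun t w => Y w + X t w).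
Proof.
move=> GY iY [aX iX cX].
have GYt t : 0 <= t -> sub_measurable (Fil t) Y.
  by move=> t0; exact: sub_measurable_mono GY.
have i2 t : 0 <= t <= T -> P.-integrable setT (EFin \o (fun w => Y w + X t w)).
  by move=> tI; apply: eq_integrable (integrableD measurableT iY (iX _ tI)).
have a2 : adapted Fil T (fun t w => Y w + X t w).
  move=> t /[dup] tI /andP[t0 tT].
  exact (sub_measurable_add (filtration_sigma filF t0) (GYt t t0) (aX t tI)).
split => // s t s0 st tT.
have sI : 0 <= s <= T by rewrite s0 (le_trans st).
have tI : 0 <= t <= T by rewrite (le_trans s0).
split; [exact: a2|exact: i2|move=> A FA].
have mA : measurable A by exact: (fil_subset s0).
have [_ _ /(_ A FA) e] := cX _ _ s0 st tT.
have iA (f : Omega -> R) : P.-integrable setT (EFin \o f) -> P.-integrable A (EFin \o f).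
  by move=> h; exact: integrableS h.
have D (f : Omega -> R) : P.-integrable setT (EFin \o f) ->
   (\int[P]_(w in A) (Y w + f w)%:E =
    \int[P]_(w in A) (Y w)%:E + \int[P]_(w in A) (f w)%:E)%E.
  move=> h; rewrite -(integralD_EFin mA (iA _ iY) (iA _ h)).
  by apply: eq_integral => w _.
by rewrite (D _ (iX _ sI)) (D _ (iX _ tI)) e.
Qed.

(** This restores the initial value that was removed before localization. It has to be integrable,
    because stopping, even at time 0, leaves it untouched. *)
Lemma local_martingale_add_initial T (Y : Omega -> R) (X : R -> Omega -> R) :
  sub_measurable (Fil 0) Y -> P.-integrable setT (EFin \o Y) ->
  local_martingale P Fil T X -> local_martingale P Fil T (fun t w => Y w + X t w).
Proof.
move=> GY iY [aX cX [tau [st nd cv mt]]]; split.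
- move=> t /[dup] tI /andP[t0 tT].
  have GYt := sub_measurable_mono filF (lexx 0) t0 GY.
  exact (sub_measurable_add (filtration_sigma filF t0) GYt (aX t tI)).
- move=> w; apply: cadlagD => //; apply: continuous_cadlag => x; exact: cvg_cst.
by exists tau; split=> // n; exact: martingale_add_initial (mt n).
Qed.

End local_martingales.

(** * Localization of the compensated price *)

Section price_martingale.
Context {d : measure_display} {Omega : measurableType d} {R : realType}.
Variables (P : probability Omega R) (Fil : R -> set (set Omega)) (B : R -> Omega -> R).
Hypothesis filF : is_filtration Fil.
Hypothesis bmB : brownian_motion P Fil B.
Variables (lam F : R) (c : cumulative R R).
Hypothesis lam0 : 0 <= lam.
Hypothesis cc : continuous (c : R -> R).
Hypothesis c0 : forall t, c t <= 0.
Hypothesis cF : forall t, - c t <= F.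

Local Notation M := (mpath B).

Lemma stopped_mpart_martingale T n : martingale P Fil T
  (stopped (fun t w => mpart lam c (M w) t - mpart lam c (M w) 0) (hitting M n%:R)).
Proof.
pose X t w := tmpart B lam c n w (stoptime B n w t) - tmpart B lam c n w 0.
apply: (@eq_martingale _ _ _ P Fil T X).
  by move=> t w /andP[t0 _]; rewrite (stopped_mpart bmB)//.
have aX t : 0 <= t -> sub_measurable (Fil t) (X t).
  move=> t0; have := tmpart_incr_adapted filF bmB n lam0 cc c0 (lexx 0) t0.
  by congr sub_measurable; apply/funext => w; rewrite stoptime0.
have iX t : 0 <= t -> P.-integrable setT (EFin \o X t).
  move=> t0.
  apply: (@bounded_integrable _ _ _ P _ (tmpart_cst lam F n t + tmpart_cst lam F n t)).
    exact (fil_measurable_fun filF t0 (aX t t0)).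
  move=> w; apply: (le_trans (ler_normB _ _)); apply: lerD.
    exact: (tmpart_stop_le bmB n lam0 cc c0 cF).
  by apply: (norm_tmpart_le bmB n lam0 cc c0 cF); rewrite lexx.
have mX s t A : 0 <= s -> s < t -> Fil s A ->
    \int[P]_w (\1_A w * (X t w - X s w)) = 0.
  move=> s0 st FA; rewrite -[RHS](stopped_incr_mean0 filF bmB n lam0 cc c0 cF s0 st FA).
  apply: eq_Rintegral => w _; rewrite /X.
  move: (tmpart _ _ _ _ w (stoptime _ _ w t)) (tmpart _ _ _ _ w (stoptime _ _ w s)) => x y.
  by move: (tmpart _ _ _ _ w 0) => z; congr (_ * _); ring.
clearbody X.
split=> [t /andP[t0 _]|t /andP[t0 _]|s t s0]; [exact: aX|exact: iX|].
rewrite le_eqVlt => /predU1P[<- sT|st tT].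
  by split; [exact: aX|exact: iX|].
have t0 := le_trans s0 (ltW st).
split; [exact: aX|exact: iX|move=> A FA].
have mA : measurable A by exact: (fil_subset filF s0).
rewrite (integral_indicM mA (iX _ s0)) (integral_indicM mA (iX _ t0)); congr EFin.
apply/esym/eqP; rewrite -subr_eq0; apply/eqP.
have i1A t1 : 0 <= t1 -> P.-integrable setT (EFin \o (fun w => \1_A w * X t1 w)).
  move=> t10; apply: (@integrable_dominated _ _ _ P _ (fun w => `|X t1 w|)).
  - apply: measurable_funM; first exact: measurable_indic.
    exact (fil_measurable_fun filF t10 (aX t1 t10)).
  - by apply: eq_integrable (integrable_abse (iX _ t10)).
  - by move=> w; rewrite normrM ler_piMl// indicE; case: (_ \in _); rewrite ?normr1 ?normr0.
rewrite -(RintegralB measurableT (i1A _ t0) (i1A _ s0)).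
rewrite -[RHS](mX s t A s0 st FA).
by apply: eq_Rintegral => w _; rewrite mulrBr.
Qed.

Lemma mpart_local_martingale T : local_martingale P Fil T
  (fun t w => mpart lam c (M w) t - mpart lam c (M w) 0).
Proof.
have M0 w t : 0 <= M w t by exact: ltW (mpath_gt0 _ _ _).
have Mc w : continuous (M w) by exact: mpath_continuous bmB w.
have Mad t : 0 <= t -> sub_measurable (Fil t) (M ^~ t) by exact: mpath_adapted bmB t.
split.
- move=> t /andP[t0 _].
  have h r : 0 <= r -> sub_measurable (Fil r) (fun w => mpart lam c (M w) r).
    by move=> r0; exact: sub_measurable_mpart.
  exact (sub_measurable_sub (filtration_sigma filF t0) (h t t0)
    (sub_measurable_mono filF (lexx 0) t0 (h 0 (lexx 0)))).
- move=> w; apply: continuous_cadlag => t; apply: cvgB; last exact: cvg_cst.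
  exact: mpart_continuous.
exists (fun n => hitting M n%:R); split.
- by move=> n; exact: hitting_stopping.
- by move=> n w; apply: hitting_nd; rewrite ler_nat.
- by apply: aeW => w; exact: hitting_cvg.
- by move=> n; exact: stopped_mpart_martingale.
Qed.

End price_martingale.

Section stieltjes_variation.
Context {R : realType}.

(** The integrand may change sign, but a multiple of [c] that dominates it makes the integral
    nondecreasing: this writes it as a difference of two nondecreasing functions. *)
Lemma stieltjes_bounded_variation (c : cumulative R R) (k : R -> R) T : 0 < T ->
  continuous k -> bounded_variation 0 T (stieltjes c k 0).
Proof.
move=> T0 ck.
have /compact_bounded[K [_ mrt]] := continuous_compact (continuous_subspaceT ck)
   (@segment_compact R 0 T).
have kK s : 0 <= s <= T -> `|k s| <= `|K| + 1.
  move=> sI; apply: mrt; first by rewrite ltr_pwDr// ler_norm.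
  by exists s => //=; rewrite in_itv.
have K0 : 0 <= `|K| + 1 by rewrite addr_ge0.
pose g t := (`|K| + 1) * c t.
have gnd : {in `[0, T] &, {homo g : x y / x <= y}}.
  by move=> x y _ _ xy; rewrite /g ler_wpM2l// cumulative_le.
have -> : stieltjes c k 0 = (stieltjes c k 0 \+ g) \+ (\- g).
  by apply/funext => t /=; rewrite addrK.
apply: bounded_variationD => //; last first.
  by apply: bounded_variationN; exact: nondecreasing_bounded_variation.
apply: nondecreasing_bounded_variation => x y; rewrite !in_itv/=.
move=> /andP[x0 xT] /andP[y0 yT] xy.
have : `|stieltjes c k x y| <= (`|K| + 1) * (c y - c x).
  apply: stieltjes_le => // s /andP[xs sy]; apply: kK.
  by rewrite (le_trans x0 (ltW xs)) (le_trans sy).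
rewrite (stieltjesD c ck x0 xy) ler_norml mulrBr /g => /andP[h _].
move: h; move: (stieltjes c k 0 x) (stieltjes c k x y) => u v h.
by lra.
Qed.

End stieltjes_variation.

(** * Bond prices *)

Section bond_prices.
Context {d : measure_display} {Omega : measurableType d} {R : realType}.
Variables (P : probability Omega R) (Fil : R -> set (set Omega)) (B : R -> Omega -> R).
Variables (Th : R) (P0 : R -> R).
Hypothesis filF : is_filtration Fil.
Hypothesis bmB : brownian_motion P Fil B.
Hypothesis Th_gt0 : 0 < Th.
Hypothesis curveP0 : initial_bond_curve Th P0.

Local Notation f := (forward_curve Th P0).

Lemma P0_gt0 t : 0 <= t <= Th -> 0 < P0 t.
Proof. by case: curveP0 => h _ _ _; exact: h. Qed.

Lemma ratio_ge1 t : 0 <= t <= Th -> 1 <= P0 t / P0 Th.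
Proof.
move=> tI; have Th0 : 0 < P0 Th by apply: P0_gt0; rewrite ltW//=.
rewrite ler_pdivlMr// mul1r; case: curveP0 => _ _ h _; case/andP: (tI) => t0 tT.
by apply: h => //; rewrite in_itv/= ?t0// lexx ltW.
Qed.

Lemma ratio_gt0 t : 0 <= t <= Th -> 0 < P0 t / P0 Th.
Proof. by move=> /ratio_ge1; apply: lt_le_trans. Qed.

Lemma forward_ge0 t : 0 <= t <= Th -> 0 <= f t.
Proof. by move=> tI; rewrite ln_ge0// ratio_ge1. Qed.

Lemma forward_Th : f Th = 0.
Proof.
by rewrite /forward_curve divff ?ln1// gt_eqF// P0_gt0// lexx ltW.
Qed.

Lemma forward_le s t : 0 <= s -> s <= t -> t <= Th -> f t <= f s.
Proof.
move=> s0 st tT.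
have sI : 0 <= s <= Th by rewrite s0 (le_trans st).
have tI : 0 <= t <= Th by rewrite (le_trans s0 st).
have Th0 : 0 < P0 Th by apply: P0_gt0; rewrite lexx ltW.
rewrite ler_ln ?posrE ?ratio_gt0// ler_pM2r ?invr_gt0//.
by case: curveP0 => _ _ h _; apply: h; rewrite ?in_itv.
Qed.

Transparent stieltjes.

(** Lebesgue measure is the Stieltjes measure of the identity, so only the endpoint 0 distinguishes
    the two integrals. *)
Lemma area_mpath w t : 0 <= t -> area (mpath B w) t = Aproc B t w.
Proof.
move=> t0; rewrite /Aproc -Rintegral_itv_obnd_cbnd.
  apply: eq_Rintegral => s; rewrite inE/= in_itv/= => /andP[s0 _].
  by rewrite mpathE// ltW.
have i := @stieltjes_integrable R idfun _ 0 t (@mpath_continuous _ _ _ P Fil B bmB w).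
by apply: eq_integrable i => // s; rewrite inE/= in_itv/= => /andP[s0 _];
  rewrite mpathE// ltW.
Qed.

Opaque stieltjes.

(** The sign turns the decreasing forward curve into a nondecreasing one, as a Stieltjes measure
    needs; clamping extends it continuously by constants outside [[0, Th]]. *)
Definition clamped_curve t : R := - f (clamp_itv Th t).

Lemma clampTh_itv t : 0 <= clamp_itv Th t <= Th.
Proof. by apply: clamp_itvP; exact: ltW. Qed.

Lemma clamped_curve_continuous : continuous clamped_curve.
Proof.
have h1 : {within `[0, Th], continuous P0} by case: curveP0.
have h2 x : `[0, Th]%classic (clamp_itv Th x) by rewrite /= in_itv/= clampTh_itv.
have cP := continuous_comp_within h1 (@clamp_itv_continuous R Th) h2.
move=> t; apply: cvgN.
apply: (@continuous_comp _ _ _ (fun t => P0 (clamp_itv Th t) / P0 Th) (@ln R)).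
  by apply: cvgM; [exact: cP|exact: cvg_cst].
by apply: continuous_ln; exact/ratio_gt0/clampTh_itv.
Qed.

Lemma clamp_itv_nd (t x y : R) : x <= y -> clamp_itv t x <= clamp_itv t y.
Proof.
move=> xy; rewrite /clamp_itv le_min !ge_min lexx orbT andbT.
by rewrite ge_max !le_max xy lexx orbT.
Qed.

Lemma clamped_curve_nd : nondecreasing clamped_curve.
Proof.
move=> x y xy; rewrite lerN2; have /andP[x0 xT] := clampTh_itv x.
by have /andP[y0 yT] := clampTh_itv y; apply: forward_le => //; exact: clamp_itv_nd.
Qed.

Definition curve_cumulative : cumulative R R := HB.pack clamped_curve
  (isCumulative.Build R _ R clamped_curve clamped_curve_nd
    (right_continuousW clamped_curve_continuous)).

Lemma curve_cumulativeE t : curve_cumulative t = - f (clamp_itv Th t).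
Proof. by []. Qed.

Lemma zero_nd : nondecreasing (cst 0 : R -> R).
Proof. by []. Qed.

Definition zero_cumulative : cumulative R R := HB.pack (cst 0 : R -> R)
  (isCumulative.Build R _ R (cst 0) zero_nd (right_continuousW (@cst_continuous R R 0))).

Lemma expo_zero lam (m : R -> R) t : expo lam zero_cumulative m t = yld (area m t) lam.
Proof. by rewrite /expo (_ : - zero_cumulative t = 0) ?yldx0 ?subr0//; exact: oppr0. Qed.

Lemma bondE T t w : 0 <= T <= Th -> 0 <= t <= Th -> bond B Th P0 T t w =
  expR (Mproc B t w * (yld (Aproc B t w) (f T) - yld (Aproc B t w) (f t))).
Proof.
move=> TI tI; rewrite /bond /long_bond /powR !gt_eqF ?ratio_gt0//.
rewrite -expRD -/(f T) -/(f t); congr expR; rewrite /yld.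
by ring.
Qed.

Lemma bond_ThE t w : 0 <= t <= Th ->
  bond B Th P0 Th t w = expR (- (Mproc B t w * yld (Aproc B t w) (f t))).
Proof.
have ThI : 0 <= Th <= Th by rewrite lexx ltW.
by move=> tI; rewrite (bondE _ ThI tI) forward_Th yldx0 sub0r mulrN.
Qed.

Lemma Aproc_ge0 t w : 0 <= Aproc B t w.
Proof. by apply: Rintegral_ge0 => s _; exact: expR_ge0. Qed.

Lemma forward_rate_gt0 :
  {in `[0, Th] &, forall S T, S < T -> f T < f S} ->
  forall T1 T2 t w, 0 <= t -> t <= T1 -> T1 < T2 -> T2 <= Th ->
  0 < forward_rate B Th P0 T1 T2 t w.
Proof.
move=> fdecr T1 T2 t w t0 tT1 T12 T2h.
have T10 := le_trans t0 tT1; have T1h := le_trans (ltW T12) T2h.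
have T1I : 0 <= T1 <= Th by rewrite T10.
have T2I : 0 <= T2 <= Th by rewrite T2h andbT (le_trans T10 (ltW T12)).
have tI : 0 <= t <= Th by rewrite t0 (le_trans tT1).
rewrite /forward_rate mulr_gt0 ?invr_gt0 ?subr_gt0// !bondE// -expRB expRK.
(* The terms in [f t], which stem from the long bond, cancel in the ratio. *)
rewrite -mulrBr mulr_gt0 ?expR_gt0// opprB addrA subrK subr_gt0.
apply: yld_lt; [exact: Aproc_ge0|exact: forward_ge0|].
by apply: fdecr => //; rewrite in_itv.
Qed.

Lemma bond_price T t w : 0 <= T <= Th -> 0 <= t <= Th ->
  bond B Th P0 T t w = price (f T) curve_cumulative (mpath B w) t.
Proof.
move=> TI tI; rewrite (bondE _ TI tI) /price /expo curve_cumulativeE opprK.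
have /andP[t0 tT] := tI.
by rewrite (clamp_itv_id tI) (area_mpath w t0) (mpathE B w t0).
Qed.

Lemma bond_ratio_price T t w : 0 <= T <= Th -> 0 <= t <= Th ->
  bond B Th P0 T t w / bond B Th P0 Th t w =
  price (f T) zero_cumulative (mpath B w) t.
Proof.
move=> TI tI; have /andP[t0 tT] := tI.
have -> : price (f T) zero_cumulative (mpath B w) t =
    expR (Mproc B t w * yld (Aproc B t w) (f T)).
  by rewrite /price expo_zero (area_mpath w t0) (mpathE B w t0).
transitivity (expR (Mproc B t w * (yld (Aproc B t w) (f T) - yld (Aproc B t w) (f t))) /
    expR (- (Mproc B t w * yld (Aproc B t w) (f t)))).
  by congr (_ / _); [exact: bondE|exact: bond_ThE].
rewrite -expRB; congr expR.
by move: (Mproc B t w) (yld _ (f T)) (yld _ (f t)) => m u v; ring.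
Qed.

Lemma bond_semimartingale T : 0 < T <= Th -> semimartingale P Fil T (bond B Th P0 T).
Proof.
move=> /andP[T0 TTh]; have TI : 0 <= T <= Th by rewrite ltW.
set c := curve_cumulative; set lam := f T.
have lam0 : 0 <= lam by exact: forward_ge0.
have cc : continuous (c : R -> R) by exact: clamped_curve_continuous.
have c0 t : c t <= 0 by rewrite oppr_le0 forward_ge0// clampTh_itv.
have cF t : - c t <= f 0.
  rewrite /c curve_cumulativeE opprK; have /andP[h1 h2] := clampTh_itv t.
  exact: forward_le.
have M0 w t : 0 <= mpath B w t by exact: ltW (mpath_gt0 _ _ _).
have Mc w : continuous (mpath B w) by exact: mpath_continuous bmB w.
have Mad t : 0 <= t -> sub_measurable (Fil t) (mpath B ^~ t) by exact: mpath_adapted bmB t.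
have bE t w : 0 <= t <= T -> bond B Th P0 T t w = price lam c (mpath B w) t.
  by move=> /andP[t0 tT]; apply: bond_price => //; rewrite t0 (le_trans tT).
split.
  move=> t /[dup] tI /andP[t0 _].
  rewrite (_ : bond B Th P0 T t = (fun w => price lam c (mpath B w) t)).
    exact: sub_measurable_price.
  by apply/funext => w; exact: bE.
exists (fun t w => mpart lam c (mpath B w) t - mpart lam c (mpath B w) 0).
exists (fun t w => fvpart lam c (mpath B w) t); split.
- split; first exact: (mpart_local_martingale filF bmB lam0 cc c0 cF).
  by move=> w; exact: subrr.
- split; last by move=> w; exact: fvpart0.
  by move=> t /andP[t0 _]; exact: sub_measurable_fvpart.
- by move=> w; apply: continuous_cadlag; exact: fvpart_continuous.
- move=> w; apply: bounded_variationD => //.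
    by apply: stieltjes_bounded_variation => //; exact: drift_dt_continuous.
  by apply: stieltjes_bounded_variation => //; exact: drift_dc_continuous.
- move=> t w tI; rewrite (bE _ _ tI) (bE 0 w); last by rewrite lexx ltW.
  rewrite /mpart (fvpart0 lam c (mpath B w)).
  move: (price _ _ _ t) (price _ _ _ 0) (fvpart _ _ _ t) => u v x.
  by ring.
Qed.

Lemma bond_ratio_local_martingale T : 0 < T <= Th -> local_martingale P Fil T
  (fun t w => bond B Th P0 T t w / bond B Th P0 Th t w).
Proof.
move=> /andP[T0 TTh]; have TI : 0 <= T <= Th by rewrite ltW.
set c := zero_cumulative; set lam := f T.
have lam0 : 0 <= lam by exact: forward_ge0.
have cc : continuous (c : R -> R) by exact: cst_continuous.
have c0 t : c t <= 0 by [].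
have cF t : - c t <= 0 by rewrite oppr0.
have M0 w t : 0 <= mpath B w t by exact: ltW (mpath_gt0 _ _ _).
have Mc w : continuous (mpath B w) by exact: mpath_continuous bmB w.
have Mad t : 0 <= t -> sub_measurable (Fil t) (mpath B ^~ t) by exact: mpath_adapted bmB t.
have fv0 t w : 0 <= t -> fvpart lam c (mpath B w) t = 0.
  move=> t0; have ck : continuous (drift_dc lam c (mpath B w)) by exact: drift_dc_continuous.
  rewrite /fvpart (stieltjes_flat ck t0 (erefl 0 : c 0 = c t)) addr0.
  rewrite (@eq_stieltjes _ _ _ (cst 0)); first by rewrite stieltjes_cst// mul0r.
  by move=> s _; rewrite /drift_dt (_ : - c s = 0) ?yldx0 ?mulr0 ?mul0r oppr0.
pose Y w := price lam c (mpath B w) 0.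
have GY : sub_measurable (Fil 0) Y by exact: sub_measurable_price.
have mY : measurable_fun setT Y by exact: (fil_measurable_fun filF (lexx 0) GY).
(* [B] vanishes at time 0 only almost surely, so the initial value is constant only up to a null
   set, on which it may be unbounded; its integrability is read off from the almost sure value, with
   [M_0 = 1] and [A_0 = 0]. *)
have YE : ae_eq P setT (EFin \o Y) (cst (expR (1 * (yld 0 lam)))%:E).
  case: bmB => _ B0 _ _ _; apply: filterS B0 => w B0w _ /=; congr EFin.
  rewrite /Y /price expo_zero /area stieltjesxx /mpath max_l//.
  by rewrite B0w mul0r subr0 expR0.
have iY : P.-integrable setT (EFin \o Y).
  apply/integrableP; split; first exact/measurable_EFinP.
  rewrite (@ae_eq_integral _ _ _ P setT (cst (expR (1 * (yld 0 lam)))%:E))//.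
  - by rewrite integral_cst// [X in (_ * X)%E]probability_setT mule1 ltry.
  - by apply: measurableT_comp => //; exact/measurable_EFinP.
  - apply: filterS YE => w h _; rewrite h//= ger0_norm// expR_ge0//.
apply: (eq_local_martingale _ (local_martingale_add_initial filF GY iY
  (mpart_local_martingale filF bmB lam0 cc c0 cF T))) => t w /andP[t0 tT].
rewrite (bond_ratio_price w TI (t := t)); last by rewrite t0 (le_trans tT).
by rewrite /mpart (fv0 t w t0) (fv0 0 w (lexx 0)) !subr0 /Y addrC subrK.
Qed.

Lemma bond_ratio_gt0 T t w : 0 <= T <= Th -> 0 <= t <= Th ->
  0 < bond B Th P0 T t w / bond B Th P0 Th t w.
Proof. by move=> TI tI; rewrite (bond_ratio_price w TI tI) expR_gt0. Qed.

End bond_prices.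

Theorem theorem2p9 (R : realType) (d : measure_display)
    (Omega : measurableType d) (P : probability Omega R)
    (Fil : R -> set (set Omega)) (B : R -> Omega -> R)
    (Th : R) (P0 : R -> R)
    (filF : is_filtration Fil) (bmB : brownian_motion P Fil B)
    (Th_gt0 : 0 < Th) (curveP0 : initial_bond_curve Th P0) :
  [/\ forall T, 0 < T <= Th ->
        semimartingale P Fil T (bond B Th P0 T),
      forall T, 0 < T <= Th ->
        (forall t w, 0 <= t <= T ->
           0 < bond B Th P0 T t w / bond B Th P0 Th t w) /\
        local_martingale P Fil T
          (fun t w => bond B Th P0 T t w / bond B Th P0 Th t w)
    & {within `[0, Th], continuous (forward_curve Th P0)} ->
      {in `[0, Th] &, forall S T, S < T ->
         forward_curve Th P0 T < forward_curve Th P0 S} ->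
      forward_curve Th P0 0 = - ln (P0 Th) ->
      forall T1 T2 t w, 0 <= t -> t <= T1 -> T1 < T2 -> T2 <= Th ->
        0 < forward_rate B Th P0 T1 T2 t w].
Proof.
split=> [T TI|T TI|_ fdecr _ T1 T2 t w t0 tT1 T12 T2h].
- exact: bond_semimartingale.
- split=> [t w /andP[t0 tT]|]; last exact: bond_ratio_local_martingale.
  case/andP: TI => T0 TTh; have TI : 0 <= T <= Th by rewrite ltW.
  have tI : 0 <= t <= Th by rewrite t0 (le_trans tT).
  exact: (bond_ratio_gt0 bmB Th_gt0 curveP0 w TI tI).
- exact: forward_rate_gt0.
Qed.
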